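(* Let $m\ge 0$ and $p\ge 1$ be integers. Then for every integer $N\ge 1$ the $N$th colored Jones polynomial of the double twist knot $K_{(-m,p)}$ is $$ \begin{aligned} J_N(K_{(-m,p)};q) = {}& q^{p(1-N)}\sum_{N-1\ge n_{(2m+1)p}\ge\cdots\ge n_1\ge 0} (q^{1-N})_{n_{(2m+1)p}}\,q^{Nn_{(2m+1)p}}\,q^{-2\binom{n_{(2m+1)p}+1}{2}}\\ &\times \prod_{\substack{1\le i<j\le (2m+1)p\\ (2m+1)\nmid i\\ j\not\equiv m+1 \ (\mathrm{mod}\ 2m+1)}} q^{\Delta_{i,j,m}n_in_j}\ \prod_{\substack{1\le i\le (2m+1)p\\ i\equiv m+1\ (\mathrm{mod}\ 2m+1)}} (-1)^{n_i}q^{-Nn_i+\binom{n_i+1}{2}}\\ &\times \prod_{\substack{1\le i\le (2m+1)p\\ i\equiv 2m+1\ (\mathrm{mod}\ 2m+1)}} (-1)^{n_i}q^{-Nn_i+\binom{n_i+1}{2}}\ \prod_{i=1}^{(2m+1)p-1} q^{\beta_{i,m}n_i}\begin{bmatrix} n_{i+1}\\ n_i\end{bmatrix}. \end{aligned} $$ (When $m\ge 1$ this is the same as $$ \begin{aligned} J_N(K_{(-m,p)};q) = {}& q^{p(1-N)}\sum_{N-1\ge n_{(2m+1)p}\ge\cdots\ge n_1\ge 0} (q^{1-N})_{n_{(2m+1)p}}(-1)^{n_{(2m+1)p}}q^{-\binom{n_{(2m+1)p}+1}{2}}\\ &\times \prod_{\substack{1\le i<j\le (2m+1)p\\ (2m+1)\nmid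 i\\ j\not\equiv m+1 \ (\mathrm{mod}\ 2m+1)}} q^{\Delta_{i,j,m}n_in_j}\ \prod_{\substack{1\le i\le (2m+1)p-1\\ i\equiv m+1\text{ or }2m+1\ (\mathrm{mod}\ 2m+1)}} (-1)^{n_i}q^{-Nn_i+\binom{n_i+1}{2}}\ \prod_{i=1}^{(2m+1)p-1} q^{\beta_{i,m}n_i}\begin{bmatrix} n_{i+1}\\ n_i\end{bmatrix}.) \end{aligned} $$ Here, for $1\le i<j\le (2m+1)p$ with $(2m+1)\nmid i$ and $j\not\equiv m+1\pmod{2m+1}$, $$ \Delta_{i,j,m}=\begin{cases}1 & \text{if } j\equiv -i \text{ or } -i+1 \pmod{2m+1},\\ -1 & \text{if } j\equiv i\text{ or } i+1\pmod{2m+1},\\ 0&\text{otherwise,}\end{cases} $$ and, for $m\ge 1$ and $1\le i\le (2m+1)p-1$, $$ \beta_{i,m}=\begin{cases}1 & \text{if } i\equiv 1,\dots,m\pmod{2m+1},\\ -1&\text{if } i\equiv m+1,\dots,2m\pmod{2m+1},\\ 0&\text{if } i\equiv 0\pmod{2m+1},\end{cases} $$ while $\beta_{i,0}=0$ for $1\le i\le p-1$.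
   Context: Notation: $(a)_n=(a;q)_n=\prod_{k=0}^{n-1}(1-aq^k)$, and for $0\le k\le n$, $\begin{bmatrix} n\\k\end{bmatrix}=\frac{(q)_n}{(q)_{n-k}(q)_k}$, where $(q)_n=(q;q)_n$. Empty products equal $1$. When $m=0$ the congruences are modulo $1$, hence always satisfied (so the product over pairs $i<j$ is empty and the two products over $i\equiv m+1$ and $i\equiv 2m+1$ both run over all $1\le i\le p$). Knots: $K_{(m,p)}$ ($m,p\in\mathbb{Z}$, $p\neq 0$) is the double twist knot with two twist regions having $2m-1$ and $2p$ half-twists respectively, positive integers meaning right-handed and negative integers left-handed half-twists. In terms of 2-bridge knots $\mathfrak{b}(l,t)$: for integers $m\ge 0$, $p\ge 1$ one has $K_{(m+1,p)}=\mathfrak{b}(4mp+2p-1,\,4mp-1)$ and $K_{(m+1,-p)}=\mathfrak{b}(4mp+2p+1,\,4mp+1)$; the mirror image of $K_{(m+1,p)}$ is $K_{(-m,-p)}$ and the mirror image of $K_{(m+1,-p)}$ is $K_{(-m,p)}$. Here $\mathfrak{b}(l,t)$ is the 2-bridge knot whose double branched cover is the lens space $L(l,t)$, with the chirality convention that $\mathfrak{b}(2p+1,1)=K_{(1,-p)}$ is the left-handed torus knot $T(2,2p+1)$ (so $K_{(0,p)}$ is the right-handed one), and $\mathfrak{b}(l,-t)$ is the mirror image of $\mathfrak{b}(l,t)$. Colored Jones polynomial: $J_N(K;q)$ is the usual $N$th colored Jones polynomial of $K$ (coloring by the $N$-dimensional irreducible representation of quantum $\mathfrak{sl}_2$, zero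 framing), normalized to be $1$ for the unknot. With $K^*$ the mirror image of $K$, $J_N(K;q^{-1})=J_N(K^*;q)$. The convention for $q$ versus $q^{-1}$ is the one in which the right-handed trefoil has $J_2=q^{-1}+q^{-3}-q^{-4}$. *)

(* Defs.v *)
From HB Require Import structures.
From mathcomp Require Import all_boot all_order all_algebra.

Set Implicit Arguments.
Unset Strict Implicit.
Unset Printing Implicit Defensive.

Import GRing.Theory.
Local Open Scope ring_scope.

(* The colored Jones polynomial lies in Z[q, q^-1], but the R-matrix and the
   framing factor involve q^(1/4).  We work in Q(t), with t an indeterminate and
   q = t^4, so that the standard parameter of U_q(sl2) is v = q^(1/2) = t^2. *)
Definition Qt : fieldType := {fraction {poly rat}}.
Definition t : Qt := tofrac 'X.
Definition q : Qt := t ^+ 4.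

(* * The quantum group U_q(sl2): generators E, F, K = v^H with
     [E, F] = (K - K^-1) / (v - v^-1),
     Delta E = E (x) K + 1 (x) E,   Delta F = F (x) 1 + K^-1 (x) F,
     S(E) = - E K^-1,   S(F) = - K F,   S(K) = K^-1. *)

Definition quantum_int (n : nat) : Qt := (t ^+ n.*2 - t ^- n.*2) / (t ^+ 2 - t ^- 2).

Definition quantum_fact (n : nat) : Qt := \prod_(1 <= k < n.+1) quantum_int k.

(* The N-dimensional irreducible module V has basis e_0, ..., e_(N-1), with
     H e_i = (N - 1 - 2 i) e_i,  E e_i = [N - i] e_(i-1),  F e_i = [i + 1] e_(i+1).
   Matrices act on column vectors: the coefficient of e_a in X e_b is X a b. *)
Definition matE (N : nat) : 'M[Qt]_N :=
  \matrix_(a, b) (if b == a.+1 :> nat then quantum_int (N - b) else 0).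

Definition matF (N : nat) : 'M[Qt]_N :=
  \matrix_(a, b) (if a == b.+1 :> nat then quantum_int a else 0).

(* Orientations of strands: true = upward, coloured by V; false = downward,
   coloured by the dual V*, on which x acts by the transpose of S(x), in the
   basis dual to (e_i). *)
Definition weight (N : nat) (up : bool) (i : 'I_N) : int :=
  if up then N%:Z - 1 - 2 * i%:Z else - (N%:Z - 1 - 2 * i%:Z).

Definition matK (N : nat) (z : int) : 'M[Qt]_N :=
  \matrix_(a, b) (if a == b then t ^ (2 * z * weight true a) else 0).

Definition actE (N : nat) (up : bool) : 'M[Qt]_N :=
  if up then matE N else - (matE N *m matK N (-1))^T.

Definition actF (N : nat) (up : bool) : 'M[Qt]_N :=
  if up then matF N else - (matK N 1 *m matF N)^T.

(* Universal R-matrix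
     R = v^(H (x) H / 2) sum_n v^(n(n-1)/2) (v - v^-1)^n / [n]! E^n (x) F^n;
   the sum stops at n < N because E^N = 0 on V and on V*.
   [Rmx l r a b c d] is the coefficient of e_c (x) e_d in R (e_a (x) e_b), where
   l and r are the orientations of the two factors; [Rmx_inv] is the same for
   R^-1 = (sum_n (-1)^n v^(-n(n-1)/2) (v - v^-1)^n / [n]! E^n (x) F^n)
            v^(- H (x) H / 2). *)
Definition Rmx (N : nat) (l r : bool) (a b c d : 'I_N) : Qt :=
  t ^ (weight l c * weight r d) *
  \sum_(n < N) t ^+ (n * n.-1) * (t ^+ 2 - t ^- 2) ^+ n / quantum_fact n *
    (actE N l ^+ n) c a * (actF N r ^+ n) d b.

Definition Rmx_inv (N : nat) (l r : bool) (a b c d : 'I_N) : Qt :=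
  t ^ (- (weight l a * weight r b)) *
  \sum_(n < N) (-1) ^+ n * t ^- (n * n.-1) * (t ^+ 2 - t ^- 2) ^+ n /
    quantum_fact n * (actE N l ^+ n) c a * (actF N r ^+ n) d b.

(* * Oriented tangle diagrams, as words of elementary slices read from bottom to
   top; [i] is the number of strands to the left of the slice.
   - [Cup i d] creates strands i and i+1 (a local minimum), the left one being
     upward iff d;
   - [Cap i] joins strands i and i+1 (a local maximum);
   - [Cross i rh] crosses strands i and i+1.  If rh, the strand going from bottom
     left to top right is the over strand: this is a right-handed half-twist
     about the vertical axis, i.e. a positive crossing when the two strands are
     parallel and a negative one when they are antiparallel.  Otherwise it is
     the under strand. *)
Inductive slice :=
  | Cup of nat & bool
  | Cap of nat
  | Cross of nat & bool.

Definition diagram := seq slice.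

Definition dir (o : seq bool) (i : nat) : bool := nth true o i.

(* Orientations of the strands above a slice, from those below it. *)
Definition next_dirs (o : seq bool) (s : slice) : seq bool :=
  match s with
  | Cup i d => take i o ++ [:: d; ~~ d] ++ drop i o
  | Cap i => take i o ++ drop i.+2 o
  | Cross i _ => take i o ++ [:: dir o i.+1; dir o i] ++ drop i.+2 o
  end.

Definition slice_sign (o : seq bool) (s : slice) : int :=
  if s is Cross i rh then
    if rh == (dir o i == dir o i.+1) then 1 else -1
  else 0.

Fixpoint writhe (o : seq bool) (D : diagram) : int :=
  if D is s :: D' then slice_sign o s + writhe (next_dirs o s) D' else 0.

(* Coevaluations  1 -> V (x) V*  (d = true) and  1 -> V* (x) V,  the latter
   through the pivotal element K^-1. *)
Definition cup_coef (N : nat) (d : bool) (a b : 'I_N) : Qt :=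
  if a == b then (if d then 1 else t ^ (- 2 * weight true a)) else 0.

(* Evaluations  V (x) V* -> 1,  e_a (x) f |-> f (K e_a)  (l = true), and
   V* (x) V -> 1. *)
Definition cap_coef (N : nat) (l : bool) (a b : 'I_N) : Qt :=
  if a == b then (if l then t ^ (2 * weight true a) else 1) else 0.

(* Coefficient of e_c (x) e_d in the image of e_a (x) e_b, where l and r are the
   orientations of the strands below the crossing: the braiding (flip o R) if
   rh, and the inverse braiding (R^-1 o flip) otherwise. *)
Definition cross_coef (N : nat) (rh l r : bool) (a b c d : 'I_N) : Qt :=
  if rh then Rmx l r a b d c else Rmx_inv r l b a c d.

(* The Reshetikhin-Turaev functor.  A vector of a tensor product of copies of V
   and V* is given by its coordinates, a function of the sequence of indices of
   basis vectors. *)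
Definition apply_slice (N : nat) (o : seq bool) (s : slice)
    (psi : seq 'I_N -> Qt) (x : seq 'I_N) : Qt :=
  match s with
  | Cup i d =>
      if drop i x is a :: b :: r then cup_coef d a b * psi (take i x ++ r) else 0
  | Cap i =>
      \sum_(a < N) \sum_(b < N)
        cap_coef (dir o i) a b * psi (take i x ++ [:: a, b & drop i x])
  | Cross i rh =>
      if drop i x is c :: d :: r then
        \sum_(a < N) \sum_(b < N)
          cross_coef rh (dir o i) (dir o i.+1) a b c d *
          psi (take i x ++ [:: a, b & r])
      else 0
  end.

Fixpoint RT (N : nat) (o : seq bool) (D : diagram) (psi : seq 'I_N -> Qt)
    : seq 'I_N -> Qt :=
  if D is s :: D' then RT (next_dirs o s) D' (apply_slice o s psi) else psi.

(* A knot is presented by a long diagram: a tangle diagram with one upward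
   strand at the bottom and one at the top, whose closure is the knot.  Its
   invariant is an endomorphism of the simple module V, hence a scalar (read here
   on e_0), which is the invariant of the closed diagram divided by that of the
   unknot.  A positive kink acts on V by q^((N^2-1)/4) = t^(N^2-1), so the last
   factor corrects the framing to zero.  The value at N = 0 is junk. *)
Definition colored_jones (N : nat) (D : diagram) : Qt :=
  if N is n.+1 then
    RT [:: true] D (fun x : seq 'I_n.+1 => if x == [:: ord0] then 1 else 0)
      [:: ord0]
    * t ^ (- (writhe [:: true] D * (N%:Z ^+ 2 - 1)))
  else 0.

(* k half-twists of strands i and i+1, right-handed if k > 0, left-handed if
   k < 0. *)
Definition half_twists (i : nat) (k : int) : diagram :=
  nseq `|k|%N (Cross i (0 < k)).

(* The double twist knot K_(m,p): 2p half-twists of strands 0 and 1 (parallel),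
   followed by 2m-1 half-twists of strands 1 and 2 (antiparallel). *)
Definition double_twist (m p : int) : diagram :=
  [:: Cup 1 true] ++ half_twists 0 (2 * p) ++ half_twists 1 (2 * m - 1)
    ++ [:: Cap 0].

(* * q-series *)

Definition qpoch (a : Qt) (n : nat) : Qt := \prod_(0 <= k < n) (1 - a * q ^+ k).

Definition qbinom (n k : nat) : Qt := qpoch q n / (qpoch q (n - k) * qpoch q k).

Definition Delta (i j m : nat) : int :=
  let d := (2 * m + 1)%N in
  if (i + j == 0 %[mod d])%N || (i + j == 1 %[mod d])%N then 1
  else if (j == i %[mod d])%N || (j == i + 1 %[mod d])%N then -1
  else 0.

Definition beta (i m : nat) : int :=
  let r := (i %% (2 * m + 1))%N in
  if (1 <= r <= m)%N then 1 else if (m + 1 <= r <= 2 * m)%N then -1 else 0.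

(* Index tuples (n_1, ..., n_M) with N - 1 >= n_M >= ... >= n_1 >= 0, and their
   entries, numbered from 1. *)
Definition nondecreasing (N M : nat) (n : M.-tuple 'I_N) : bool :=
  sorted leq [seq val x | x <- n].

Definition entry (N M : nat) (n : M.-tuple 'I_N) (i : nat) : nat :=
  nth 0%N [seq val x | x <- n] i.-1.

(* Main.v *)
Require Import Defs.
From HB Require Import structures.
From mathcomp Require Import all_boot all_order all_algebra.
From mathcomp Require Import ring zify.

Set Implicit Arguments.
Unset Strict Implicit.
Unset Printing Implicit Defensive.

Import GRing.Theory.
Local Open Scope ring_scope.

(* View K_(-m,p) as the closure of a tangle on strands V, V, V*: a cup, p full twists of the two
   parallel strands, m + 1/2 full twists of the two antiparallel ones, a cap.  The state is a vector
   killed by E, hence determined by its coordinates psi(x,0,x); on them the braidings collapse, by the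
   q-binomial theorem, to explicit triangular matrices T (parallel full twist) and S (antiparallel full
   twist), and J_N is a matrix coefficient eta_0 S^m T^p delta_0.  The row eta_0 extends to a family
   eta_K stable under S, and a bidiagonal matrix commuting with T shows that eta_K T^p delta_0 =
   eta_0 T^p u_K for explicit columns u_K; this turns J_N into a sum over chains c_1 >= ... >= c_m.
   On the other side, summing the multisum one period n_1, ..., n_(2m+1) at a time, with the earlier
   indices fixed, reproduces a chain sum of the same shape with eta_0 T^p replaced by eta_0 T^(p+1),
   by q-Vandermonde summations; induction on p identifies the two. *)

(** The multisum couples each index to almost all earlier ones, so its periods do not separate, and
    the induction on [p] needs a closed form valid after an arbitrary beginning of the index
    sequence. A symmetry keeps this form small: the reflection $j\mapsto 1-j$ modulo $2m+1$ changes
    the sign of $\Delta_{i,j,m}$, and its only fixed residue is $m+1$, the one that the exponents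
    omit. Hence the past acts only through its last entry and through $m$ linear forms, one for each
    residue $1,\dots,m$; these are the parameters of the chain sums, and they vanish for the empty
    past, the case met by the knot. The braidings collapse for two reasons. A half-twist takes the
    coordinates (x,0,x) to (0,x,x) or (x,x,0) diagonally, because no positive power of F produces
    $e_0$. On the way back, powers of E become $q$-difference operators on the coordinates, because
    E kills the state. The identity between $\eta_K$ and $u_K$ is proved by induction on $K$, not on
    $p$: it holds for every matrix that commutes with the bidiagonal one. *)

Definition tri (n : nat) : int := 'C(n.+1, 2)%:Z.

Lemma triS n : tri n.+1 = tri n + n%:Z + 1.
Proof. by rewrite /tri binS bin1; lia. Qed.

Lemma tri0 : tri 0 = 0. Proof. by []. Qed.

Lemma triD m n : tri (m + n) = tri m + tri n + m%:Z * n%:Z.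
Proof. by elim: n => [|n IH]; rewrite ?addn0 ?addnS ?tri0 ?triS ?IH; lia. Qed.

Lemma tri2 n : 2 * tri n = n%:Z * n%:Z + n%:Z.
Proof. by elim: n => [|n IH]; rewrite ?tri0 // triS; lia. Qed.

(** * Sums over tuples, residues modulo $2m+1$, telescoping *)

Lemma big_tuple_cons (R : nmodType) (T : finType) k (G : k.+1.-tuple T -> R) :
  \sum_n G n = \sum_(a : T) \sum_(n : k.-tuple T) G [tuple of a :: n].
Proof.
rewrite pair_big /= (reindex (fun p : T * k.-tuple T => [tuple of p.1 :: p.2])) //=.
exists (fun n => (thead n, [tuple of behead n])) => [[a n]|n] _ /=.
  by congr (_, _); apply: val_inj.
by rewrite [RHS]tuple_eta; apply: val_inj.
Qed.

Lemma sorted_path0 (l : seq nat) : path leq 0 l = sorted leq l.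
Proof. by case: l. Qed.

Lemma iter_double (T : Type) (f : T -> T) p x : iter (2 * p) f x = iter p (fun y => iter 2 f y) x.
Proof. by elim: p => [|p IH]; rewrite ?muln0 // mulnS iterD IH. Qed.

Lemma modn_lt2 d u : (u < d + d)%N -> (u %% d = if u < d then u else u - d)%N.
Proof.
move=> lt_u; have [lt_ud|le_du] := ltnP u d; first by rewrite modn_small.
by rewrite -{1}(subnK le_du) modnDr modn_small //; lia.
Qed.

(** Representatives taken in one period turn the congruences into equalities: [r + x] lies strictly
    between 1 and [2 * d], so it is 0 or 1 modulo [d] only as [d] or [d.+1]. *)
Lemma Delta_residues m tau sigma r x : let d := (2 * m + 1)%N in (0 < r < d)%N -> (0 < x <= d)%N -> x != m.+1 ->
  Delta (d * tau + r) (d * sigma + x) m =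
  if (r + x == d)%N || (r + x == d.+1)%N then 1 else if (x == r) || (x == r.+1) then -1 else 0.
Proof.
move=> d Hr Hx Hxm; rewrite /Delta -/d.
have -> : (d * tau + r + (d * sigma + x) = (tau + sigma) * d + (r + x))%N by ring.
have -> : (d * tau + r + 1 = tau * d + r.+1)%N by lia.
have -> : (d * tau + r = tau * d + r)%N by lia.
have -> : (d * sigma + x = sigma * d + x)%N by lia.
rewrite !modnMDl mod0n.
have -> : ((r + x) %% d == 0)%N = (r + x == d)%N.
  by rewrite modn_lt2; last lia; case: ltnP => ?; lia.
have -> : ((r + x) %% d == 1 %% d)%N = (r + x == d.+1)%N.
  rewrite modn_lt2; last lia.
  by have [d1|d1] := eqVneq d 1%N; [|rewrite (modn_small (m := 1%N)); last lia]; [|case: ltnP => ?]; lia.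
have -> : (x %% d == r %% d)%N = (x == r).
  rewrite (modn_small (m := r)); last lia.
  by rewrite modn_lt2; last lia; case: ltnP => ?; lia.
have -> // : (x %% d == r.+1 %% d)%N = (x == r.+1).
by rewrite !modn_lt2; try lia; do 2?case: ltnP => ?; lia.
Qed.

Lemma telescope_shift (V : zmodType) n (P Q : nat -> V) :
  P 0%N = 0 -> (forall k, P k.+1 = Q k) -> Q n = 0 -> \sum_(k < n.+1) P k = \sum_(k < n.+1) Q k.
Proof.
move=> P0 PQ Qn; rewrite big_ord_recl P0 add0r [RHS]big_ord_recr /= Qn addr0.
by apply: eq_bigr => i _; rewrite /= PQ.
Qed.

Lemma sum_sub_add (V : zmodType) n (A B C D P Q : 'I_n -> V) :
  (forall k, A k - C k = P k) -> (forall k, D k - B k = Q k) -> \sum_k P k = \sum_k Q k ->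
  \sum_k (A k + B k) = \sum_k C k + \sum_k D k.
Proof.
move=> HP HQ H; apply/eqP; rewrite -big_split /= -subr_eq0 -sumrB; apply/eqP.
move/eqP: H; rewrite -subr_eq0 -sumrB => /eqP H; rewrite -[RHS]H; apply: eq_bigr => k _.
by rewrite -HP -HQ !opprD !opprK !addrA; do ?[rewrite (addrAC _ (B k)) | done].
Qed.

(** * Basic hypergeometric identities *)

Section QSeries.
Import Order.TTheory Num.Theory.
Variables (F : fieldType) (q : F) (N : nat).
Hypotheses (q0 : q != 0) (qn1 : forall k, q ^+ k.+1 != 1).

Lemma qzD (x y : int) : q ^ (x + y) = q ^ x * q ^ y.
Proof. exact: expfzDr. Qed.

(* Used as [apply: (lincomb (c := c) E); ring]: the goal is [c] times the identity [E], up to ring axioms. *)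
Lemma lincomb (c x y u v : F) : u = v -> x - y = c * (u - v) -> x = y.
Proof. by move=> ->; rewrite subrr mulr0 => /subr0_eq. Qed.

(** Gaussian binomials by Pascal's rule rather than as quotients: they vanish for [n < k], so sums
    may run over any larger range, and inductions need no division. [gbE] recovers the quotient. *)
Fixpoint gb (n k : nat) : F :=
  match n, k with
  | _, 0 => 1
  | 0, _.+1 => 0
  | n'.+1, k'.+1 => gb n' k' + q ^+ k'.+1 * gb n' k'.+1
  end.

Lemma gbn0 n : gb n 0 = 1. Proof. by case: n. Qed.

Lemma gbS n k : gb n.+1 k.+1 = gb n k + q ^+ k.+1 * gb n k.+1.
Proof. by []. Qed.

Lemma gb_small n k : (n < k)%N -> gb n k = 0.
Proof.
elim: n k => [|n IH] [|k] //= lt_nk.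
by rewrite !IH ?mulr0 ?addr0 // ltnW.
Qed.

Lemma gbnn n : gb n n = 1.
Proof. by elim: n => //= n ->; rewrite gb_small // mulr0 addr0. Qed.

Arguments gb n k : simpl never.

Definition pch (a : F) (n : nat) : F := \prod_(0 <= k < n) (1 - a * q ^+ k).

Lemma pch0 a : pch a 0 = 1. Proof. by rewrite /pch big_nil. Qed.

Lemma pchS a n : pch a n.+1 = pch a n * (1 - a * q ^+ n).
Proof. by rewrite /pch big_nat_recr. Qed.

Lemma pchSl a n : pch a n.+1 = (1 - a) * pch (a * q) n.
Proof.
rewrite /pch big_nat_recl // expr0 mulr1; congr (_ * _).
by apply: eq_bigr => i _; rewrite exprS mulrA.
Qed.

Lemma qfS n : pch q n.+1 = pch q n * (1 - q ^+ n.+1).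
Proof. by rewrite pchS exprS. Qed.

Lemma sub1q_neq0 k : 1 - q ^+ k.+1 != 0.
Proof. by rewrite subr_eq0 eq_sym qn1. Qed.

Lemma qf_neq0 n : pch q n != 0.
Proof. by elim: n => [|n IH]; rewrite ?pch0 ?oner_eq0 // qfS mulf_neq0 // sub1q_neq0. Qed.

Lemma gb_fact a b : gb (a + b) a * pch q a * pch q b = pch q (a + b).
Proof.
move En: (a + b)%N => n; elim: n a b En => [|n IH] a b.
  by case: a => //; case: b => // _; rewrite gbn0 !pch0 !mul1r.
case: a => [|a]; first by rewrite add0n => ->; rewrite gbn0 pch0 !mul1r.
rewrite addSn => - [] En; rewrite gbS qfS.
case: b En => [|b] En.
  rewrite addn0 in En; subst a; rewrite (@gb_small n n.+1) // mulr0 addr0 gbnn pch0 qfS; ring.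
have H1 := IH _ _ En; rewrite addnS in En.
have H2 : gb n a.+1 * pch q a.+1 * pch q b = pch q n by apply: IH; rewrite addSn.
rewrite qfS in H2 *; rewrite !qfS in H1 *.
have -> : (n.+1 = a.+1 + b.+1)%N by rewrite -En addSn addnS.
rewrite mulrDr exprD.
transitivity ((gb n a * pch q a * (pch q b * (1 - q ^+ b.+1))) * (1 - q ^+ a.+1) +
  q ^+ a.+1 * (gb n a.+1 * (pch q a * (1 - q ^+ a.+1)) * pch q b) * (1 - q ^+ b.+1)).
  ring.
rewrite H1 H2; ring.
Qed.

Lemma gbE a b : gb (a + b) a = pch q (a + b) / (pch q b * pch q a).
Proof.
apply: (mulIf (mulf_neq0 (qf_neq0 b) (qf_neq0 a))).
rewrite divfK ?mulf_neq0 ?qf_neq0 // -(gb_fact a b); ring.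
Qed.

Lemma gb_sym a b : gb (a + b) a = gb (a + b) b.
Proof. by rewrite gbE addnC gbE addnC mulrC [in RHS]mulrC; congr (_ * _); rewrite mulrC. Qed.

Lemma gbS' n k : (k <= n)%N -> gb n.+1 k.+1 = q ^+ (n - k) * gb n k + gb n k.+1.
Proof.
rewrite leq_eqVlt => /predU1P[->|lt_kn].
  by rewrite subnn expr0 mul1r !gbnn gb_small // addr0.
have -> : n = (k.+1 + (n - k.+1))%N by rewrite subnKC.
move: (n - k.+1)%N => j {n lt_kn}.
have -> : (k.+1 + j - k = j.+1)%N by rewrite addSnnS addKn.
have E1 : gb (k.+1 + j).+1 k.+1 = gb (j.+1 + k.+1) j.+1.
  by rewrite -addnS gb_sym addnC.
have E2 : gb (k.+1 + j) k = gb (j.+1 + k) j.+1.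
  by rewrite addSnnS gb_sym addnC.
have E3 : gb (k.+1 + j) k.+1 = gb (j + k.+1) j by rewrite gb_sym addnC.
rewrite E1 E2 E3 addSn gbS addSnnS; ring.
Qed.

(** * Products and sums of Gaussian binomials *)

Lemma gb_mul j a b : gb (j + a + b) (j + a) * gb (j + a) j = gb (j + a + b) j * gb (a + b) a.
Proof.
rewrite gbE (gbE j a) (gbE a b) -addnA (gbE j (a + b)).
have := qf_neq0 (j + a); have := qf_neq0 j; have := qf_neq0 a; have := qf_neq0 b.
have := qf_neq0 (a + b); move: (pch q _) (pch q _) (pch q _) (pch q _) (pch q _) (pch q _).
move=> x1 x2 x3 x4 x5 x6 ? ? ? ? ?; field.
by do ?[apply/andP; split].
Qed.

Lemma gb_mulE n k j : (j <= k)%N -> gb n k * gb k j = gb n j * gb (n - j) (k - j).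
Proof.
move=> le_jk; have [lt_nk|le_kn] := ltnP n k.
  rewrite gb_small // mul0r; case: (ltnP n j) => [lt_nj|le_jn].
    by rewrite gb_small // mul0r.
  by rewrite (@gb_small (n - j)) ?mulr0 // ltn_sub2r // (leq_ltn_trans le_jn).
have -> : k = (j + (k - j))%N by rewrite subnKC.
have -> : n = (j + (k - j) + (n - k))%N by rewrite subnKC // subnKC.
by rewrite gb_mul -!addnA !addKn.
Qed.

(** Pascal's rule as a summation by parts; with [gb_sum_rec'], which uses the other Pascal rule, it
    drives the inductions on the upper index below. *)
Lemma gb_sum_rec m (X : nat -> F) :
  \sum_(0 <= k < m.+2) gb m.+1 k * X k =
  \sum_(0 <= k < m.+1) gb m k * (q ^+ k * X k + X k.+1).
Proof.
rewrite big_nat_recl // gbn0.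
under eq_big_nat => k _ do rewrite gbS mulrDl.
rewrite big_split /=.
have -> : \sum_(0 <= k < m.+1) q ^+ k.+1 * gb m k.+1 * X k.+1 =
    \sum_(0 <= k < m.+1) gb m k * (q ^+ k * X k) - X 0%N.
  rewrite [in RHS]big_nat_recl // gbn0 expr0 !mul1r [RHS]addrC addKr.
  rewrite big_nat_recr //= gb_small // mulr0 mul0r addr0.
  by apply: eq_bigr => k _; ring.
transitivity (\sum_(0 <= k < m.+1) gb m k * (q ^+ k * X k) + \sum_(0 <= k < m.+1) gb m k * X k.+1).
  ring.
by rewrite -big_split /=; apply: eq_bigr => k _; ring.
Qed.

Lemma gb_sum_rec' m (X : nat -> F) :
  \sum_(0 <= k < m.+2) gb m.+1 k * X k =
  \sum_(0 <= k < m.+1) gb m k * (X k + q ^+ (m - k) * X k.+1).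
Proof.
rewrite big_nat_recl // gbn0.
under eq_big_nat => k /andP[_ lt_km] do rewrite gbS' // mulrDl.
rewrite big_split /=.
have -> : \sum_(0 <= k < m.+1) gb m k.+1 * X k.+1 =
    \sum_(0 <= k < m.+1) gb m k * X k - X 0%N.
  rewrite [in RHS]big_nat_recl // gbn0 !mul1r [RHS]addrC addKr.
  by rewrite big_nat_recr //= gb_small // mul0r addr0.
transitivity (\sum_(0 <= k < m.+1) gb m k * X k +
    \sum_(0 <= k < m.+1) q ^+ (m - k) * gb m k * X k.+1).
  ring.
by rewrite -big_split /=; apply: eq_bigr => k _; ring.
Qed.

(** The $q$-Chu-Vandermonde sum ${}_2\phi_1(q^{-m},a;0;q,q)=a^m$, with $(q^{-m})_k/(q)_k$ written
    through Gaussian binomials. At $a=0$ it says that an alternating sum vanishes. *)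
Lemma gb_pch_sum (a : F) m :
  \sum_(0 <= k < m.+1) gb m k * ((-1) ^+ k * q ^ (tri k - m%:Z * k%:Z) * pch a k) = a ^+ m.
Proof.
elim: m a => [|m IH] a; first by rewrite big_nat1 expr0 gbn0 pch0 expr0z !mulr1.
rewrite gb_sum_rec; under eq_bigr => k _ do rewrite mulrDr.
rewrite big_split /=.
have -> : \sum_(0 <= k < m.+1) gb m k *
    (q ^+ k * ((-1) ^+ k * q ^ (tri k - m.+1%:Z * k%:Z) * pch a k)) = a ^+ m.
  rewrite -[RHS]IH; apply: eq_bigr => k _; rewrite [q ^+ k]exprnP.
  have : q ^ k%:Z * q ^ (tri k - m.+1%:Z * k%:Z) = q ^ (tri k - m%:Z * k%:Z).
    by rewrite -qzD; congr (q ^ _); lia.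
  by move=> E; apply: (lincomb (c := gb m k * (-1) ^+ k * pch a k) E); ring.
have -> : \sum_(0 <= k < m.+1) gb m k *
    ((-1) ^+ k.+1 * q ^ (tri k.+1 - m.+1%:Z * k.+1%:Z) * pch a k.+1) =
    - (1 - a) * q ^ (- m%:Z) * (a * q) ^+ m.
  rewrite -(IH (a * q)) big_distrr /=; apply: eq_bigr => k _; rewrite pchSl exprS.
  have : q ^ (tri k.+1 - m.+1%:Z * k.+1%:Z) = q ^ (- m%:Z) * q ^ (tri k - m%:Z * k%:Z).
    by rewrite -qzD; congr (q ^ _); rewrite triS; lia.
  by move=> E; apply: (lincomb (c := - gb m k * (-1) ^+ k * (1 - a) * pch (a * q) k) E); ring.
have : q ^ (- m%:Z) * q ^+ m = 1 by rewrite exprnP -qzD addNr expr0z.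
rewrite exprMn exprS => E; apply: (lincomb (c := - (1 - a) * a ^+ m) E); ring.
Qed.

(** An integer lower index, with value zero out of range, frees the Vandermonde convolutions from
    bounds on differences such as [m - i]. *)
Definition gbz (n : nat) (z : int) : F := if z is Posz k then gb n k else 0.

Lemma gbz_nat n k : gbz n k%:Z = gb n k. Proof. by []. Qed.

Lemma gbz_neg n (z : int) : (z < 0)%R -> gbz n z = 0.
Proof. by case: z. Qed.

Lemma gbz_big n (z : int) : (n%:Z < z)%R -> gbz n z = 0.
Proof. by case: z => // k; rewrite ltz_nat => /gb_small. Qed.

Lemma gbzS n (z : int) : gbz n.+1 z = gbz n (z - 1) + q ^ z * gbz n z.
Proof.
case: z => [[|k]|k]; first by rewrite (@gbz_neg n (0 - 1)) // expr0z !gbz_nat !gbn0 mul1r add0r.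
- by have -> : k.+1%:Z - 1 = k%:Z by lia.
- by rewrite !gbz_neg // ?mulr0 ?addr0 //; lia.
Qed.

Lemma gbz_sym n (z : int) : gbz n (n%:Z - z) = gbz n z.
Proof.
have [z_lt0|] := ltP z 0; first by rewrite gbz_big ?gbz_neg //; lia.
case: z => // k _; have [lt_nk|le_kn] := ltnP n k.
  by rewrite gbz_neg ?gbz_big //; lia.
have -> : n%:Z - k%:Z = (n - k)%N%:Z by lia.
by rewrite /gbz -{1 3}(subnK le_kn) gb_sym.
Qed.

Lemma gb_vandermonde (a b : nat) (m : int) :
  \sum_(0 <= i < a.+1) gb a i * (q ^ ((a%:Z - i%:Z) * (m - i%:Z)) * gbz b (m - i%:Z))
  = gbz (a + b) m.
Proof.
elim: a b => [|a IH] b; first by rewrite big_nat1 subrr mul0r expr0z subr0 !mul1r.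
rewrite gb_sum_rec' addSnnS -IH; apply: eq_big_nat => i /andP[_ lt_ia]; congr (_ * _).
have -> : m - i.+1%:Z = m - i%:Z - 1 by lia.
have E1 : q ^+ (a - i) * q ^ ((a.+1%:Z - i.+1%:Z) * (m - i%:Z - 1)) = q ^ ((a%:Z - i%:Z) * (m - i%:Z)).
  by rewrite exprnP -qzD; congr (q ^ _); lia.
have E2 : q ^ ((a.+1%:Z - i%:Z) * (m - i%:Z)) = q ^ ((a%:Z - i%:Z) * (m - i%:Z)) * q ^ (m - i%:Z).
  by rewrite -qzD; congr (q ^ _); lia.
by rewrite gbzS mulrA E1 E2; ring.
Qed.

(** The alternating companion of $q$-Vandermonde: one Pascal step solved for its first term lowers
    both indices by one, and the sum performs [a] such steps. *)
Lemma gb_vandermonde_alt (a c : nat) (b : int) : (a <= c)%N ->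
  \sum_(0 <= i < a.+1) gb a i * ((-1) ^+ i * q ^ (tri i + (b - a%:Z) * i%:Z) * gbz (c - i) b)
  = gbz (c - a) (b - a%:Z).
Proof.
elim: a b c => [|a IH] b c le_ac.
  by rewrite big_nat1 !subn0 subr0 mulr0 expr0z !mul1r.
rewrite gb_sum_rec'; case: c le_ac => // c le_ac.
rewrite subSS (_ : b - a.+1%:Z = (b - 1) - a%:Z); last by lia.
rewrite -IH //; apply: eq_big_nat => i /andP[_ lt_ia]; congr (_ * _).
have -> : (c.+1 - i = (c - i).+1)%N by lia.
rewrite subSS gbzS triS exprS.
have E1 : q ^+ (a - i) * q ^ (tri i + i%:Z + 1 + (b - 1 - a%:Z) * i.+1%:Z) =
   q ^ (tri i + (b - 1 - a%:Z) * i%:Z) * q ^ b.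
  by rewrite exprnP -!qzD; congr (q ^ _); lia.
apply: (lincomb (c := - (-1) ^+ i * gbz (c - i) b) E1); ring.
Qed.

(** Both sides satisfy $S_{m+1}(w)=wS_m(w)+(1-aw)S_m(qw)$, which is why [w] stays general in the
    induction. When $aw=1$ only the term $k=0$ survives on the right. *)
Lemma gb_pch_sym (a w : F) m :
  \sum_(0 <= k < m.+1) gb m k * (pch a k * w ^+ k) =
  \sum_(0 <= k < m.+1) gb m k * (pch (a * w) k * w ^+ (m - k)).
Proof.
elim: m w => [|m IH] w; first by rewrite !big_nat1 !pch0.
rewrite gb_sum_rec gb_sum_rec'.
transitivity (w * \sum_(0 <= k < m.+1) gb m k * (pch a k * w ^+ k) +
  (1 - a * w) * \sum_(0 <= k < m.+1) gb m k * (pch a k * (w * q) ^+ k)).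
  rewrite !mulr_sumr -big_split /=; apply: eq_bigr => k _.
  by rewrite pchS exprS exprMn; ring.
rewrite !IH !mulr_sumr -big_split /=; apply: eq_big_nat => k /andP[_ lt_km].
have -> : a * (w * q) = a * w * q by ring.
by rewrite pchSl subSS subSn // exprS exprMn; ring.
Qed.

Lemma gb_mulz n k j : (j <= n)%N -> gb n k * gb k j = gb n j * gbz (n - j) (k%:Z - j%:Z).
Proof.
move=> le_jn; have [le_jk|lt_kj] := leqP j k.
  by rewrite gb_mulE // (_ : k%:Z - j%:Z = (k - j)%N%:Z) //; lia.
by rewrite (gb_small lt_kj) gbz_neg ?mulr0 //; lia.
Qed.

Lemma gb_mulz' n k j : (j <= n)%N -> gb n k * gb k j = gb n j * gbz (n - j) (n%:Z - k%:Z).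
Proof.
move=> le_jn; rewrite gb_mulz // -(gbz_sym _ (k%:Z - j%:Z)).
by congr (_ * gbz _ _); lia.
Qed.

(** Trinomial revision leaves the summation index in a single Gaussian binomial with fixed upper
    index, the shape required by the summation formulas above. *)
Lemma gb_sum_shift n a M (X : nat -> F) : (n <= a)%N -> (a < M)%N ->
  \sum_(0 <= s < M) gb s n * gb a s * X s =
  gb a n * \sum_(0 <= i < (a - n).+1) gb (a - n) i * X (n + i)%N.
Proof.
move=> le_na lt_aM; rewrite (big_cat_nat (n := n)) //=; last by lia.
rewrite big_nat big1 ?add0r; last first.
  by move=> i /andP[_ lt_in]; rewrite gb_small // !mul0r.
rewrite (big_cat_nat (n := a.+1)) //=; last by lia.
rewrite [X in _ + X]big_nat [X in _ + X]big1 ?addr0; last first.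
  by move=> i /andP[lt_ai _]; rewrite (@gb_small a) // mulr0 mul0r.
rewrite -{1}[n]add0n big_addn subSn // mulr_sumr; apply: eq_big_nat => i _.
rewrite (addnC n) mulrA; congr (_ * _).
by rewrite mulrC gb_mulE ?leq_addl // addnK.
Qed.

(** * Truncation at [N] and the kernels of one period *)

Definition fall (a b : nat) : F := \prod_(a <= i < b) (1 - q ^ (N%:Z - 1 - i%:Z)).

Lemma fallnn a : fall a a = 1. Proof. by rewrite /fall big_geq. Qed.

Lemma fall_cat a b c : (a <= b)%N -> (b <= c)%N -> fall a b * fall b c = fall a c.
Proof. by move=> le_ab le_bc; rewrite /fall -big_cat_nat. Qed.

Lemma fallSr a b : (a <= b)%N -> fall a b.+1 = fall a b * (1 - q ^ (N%:Z - 1 - b%:Z)).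
Proof. by move=> le_ab; rewrite /fall big_nat_recr //=. Qed.

Lemma fallSl a b : (a < b)%N -> fall a b = (1 - q ^ (N%:Z - 1 - a%:Z)) * fall a.+1 b.
Proof. by move=> lt_ab; rewrite /fall big_ltn. Qed.

(** The factor with index [N - 1] is $1-q^0$. This is what lets sums cut off at [N] obey identities
    whose natural range is longer. *)
Lemma fall_zero a b : (a < N)%N -> (N <= b)%N -> fall a b = 0.
Proof.
move=> lt_aN le_Nb; have N1 : (N.-1.+1 = N)%N by lia.
rewrite -(@fall_cat a N.-1) ?(@fallSl N.-1); try lia.
have -> : N%:Z - 1 - N.-1%:Z = 0 by lia.
by rewrite expr0z subrr mul0r mulr0.
Qed.

(* The kernels arising when one period of [2m+1] indices is summed out, last index first.  For a
   weight vector [w], [ecoef] gives the closed form before the period, [hcoef] the kernel left after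
   one of its last [m] steps, [fcoef] the one after the middle step and after the first [m] steps;
   [chain_coef] and [Pcoef] couple the auxiliary indices of consecutive steps. *)
Definition chain_coef (a b : nat) : F := gb b a * q ^ (- (a%:Z * (b%:Z + 1))).

Definition ecoef (n k a : nat) : F :=
  q ^ (- N%:Z * k%:Z + a%:Z * a%:Z - a%:Z * n%:Z) * gb a n * gb (n + k) a * fall a (n + k).

Definition hcoef (n b K : nat) : F :=
  (-1) ^+ n * q ^ (- (N%:Z + b%:Z) * K%:Z + (N%:Z - 1) * b%:Z + tri n + n%:Z * b%:Z) *
  gb K (n + b) * fall (n + b) K.

Definition fcoef (r K w : nat) : F :=
  q ^ (- N%:Z * K%:Z + w%:Z * w%:Z - N%:Z * w%:Z - K%:Z * w%:Z) * gb w r * gb K w * fall w K.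

Definition Pcoef (K k : nat) : F :=
  q ^ (- (N%:Z + k%:Z) * K%:Z + (N%:Z - 1) * k%:Z) * gb K k * fall k K.

Definition twist_coef (b : nat) : F := q ^ (1 - N%:Z + b%:Z * b%:Z + b%:Z - 2 * N%:Z * b%:Z).

(** The factor [hcoef n b K] does not involve [a], so the step applies to any combination of the
    [ecoef _ _ a], that is, to an arbitrary weight vector. After recentring, the sum is
    [gb_vandermonde_alt]. *)
Lemma ecoef_S n b K a :
  \sum_(0 <= s < K.+1) gb s n * ((-1) ^+ s * q ^ (- N%:Z * s%:Z + tri s) *
      chain_coef b (K - s) * ecoef s (K - s) a) = hcoef n b K * ecoef n b a.
Proof.
have [lt_Ka|le_aK] := ltnP K a.
  rewrite big_nat big1 => [|s /andP[_ le_sK]]; last first.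
    by rewrite /ecoef subnKC // (gb_small lt_Ka); ring.
  rewrite /hcoef /ecoef; have [lt_nb|le_a] := ltnP (n + b) a.
    by rewrite (gb_small lt_nb); ring.
  by rewrite (@gb_small K) ?(leq_trans lt_Ka) //; ring.
have [lt_an|le_na] := ltnP a n.
  rewrite big_nat big1 => [|s _]; last first.
    rewrite /ecoef; have [lt_as|le_sa] := ltnP a s; first by rewrite (gb_small lt_as); ring.
    by rewrite (@gb_small s) ?(leq_ltn_trans le_sa) //; ring.
  by rewrite /ecoef (gb_small lt_an); ring.
transitivity (\sum_(0 <= s < K.+1) gb s n * gb a s * ((-1) ^+ s * q ^ (- N%:Z * s%:Z + tri s) *
   chain_coef b (K - s) * (q ^ (- N%:Z * (K - s)%N%:Z + a%:Z * a%:Z - a%:Z * s%:Z) * gb K a * fall a K))).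
  by apply: eq_big_nat => s /andP[_ le_sK]; rewrite /ecoef subnKC //; ring.
rewrite gb_sum_shift //.
transitivity (gb a n * (\sum_(0 <= i < (a - n).+1) gb (a - n) i *
   ((-1) ^+ i * q ^ (tri i + (b%:Z - (a - n)%N%:Z) * i%:Z) * gbz ((K - n) - i) b%:Z)) *
   ((-1) ^+ n * q ^ (- N%:Z * K%:Z + a%:Z * a%:Z - a%:Z * n%:Z + tri n - b%:Z * (K%:Z - n%:Z + 1)) *
   gb K a * fall a K)).
  rewrite -!mulrA; congr (_ * _); rewrite mulr_suml; apply: eq_big_nat => i /andP[_ le_i].
  rewrite /chain_coef gbz_nat subnDA triD exprD.
  have E : q ^ (- N%:Z * (n + i)%N%:Z + (tri n + tri i + n%:Z * i%:Z)) *
     q ^ (- (b%:Z * ((K - n - i)%N%:Z + 1))) *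
     q ^ (- N%:Z * (K - n - i)%N%:Z + a%:Z * a%:Z - a%:Z * (n + i)%N%:Z) =
     q ^ (tri i + (b%:Z - (a - n)%N%:Z) * i%:Z) *
     q ^ (- N%:Z * K%:Z + a%:Z * a%:Z - a%:Z * n%:Z + tri n - b%:Z * (K%:Z - n%:Z + 1)).
    rewrite -!qzD; congr (q ^ _); have -> : (K - n - i)%N%:Z = K%:Z - n%:Z - i%:Z by lia.
    have -> : (a - n)%N%:Z = a%:Z - n%:Z by lia.
    by rewrite PoszD; ring.
  by apply: (lincomb (c := gb (a - n) i * (-1) ^+ n * (-1) ^+ i * gb (K - n - i) b *
     gb K a * fall a K) E); ring.
rewrite gb_vandermonde_alt //; last by lia.
have -> : (K - n - (a - n) = K - a)%N by lia.
have -> : b%:Z - (a - n)%N%:Z = (n + b)%N%:Z - a%:Z by lia.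
have G := gb_mulz (n + b) le_aK; rewrite /hcoef /ecoef.
have [le_a|lt_a] := leqP a (n + b); last first.
  by rewrite gbz_neg ?(gb_small lt_a) //; [ring | lia].
have [le_nb|lt_nb] := leqP (n + b) K; last first.
  by rewrite gbz_big ?(gb_small lt_nb) //; [ring | lia].
rewrite -(fall_cat le_a le_nb).
have E : q ^ (- (N%:Z + b%:Z) * K%:Z + (N%:Z - 1) * b%:Z + tri n + n%:Z * b%:Z) *
   q ^ (- N%:Z * b%:Z + a%:Z * a%:Z - a%:Z * n%:Z) =
   q ^ (- N%:Z * K%:Z + a%:Z * a%:Z - a%:Z * n%:Z + tri n - b%:Z * (K%:Z - n%:Z + 1)).
  by rewrite -!qzD; congr (q ^ _); ring.
rewrite -E.
apply: (lincomb (c := - gb a n * (-1) ^+ n * fall a (n + b) * fall (n + b) K *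
  q ^ (- (N%:Z + b%:Z) * K%:Z + (N%:Z - 1) * b%:Z + tri n + n%:Z * b%:Z) *
   q ^ (- N%:Z * b%:Z + a%:Z * a%:Z - a%:Z * n%:Z)) G); ring.
Qed.

(** As in [ecoef_S], the resulting factor is free of the index [w] of the weight vector. Revising
    the product of [gb K (c + r)] and [gb (c + r) w] turns the sum into [gb_vandermonde]. *)
Lemma fcoef_N rho c K w :
  (w < N)%N ->
  \sum_(0 <= r < N) gb r rho * (q ^ (r%:Z + (c + r)%N%:Z * (r%:Z + rho%:Z) - r%:Z * rho%:Z) *
      Pcoef K (c + r) * fcoef r (c + r) w) = chain_coef c (K - rho) * fcoef rho K w.
Proof.
move=> lt_wN.
have [lt_Kw|le_wK] := ltnP K w.
  rewrite big_nat big1 => [|r _]; last first.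
    rewrite /Pcoef /fcoef; have [lt_cw|le_wc] := ltnP (c + r) w; first by rewrite (gb_small lt_cw); ring.
    by rewrite (@gb_small K) ?(leq_trans lt_Kw) //; ring.
  by rewrite /fcoef (gb_small lt_Kw); ring.
have [lt_wr|le_rw] := ltnP w rho.
  rewrite big_nat big1 => [|r _]; last first.
    rewrite /fcoef; have [lt_wr'|le_rw] := ltnP w r; first by rewrite (gb_small lt_wr'); ring.
    by rewrite (@gb_small r) ?(leq_ltn_trans le_rw) //; ring.
  by rewrite /fcoef (gb_small lt_wr); ring.
transitivity (\sum_(0 <= r < N) gb r rho * gb w r *
   (q ^ (r%:Z + (c + r)%N%:Z * (r%:Z + rho%:Z) - r%:Z * rho%:Z) *
    q ^ (- (N%:Z + (c + r)%N%:Z) * K%:Z + (N%:Z - 1) * (c + r)%N%:Z) *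
    q ^ (- N%:Z * (c + r)%N%:Z + w%:Z * w%:Z - N%:Z * w%:Z - (c + r)%N%:Z * w%:Z) *
    gb K w * gbz (K - w) (K%:Z - (c + r)%N%:Z) * fall w K)).
  apply: eq_big_nat => r _; rewrite /Pcoef /fcoef.
  have G := gb_mulz' (c + r) le_wK.
  have [lt_cw|le_wc] := ltnP (c + r) w.
    by rewrite (gb_small lt_cw) gbz_big; [ring | lia].
  have [lt_Kc|le_cK] := ltnP K (c + r).
    by rewrite (gb_small lt_Kc) gbz_neg; [ring | lia].
  rewrite -(fall_cat le_wc le_cK).
  set A := q ^ _; set B := q ^ _; set C := q ^ _.
  apply: (lincomb (c := gb r rho * gb w r * A * B * C * fall w (c + r) * fall (c + r) K) G); ring.
rewrite gb_sum_shift //.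
have V := gb_vandermonde (w - rho) (K - w) (K%:Z - (c + rho)%N%:Z).
have le_rhoK := leq_trans le_rw le_wK.
transitivity (gb w rho * (gb K w * fall w K * q ^ (rho%:Z + (c + rho)%N%:Z * (2 * rho%:Z) - rho%:Z * rho%:Z +
    - (N%:Z + (c + rho)%N%:Z) * K%:Z + (N%:Z - 1) * (c + rho)%N%:Z +
    (- N%:Z * (c + rho)%N%:Z + w%:Z * w%:Z - N%:Z * w%:Z - (c + rho)%N%:Z * w%:Z)
    - (w%:Z - rho%:Z) * (K%:Z - (c + rho)%N%:Z))) *
    gbz (w - rho + (K - w)) (K%:Z - (c + rho)%N%:Z)).
  rewrite -V -!mulrA; congr (_ * _); rewrite !mulr_sumr; apply: eq_big_nat => i _.
  rewrite (_ : K%:Z - (c + (rho + i))%N%:Z = K%:Z - (c + rho)%N%:Z - i%:Z); last by lia.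
  set e1 := q ^ _; set e2 := q ^ _; set e3 := q ^ _; set e4 := q ^ _; set e5 := q ^ _.
  have E : e1 * e2 * e3 = e4 * e5.
    rewrite /e1 /e2 /e3 /e4 /e5 -!qzD; congr (q ^ _).
    have -> : (w - rho)%N%:Z = w%:Z - rho%:Z by lia.
    by rewrite !PoszD; ring.
  by apply: (lincomb (c := gb (w - rho) i * gb K w * fall w K * gbz (K - w) (K%:Z - (c + rho)%N%:Z - i%:Z)) E); ring.
have -> : (w - rho + (K - w) = K - rho)%N by lia.
have -> : K%:Z - (c + rho)%N%:Z = (K - rho)%N%:Z - c%:Z by lia.
rewrite gbz_sym gbz_nat /chain_coef /fcoef.
set e1 := q ^ _; set e2 := q ^ _; set e3 := q ^ _.
have E : e1 = e2 * e3.
  rewrite /e1 /e2 /e3 -qzD; congr (q ^ _).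
  have -> : (K - rho)%N%:Z = K%:Z - rho%:Z by lia.
  by rewrite !PoszD; ring.
by rewrite E; ring.
Qed.

(** A Pascal rule for the products [gb M b * fall b M]; it carries the induction in
    [gb_twist_sum]. *)
Lemma fall_pascal b M : gb M b * fall b M + q ^+ b.+1 * (gb M b.+1 * fall b.+1 M) =
   q ^ (N%:Z - 1 - M%:Z) * (gb M b.+1 * fall b.+1 M) + gb M.+1 b.+1 * fall b.+1 M.+1.
Proof.
case: (ltngtP b M) => [lt_bM|lt_Mb|->].
- rewrite (fallSl lt_bM) (@fallSr b.+1 M) //.
  have G1 : gb M.+1 b.+1 = gb M b + q ^+ b.+1 * gb M b.+1 by [].
  have G2 := gbS' (ltnW lt_bM).
  have E : q ^ (N%:Z - 1 - M%:Z) * q ^+ (M - b) = q ^ (N%:Z - 1 - b%:Z).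
    by rewrite exprnP -qzD; congr (q ^ _); lia.
  transitivity ((gb M.+1 b.+1 - gb M b * q ^ (N%:Z - 1 - b%:Z)) * fall b.+1 M).
    by rewrite G1; ring.
  transitivity ((q ^ (N%:Z - 1 - M%:Z) * gb M b.+1 + gb M.+1 b.+1 - gb M.+1 b.+1 * q ^ (N%:Z - 1 - M%:Z)) * fall b.+1 M).
    by rewrite [in X in _ = (_ - X) * _]G2 -E; ring.
  by ring.
- by rewrite !gb_small //; [ring | lia..].
- by rewrite !gbnn !fallnn !gb_small //; ring.
Qed.

(* Both sides satisfy the same Pascal-type recursion in [m]. *)
Lemma gb_twist_sum n K m :
  \sum_(0 <= i < m.+1) gb m i * (q ^ ((n + i)%N%:Z * i%:Z) * gb K (n + i) * fall (n + i) K) =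
  \sum_(0 <= i < m.+1) gb m i * (q ^ ((m%:Z - i%:Z) * (N%:Z - 1 - K%:Z - i%:Z)) *
     gb (K + i) (n + m) * fall (n + m) (K + i)).
Proof.
elim: m n => [|m IH] n.
  by rewrite !big_nat1 !addn0 mulr0 mul0r !expr0z.
rewrite gb_sum_rec' [in RHS]gb_sum_rec'.
transitivity (\sum_(0 <= i < m.+1) gb m i * (q ^ ((n + i)%N%:Z * i%:Z) * gb K (n + i) * fall (n + i) K) +
  q ^+ (n + m).+1 * \sum_(0 <= i < m.+1) gb m i * (q ^ ((n.+1 + i)%N%:Z * i%:Z) * gb K (n.+1 + i) * fall (n.+1 + i) K)).
  rewrite mulr_sumr -big_split /=; apply: eq_big_nat => i /andP[_ le_im].
  rewrite addnS -addSn.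
  have E : q ^+ (m - i) * q ^ ((n.+1 + i)%N%:Z * i.+1%:Z) = q ^+ (n + m).+1 * q ^ ((n.+1 + i)%N%:Z * i%:Z).
    by rewrite !exprnP -!qzD; congr (q ^ _); lia.
  by apply: (lincomb (c := gb m i * gb K (n.+1 + i) * fall (n.+1 + i) K) E); ring.
rewrite !IH mulr_sumr -big_split /=; apply: eq_big_nat => i /andP[_ le_im].
rewrite addnS addSn -[in RHS]addnS !addnS.
have P := fall_pascal (n + m) (K + i).
have E1 : q ^ ((m%:Z - i%:Z) * (N%:Z - 1 - K%:Z - i%:Z)) * q ^ (N%:Z - 1 - (K + i)%N%:Z) =
   q ^ ((m.+1%:Z - i%:Z) * (N%:Z - 1 - K%:Z - i%:Z)).
  by rewrite -qzD; congr (q ^ _); lia.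
have E2 : q ^ ((m%:Z - i%:Z) * (N%:Z - 1 - K%:Z - i%:Z)) =
   q ^+ (m - i) * q ^ ((m.+1%:Z - i.+1%:Z) * (N%:Z - 1 - K%:Z - i.+1%:Z)).
  by rewrite exprnP -qzD; congr (q ^ _); lia.
rewrite -E1.
transitivity (gb m i * q ^ ((m%:Z - i%:Z) * (N%:Z - 1 - K%:Z - i%:Z)) *
  (gb (K + i) (n + m) * fall (n + m) (K + i) + q ^+ (n + m).+1 * (gb (K + i) (n + m).+1 * fall (n + m).+1 (K + i)))).
  by ring.
rewrite P.
apply: (lincomb (c := gb m i * gb (K + i).+1 (n + m).+1 * fall (n + m).+1 (K + i).+1) E2); ring.
Qed.

(** The link between consecutive periods: [r] is the first index of a period, and summing it trades
    [fcoef] for [ecoef] with one more twist. Once recentred at [n], both sides are those of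
    [gb_twist_sum]. *)
Lemma ecoef_W n c b : (n <= b)%N -> (b < N)%N ->
  \sum_(0 <= a < N) ecoef n c a * (twist_coef b * gb b a) =
  q ^ (1 - N%:Z) * \sum_(0 <= r < N) gb r n * (q ^ (r%:Z + (c + r)%N%:Z * r%:Z) * fcoef r (c + r) b).
Proof.
move=> le_nb lt_bN.
transitivity (\sum_(0 <= a < N) gb a n * gb b a * (twist_coef b *
   q ^ (- N%:Z * c%:Z + a%:Z * a%:Z - a%:Z * n%:Z) * gb (n + c) a * fall a (n + c))).
  by apply: eq_big_nat => a _; rewrite /ecoef; ring.
rewrite gb_sum_shift //.
transitivity (q ^ (1 - N%:Z) * \sum_(0 <= r < N) gb r n * gb b r * (q ^ (r%:Z + (c + r)%N%:Z * r%:Z) *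
   q ^ (- N%:Z * (c + r)%N%:Z + b%:Z * b%:Z - N%:Z * b%:Z - (c + r)%N%:Z * b%:Z) *
   gb (c + r) b * fall b (c + r))); last first.
  by congr (_ * _); apply: eq_big_nat => a _; rewrite /fcoef; ring.
rewrite gb_sum_shift // mulrCA; congr (_ * _).
transitivity (twist_coef b * q ^ (- N%:Z * c%:Z) * \sum_(0 <= i < (b - n).+1) gb (b - n) i *
   (q ^ ((n + i)%N%:Z * i%:Z) * gb (n + c) (n + i) * fall (n + i) (n + c))).
  rewrite mulr_sumr; apply: eq_big_nat => i _.
  have E : q ^ (- N%:Z * c%:Z + (n + i)%N%:Z * (n + i)%N%:Z - (n + i)%N%:Z * n%:Z) =
    q ^ (- N%:Z * c%:Z) * q ^ ((n + i)%N%:Z * i%:Z).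
    by rewrite -qzD; congr (q ^ _); rewrite !PoszD; ring.
  by rewrite E; ring.
rewrite gb_twist_sum !mulr_sumr; apply: eq_big_nat => i _.
have -> : (n + (b - n) = b)%N by lia.
have -> : (c + (n + i) = n + c + i)%N by lia.
have E : twist_coef b * q ^ (- N%:Z * c%:Z) * q ^ (((b - n)%N%:Z - i%:Z) * (N%:Z - 1 - (n + c)%N%:Z - i%:Z)) =
   q ^ (1 - N%:Z) * q ^ ((n + i)%N%:Z + (n + c + i)%N%:Z * (n + i)%N%:Z) *
   q ^ (- N%:Z * (n + c + i)%N%:Z + b%:Z * b%:Z - N%:Z * b%:Z - (n + c + i)%N%:Z * b%:Z).
  rewrite /twist_coef -!qzD; congr (q ^ _).
  have -> : (b - n)%N%:Z = b%:Z - n%:Z by lia.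
  by rewrite !PoszD; ring.
apply: (lincomb (c := gb (b - n) i * gb (n + c + i) b * fall b (n + c + i)) E); ring.
Qed.

(** * The commuting bidiagonal matrix and the duality of rows and columns *)

Lemma gb_upper x j : gb (x + j).+1 x * (1 - q ^+ j.+1) = gb (x + j) x * (1 - q ^+ (x + j).+1).
Proof.
apply: (mulIf (mulf_neq0 (qf_neq0 x) (qf_neq0 j))).
have H1 := gb_fact x j; have H2 := gb_fact x j.+1; rewrite addnS !qfS in H2.
transitivity (gb (x + j).+1 x * pch q x * (pch q j * (1 - q ^+ j.+1))); first by ring.
by rewrite H2 -H1; ring.
Qed.

Lemma gb_lower x k : gb x k.+1 * (1 - q ^+ k.+1) = gb x k * (1 - q ^ (x%:Z - k%:Z)).
Proof.
have [lt_xk|le_kx] := ltnP x k; first by rewrite !gb_small ?mul0r // ltnW.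
have [->|lt_kx] := eqVneq x k; first by rewrite gb_small // subrr expr0z subrr mul0r mulr0.
have -> : x = (k + (x - k.+1).+1)%N by lia.
move: (x - k.+1)%N => j.
have H1 := gb_fact k j.+1; have H2 := gb_fact k.+1 j; rewrite !addSn addnS !qfS in H1 H2 *.
have -> : (k + j).+1%:Z - k%:Z = j.+1%:Z by lia.
apply: (mulIf (mulf_neq0 (qf_neq0 k) (qf_neq0 j))).
transitivity (gb (k + j).+1 k.+1 * (pch q k * (1 - q ^+ k.+1)) * pch q j); first by ring.
rewrite H2 -H1 -[q ^ _]exprnP; ring.
Qed.

Lemma gb_diag x k : gb x.+1 k.+1 * (1 - q ^+ k.+1) = gb x k * (1 - q ^+ x.+1).
Proof.
have [lt_xk|le_kx] := ltnP x k; first by rewrite !gb_small ?mul0r.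
have -> : x = (k + (x - k))%N by lia.
move: (x - k)%N => j.
have H1 := gb_fact k j; have H2 := gb_fact k.+1 j; rewrite !addSn !qfS in H2.
apply: (mulIf (mulf_neq0 (qf_neq0 k) (qf_neq0 j))).
transitivity (gb (k + j).+1 k.+1 * (pch q k * (1 - q ^+ k.+1)) * pch q j); first by ring.
by rewrite H2 -H1; ring.
Qed.

(** The weight of the last index in the multisum, with $(q^{1-N})_x$ rewritten through the factors
    $1-q^{N-1-k}$; see [final_coef_qpoch]. *)
Definition final_coef (x : nat) : F := (-1) ^+ x * fall 0 x * q ^ (- tri x).

(** [eta 0] is [final_coef], through which the cap reads the state in [cap_value]. The factor
    $(q^{N+1})_K$ is what [gb_pch_sym] produces when a clasp acts on [eta 0]. *)
Definition eta (K x : nat) : F :=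
  pch (q ^+ N.+1) K * gb x K * q ^ (- (K%:Z * (x%:Z + 1))) * final_coef x.

(* [twist_mx] and [clasp_mx] are the actions of a full twist of the parallel, resp. antiparallel,
   strands in the coordinates normalised by [coord_scale] below. *)
Definition twist_mx : 'M[F]_N := \matrix_(x, y) (twist_coef x * gb x y).

Definition clasp_mx : 'M[F]_N := \matrix_(x, y)
  ((-1) ^+ (y - x) * gb y x * fall x y ^+ 2 *
   q ^ (- tri y - x%:Z * y%:Z + tri x - x%:Z)).

(* [Lmx] is a bidiagonal matrix commuting with [twist_mx]; [eta_row K] (on the left) and [u_col K] (on
   the right) satisfy the same three-term recurrence in [K] under it, which forces the duality
   [eta_row_commute]. *)
Definition Lalpha (x : nat) : F := q ^ (- x%:Z) + q ^ (1 - 2 * N%:Z + x%:Z).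
Definition Lgamma (x : nat) : F := q ^ (x%:Z - 2 * N%:Z) * (1 - q ^+ x).

Definition Lmx : 'M[F]_N := \matrix_(x, y)
  ((if x == y then Lalpha x else 0) - (if x == y.+1 :> nat then Lgamma x else 0)).

Definition eta_row K : 'rV[F]_N := \row_x eta K x.
Definition u_col K : 'cV[F]_N := \col_a ecoef 0 K a.
Definition delta0 : 'cV[F]_N := \col_x ((x == 0%N :> nat)%:R).

Lemma row_Lmx (f : nat -> F) : f N = 0 ->
  (\row_x f x) *m Lmx = \row_(y < N) (f y * Lalpha y - f y.+1 * Lgamma y.+1).
Proof.
move=> fN0; apply/rowP => y; rewrite !mxE.
under eq_bigr => x _ do rewrite !mxE mulrBr.
rewrite sumrB; congr (_ - _).
  by rewrite (bigD1 y) //= eqxx big1 ?addr0 // => x /negPf ->; rewrite mulr0.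
have [lt_yN|] := ltnP y.+1 N.
  rewrite (bigD1 (Ordinal lt_yN)) //= eqxx big1 ?addr0 // => x ne_x.
  by rewrite ifN ?mulr0 //; apply: contra ne_x => /eqP E; apply/eqP/val_inj.
rewrite leq_eqVlt => /predU1P[E|]; last by rewrite ltnS leqNgt ltn_ord.
rewrite -E fN0 mul0r big1 // => x _; rewrite ifN ?mulr0 //.
by rewrite ltn_eqF // ltn_ord.
Qed.

Lemma Lmx_col (f : nat -> F) :
  Lmx *m (\col_x f x) = \col_(x < N) (Lalpha x * f x - Lgamma x * f x.-1).
Proof.
apply/colP => x; rewrite !mxE.
under eq_bigr => y _ do rewrite !mxE mulrBl.
rewrite sumrB; congr (_ - _).
  by rewrite (bigD1 x) //= eqxx big1 ?addr0 // => y; rewrite eq_sym => /negPf ->; rewrite mul0r.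
case: x => [[|x] lt_xN] /=.
  rewrite /Lgamma expr0 subrr mulr0 mul0r big1 // => y _.
  by rewrite mul0r.
rewrite (bigD1 (Ordinal (ltnW lt_xN))) //= eqxx big1 ?addr0 // => y ne_y.
rewrite ifN ?mul0r //; apply: contra ne_y => /eqP [E]; apply/eqP/val_inj; by rewrite /= E.
Qed.

Lemma twist_coefS x : twist_coef x = q ^ (2 * N%:Z - 2 * x.+1%:Z) * twist_coef x.+1.
Proof. by rewrite /twist_coef -qzD; congr (q ^ _); lia. Qed.

(** Each entry involves three neighbouring Gaussian binomials; [gb_lower] and [gb_diag] express them
    through one of them, and then only powers of [q] remain to be compared. *)
Lemma twist_mx_Lmx : twist_mx *m Lmx = Lmx *m twist_mx.
Proof.
apply/matrixP => x y.
transitivity (((\row_z (twist_coef x * gb x z)) *m Lmx) 0 y).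
  by rewrite !mxE; apply: eq_bigr => z _; rewrite !mxE.
transitivity ((Lmx *m \col_z (twist_coef z * gb z y)) x 0); last first.
  by rewrite !mxE; apply: eq_bigr => z _; rewrite !mxE.
rewrite (@row_Lmx (fun z => twist_coef x * gb x z)) ?gb_small ?mulr0 // (@Lmx_col (fun z => twist_coef z * gb z y)) !mxE.
case: x => [[|x] lt_xN] /=.
  rewrite (@gb_small 0 y.+1) // /Lgamma expr0 subrr.
  by case: (posnP y) => [->|y_gt0]; rewrite ?gbn0 ?(@gb_small 0 y) //; ring.
rewrite /Lgamma (twist_coefS x).
have G1 := gb_lower x.+1 y; have G2 : gb x y * (1 - q ^+ x.+1) = gb x.+1 y * (1 - q ^ (x.+1%:Z - y%:Z)).
  by rewrite -gb_diag gb_lower.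
have E1 : q ^ (y.+1%:Z - 2 * N%:Z) * q ^ (x.+1%:Z - y%:Z) = q ^ (1 - 2 * N%:Z + x.+1%:Z).
  by rewrite -qzD; congr (q ^ _); lia.
have E2 : q ^ (x.+1%:Z - 2 * N%:Z) * q ^ (2 * N%:Z - 2 * x.+1%:Z) = q ^ (- x.+1%:Z).
  by rewrite -qzD; congr (q ^ _); lia.
have E3 : q ^ (- x.+1%:Z) * q ^ (x.+1%:Z - y%:Z) = q ^ (- y%:Z).
  by rewrite -qzD; congr (q ^ _); lia.
have E4 : q ^ (1 - 2 * N%:Z + y%:Z) = q ^ (y.+1%:Z - 2 * N%:Z) by congr (q ^ _); lia.
transitivity (twist_coef x.+1 * (gb x.+1 y * Lalpha y - q ^ (y.+1%:Z - 2 * N%:Z) * (gb x.+1 y.+1 * (1 - q ^+ y.+1)))).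
  by ring.
transitivity (twist_coef x.+1 * (gb x.+1 y * Lalpha x.+1 - q ^ (x.+1%:Z - 2 * N%:Z) * q ^ (2 * N%:Z - 2 * x.+1%:Z) * (gb x y * (1 - q ^+ x.+1)))); last by ring.
rewrite G1 G2 /Lalpha E2 E4 -E1 -E3; ring.
Qed.

Lemma qzN (z : int) : q ^ (- z) = (q ^ z)^-1.
Proof. by rewrite invr_expz. Qed.

Lemma qz2 (z : int) : q ^ (2 * z) = q ^ z * q ^ z.
Proof. by rewrite -qzD; congr (q ^ _); lia. Qed.

Lemma qz_nat (n : nat) : q ^ n%:Z = q ^+ n. Proof. by []. Qed.

Lemma qzS (n : nat) : q ^ n.+1%:Z = q * q ^+ n. Proof. by rewrite -exprS. Qed.

Lemma qz1 : q ^ (1 : int) = q. Proof. exact: expr1z. Qed.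

Definition qzE := (qzS, qz_nat, qz1, qzD, qzN, qz2).

(** Coefficients of the common three-term recurrence. [lower_up] never vanishes, so the recurrence
    determines the term [K.+1]; [lower_down 0] is zero, so the value [0.-1 = 0] does no harm. *)
Definition lower_diag (K : nat) : F := q ^ (- K%:Z - 2 * N%:Z) + 2%:R * q ^ (- K%:Z - N%:Z) + q ^ (- K%:Z)
  - q ^ (- (2 * K%:Z) - N%:Z) - q ^ (- (2 * K%:Z) - N%:Z - 1).
Definition lower_up (K : nat) : F := - q ^ (- K%:Z - N%:Z) * (1 - q ^+ K.+1).
Definition lower_down (K : nat) : F := (1 - q ^ (N%:Z + K%:Z)) * (1 - q ^+ K) * (1 - q ^ (N%:Z - K%:Z)) *
  q ^ (- (2 * K%:Z) - 2 * N%:Z).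

Lemma final_coefS x : final_coef x.+1 = - (1 - q ^ (N%:Z - 1 - x%:Z)) * q ^ (- (x%:Z + 1)) * final_coef x.
Proof.
rewrite /final_coef fallSr // triS exprS.
have -> : q ^ (- (tri x + x%:Z + 1)) = q ^ (- (x%:Z + 1)) * q ^ (- tri x).
  by rewrite -qzD; congr (q ^ _); lia.
ring.
Qed.

Lemma qX_neq0 n : q ^+ n != 0. Proof. exact: expf_neq0. Qed.

Lemma gb_lowerE x k : gb x k.+1 = gb x k * (1 - q ^+ x / q ^+ k) / (1 - q * q ^+ k).
Proof.
have nz : 1 - q * q ^+ k != 0 by rewrite -exprS sub1q_neq0.
by apply: (mulIf nz); rewrite divfK // -exprS gb_lower qzD qzN.
Qed.

Lemma gb_diagE x k : gb x.+1 k.+1 = gb x k * (1 - q * q ^+ x) / (1 - q * q ^+ k).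
Proof.
have nz : 1 - q * q ^+ k != 0 by rewrite -exprS sub1q_neq0.
by apply: (mulIf nz); rewrite divfK // -!exprS gb_diag.
Qed.

(** All terms are multiples of one product, with ratios rational in $q^x$, $q^k$ and $q^N$. The
    bilinear exponents are first gathered in [c], since they are not monomials in these three. *)
Lemma eta_LS k x : eta k.+1 x * Lalpha x - eta k.+1 x.+1 * Lgamma x.+1 =
  lower_diag k.+1 * eta k.+1 x + lower_up k.+1 * eta k.+2 x + lower_down k.+1 * eta k x.
Proof.
rewrite /eta !pchS final_coefS gb_diagE !gb_lowerE.
set c := q ^ (- (k%:Z * (x%:Z + 1))).
have -> : q ^ (- (k.+1%:Z * (x%:Z + 1))) = c * q ^ (- (x%:Z + 1)).
  by rewrite -qzD; congr (q ^ _); lia.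
have -> : q ^ (- (k.+2%:Z * (x%:Z + 1))) = c * q ^ (- (x%:Z + 1)) * q ^ (- (x%:Z + 1)).
  by rewrite -!qzD; congr (q ^ _); lia.
have -> : q ^ (- (k.+1%:Z * (x.+1%:Z + 1))) = c * q ^ (- (x%:Z + 1)) * q ^ (- (k%:Z + 1)).
  by rewrite -!qzD; congr (q ^ _); lia.
rewrite /lower_diag /lower_up /lower_down /Lalpha /Lgamma !qzE !exprS.
have := sub1q_neq0 k; have := sub1q_neq0 k.+1; rewrite !exprS.
have := qX_neq0 x; have := qX_neq0 k; have := qX_neq0 N.
move: (q ^+ x) (q ^+ k) (q ^+ N) c (gb x k) (final_coef x) (pch _ k) => Y a Q c g f p Q0 a0 Y0 nz2 nz1.
field; by do ?[apply/andP; split].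
Qed.

Lemma eta_L0 x : eta 0 x * Lalpha x - eta 0 x.+1 * Lgamma x.+1 = lower_diag 0 * eta 0 x + lower_up 0 * eta 1 x.
Proof.
rewrite /eta !pchS !pch0 final_coefS gb_lowerE !gbn0 !mul0r oppr0 !expr0z !mul1r.
rewrite /lower_diag /lower_up /lower_down /Lalpha /Lgamma !qzE !exprS !expr0.
have := sub1q_neq0 0; rewrite !exprS !expr0 mulr1.
have := qX_neq0 x; have := qX_neq0 N.
move: (q ^+ x) (q ^+ N) (final_coef x) => Y Q f Q0 Y0 nz1.
by field; rewrite oner_eq0 q0 Y0 nz1 Q0.
Qed.

Lemma eta_row_Lmx K : eta_row K *m Lmx = lower_diag K *: eta_row K + lower_up K *: eta_row K.+1 + lower_down K *: eta_row K.-1.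
Proof.
have [N0|N_gt0] := posnP N; first by apply/rowP => x; have := ltn_ord x; rewrite {2}N0.
(* The last column would read the entry of index [N], which vanishes by the factor $1-q^0$ in
   [final_coef]. *)
rewrite /eta_row row_Lmx; last by rewrite /eta /final_coef fall_zero //; ring.
apply/rowP => x; rewrite !mxE; case: K => [|K]; last exact: eta_LS.
by rewrite eta_L0 /lower_down expr0 subrr !(mulr0, mul0r) addr0.
Qed.

Lemma ecoef0E K x : ecoef 0 K x = q ^ (- N%:Z * K%:Z + x%:Z * x%:Z) * gb K x * fall x K.
Proof. by rewrite /ecoef gbn0 mulr0 subr0 mulr1. Qed.

(** The counterpart of [eta_LS] for $K=x+j\ge x$. At [x = 0] and at [j = 0] the predecessors leave
    the range and their terms vanish, so these cases are split off before the division by common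
    factors. *)
Lemma u_col_LS j x : Lalpha x * ecoef 0 (x + j) x - Lgamma x * ecoef 0 (x + j) x.-1 =
  lower_diag (x + j) * ecoef 0 (x + j) x + lower_up (x + j) * ecoef 0 (x + j).+1 x + lower_down (x + j) * ecoef 0 (x + j).-1 x.
Proof.
rewrite !ecoef0E.
set c := q ^ (- N%:Z * (x + j)%N%:Z + x%:Z * x%:Z).
have nz1 : 1 - q * q ^+ j != 0 by rewrite -exprS sub1q_neq0.
have E1 : gb (x + j).+1 x = gb (x + j) x * (1 - q * (q ^+ x * q ^+ j)) / (1 - q * q ^+ j).
  by apply: (mulIf nz1); rewrite divfK // -exprD -!exprS gb_upper.
have -> : q ^ (- N%:Z * (x + j).+1%:Z + x%:Z * x%:Z) = c / q ^+ N.
  by rewrite -[q ^+ N]qz_nat -qzN -qzD; congr (q ^ _); lia.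
have E2 : lower_down (x + j) * (q ^ (- N%:Z * (x + j).-1%:Z + x%:Z * x%:Z) * gb (x + j).-1 x * fall x (x + j).-1) =
    (1 - q ^ (N%:Z + (x + j)%N%:Z)) * (1 - q ^+ j) * q ^ (- (2 * (x + j)%N%:Z) - 2 * N%:Z) *
    (c * q ^+ N * gb (x + j) x * fall x (x + j)).
  rewrite /lower_down; case: j {nz1 E1} @c => [|j] c.
    rewrite addn0 in c *; case: x c => [|x] c; first by rewrite expr0 subrr; ring.
    by rewrite (@gb_small x.+1.-1) // expr0 subrr; ring.
  rewrite addnS /= fallSr ?leq_addr //.
  have -> : N%:Z - 1 - (x + j)%N%:Z = N%:Z - (x + j).+1%:Z by lia.
  have -> : q ^ (- N%:Z * (x + j)%N%:Z + x%:Z * x%:Z) = c * q ^+ N.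
    by rewrite -[q ^+ N]qz_nat -qzD; congr (q ^ _); rewrite /c; lia.
  have G := gb_upper x j.
  set t1 := q ^ _; set t2 := q ^ _; set t3 := q ^ _.
  by apply: (lincomb (c := - (1 - t1) * (1 - t2) * t3 * c * q ^+ N * fall x (x + j)) G); ring.
rewrite E2 E1 fallSr ?leq_addr // {E1 E2}.
have E3 : Lgamma x * (q ^ (- N%:Z * (x + j)%N%:Z + x.-1%:Z * x.-1%:Z) * gb (x + j) x.-1 * fall x.-1 (x + j)) =
   q ^ (x%:Z - 2 * N%:Z) * (1 - q ^+ x) ^+ 2 / (1 - q * q ^+ j) * (c * q ^ (1 - 2 * x%:Z)) * gb (x + j) x *
     ((1 - q ^ (N%:Z - x%:Z)) * fall x (x + j)).
  rewrite /Lgamma; case: x @c => [|x] c; first by rewrite expr0 subrr; ring.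
  rewrite [x.+1.-1]/= (@fallSl x) ?addSn ?ltnS ?leq_addr //.
  have -> : N%:Z - 1 - x%:Z = N%:Z - x.+1%:Z by lia.
  have -> : q ^ (- N%:Z * (x + j).+1%:Z + x%:Z * x%:Z) = c * q ^ (1 - 2 * x.+1%:Z).
    by rewrite -qzD; congr (q ^ _); lia.
  have G := gb_lower (x + j).+1 x; have G' : (x + j).+1%:Z - x%:Z = j.+1%:Z by lia.
  rewrite G' qz_nat in G.
  have G2 : gb (x + j).+1 x = gb (x + j).+1 x.+1 * (1 - q ^+ x.+1) / (1 - q * q ^+ j).
    by apply: (mulIf nz1); rewrite divfK // G exprS.
  by rewrite G2; ring.
rewrite E3 {E3} /lower_diag /lower_up /Lalpha PoszD !qzE !exprS !exprD.
have := qX_neq0 x; have := qX_neq0 j; have := qX_neq0 N.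
move: nz1; move: c => c; move: (q ^+ x) (q ^+ j) (q ^+ N) c (gb (x + j) x) (fall x (x + j)) => Y J Q c g f nz1 Q0 J0 Y0.
field; by do ?[apply/andP; split].
Qed.

Lemma u_col_Lmx K : Lmx *m u_col K = lower_diag K *: u_col K + lower_up K *: u_col K.+1 + lower_down K *: u_col K.-1.
Proof.
rewrite /u_col Lmx_col; apply/colP => y; rewrite !mxE; move: (nat_of_ord y) => x.
have [lt_Kx|le_xK] := ltnP K.+1 x.
  rewrite !ecoef0E !(@gb_small _ x) ?(@gb_small _ x.-1); try lia.
  ring.
case: (ltngtP x K.+1) le_xK => // [le_xK|->] _; last first.
  (* In row [K.+1] only the subdiagonal entry of [Lmx] and the term in [u_col K.+1] survive. *)
  rewrite !ecoef0E /= (@gb_small K) // (@gb_small K.-1) ?gbnn ?fallnn; last by lia.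
  have E : q ^ (K.+1%:Z - 2 * N%:Z) * q ^ (- N%:Z * K%:Z + K%:Z * K%:Z) =
     q ^ (- K%:Z - N%:Z) * q ^ (- N%:Z * K.+1%:Z + K.+1%:Z * K.+1%:Z).
    by rewrite -!qzD; congr (q ^ _); lia.
  by apply: (lincomb (c := - (1 - q ^+ K.+1)) E); rewrite /Lgamma /lower_up; ring.
have -> : K = (x + (K - x))%N by lia.
exact: u_col_LS.
Qed.

(** Evaluate $\eta_K LO\delta_0$ both by the recurrence for $\eta_K$ and, with the induction
    hypothesis for $LO$ and $LO=OL$, by the recurrence for $u_K$. The coefficients agree and
    [lower_up K] is invertible, so the case [K.+1] follows. Hence [O] is quantified inside the
    induction, which is strong because the recurrence reaches back to [K.-1]. *)
Lemma eta_row_commute (O : 'M[F]_N) K : O *m Lmx = Lmx *m O ->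
  eta_row K *m O *m delta0 = eta_row 0 *m O *m u_col K.
Proof.
have LB_neq0 j : lower_up j != 0.
  by rewrite mulf_neq0 ?sub1q_neq0 // oppr_eq0 expfz_neq0.
have u0 : u_col 0 = delta0.
  apply/colP => x; rewrite !mxE ecoef0E; case: (nat_of_ord x) => [|z].
    by rewrite gbn0 fallnn mulr0 addr0 expr0z !mulr1.
  by rewrite gb_small // mulr0 mul0r.
have: (forall j, (j <= K)%N -> forall O : 'M[F]_N, O *m Lmx = Lmx *m O ->
    eta_row j *m O *m delta0 = eta_row 0 *m O *m u_col j); last by move/(_ K (leqnn K)); apply.
elim: K => [|K IH] j; first by rewrite leqn0 => /eqP -> {}O _; rewrite u0.
rewrite leq_eqVlt => /predU1P[->|/IH //] {}O cO.
have H1 := IH K (leqnn K) _ cO.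
have H2 := IH K.-1 (leq_pred K) _ cO.
have cLO : (Lmx *m O) *m Lmx = Lmx *m (Lmx *m O) by rewrite -mulmxA cO.
have H3 := IH K (leqnn K) _ cLO.
apply: (scalerI (LB_neq0 K)); move: H3.
rewrite mulmxA eta_row_Lmx -!mulmxA [Lmx *m (O *m _)]mulmxA -cO -mulmxA u_col_Lmx.
rewrite !(mulmxDr, mulmxDl, =^~ scalemxAl, =^~ scalemxAr) !mulmxA H1 H2.
by move/addIr/addrI.
Qed.

Definition twist_row p := iter p (mulmxr twist_mx) (eta_row 0).
Definition twist_col p := iter p (mulmx twist_mx) delta0.

Lemma eta_row_twist_col K p : eta_row K *m twist_col p = twist_row p *m u_col K.
Proof.
pose O r := iter r (mulmx twist_mx) (1%:M : 'M[F]_N).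
have cO r : O r *m Lmx = Lmx *m O r.
  elim: r => [|r IH]; first by rewrite mulmx1 mul1mx.
  by rewrite /O /= -/(O r) -mulmxA IH !mulmxA twist_mx_Lmx.
have TO r : O r *m twist_mx = twist_mx *m O r.
  elim: r => [|r IH]; first by rewrite mulmx1 mul1mx.
  by rewrite /O /= -/(O r) -{1}mulmxA IH.
have GO r : twist_col r = O r *m delta0.
  elim: r => [|r IH]; first by rewrite mul1mx.
  by rewrite /O /twist_col /= -/(O r) -/(twist_col r) IH mulmxA.
have WO r : twist_row r = eta_row 0 *m O r.
  elim: r => [|r IH]; first by rewrite mulmx1.
  by rewrite /O /twist_row /= -/(O r) -/(twist_row r) IH -mulmxA TO.
by rewrite GO WO mulmxA eta_row_commute.
Qed.

(** In column [z], after recentring at [K], this is [gb_pch_sym] with upper index $z-K$, $a=q^{N-z}$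
    and $w=q^{K+z+1}$, so that $aw=q^{N+1+K}$ continues the product $(q^{N+1})_K$. *)
Lemma eta_row_clasp_mx K : eta_row K *m clasp_mx = \sum_(0 <= b < N) chain_coef K b *: eta_row b.
Proof.
apply/rowP => y; rewrite mxE summxE.
under eq_bigr => x _ do rewrite !mxE.
under [RHS]eq_bigr => b _ do rewrite !mxE.
rewrite -(big_mkord xpredT (fun x => eta K x * ((-1) ^+ (y - x) * gb y x * fall x y ^+ 2 *
   q ^ (- tri y - x%:Z * y%:Z + tri x - x%:Z)))).
have lt_yN := ltn_ord y; move: (nat_of_ord y) lt_yN => z lt_zN {y}.
have [lt_zK|le_Kz] := ltnP z K.
  rewrite !big_nat !big1 // => i /andP[_ lt_iN].
    by rewrite /chain_coef /eta; have [lt_zi|le_iz] := ltnP z i; [rewrite (gb_small lt_zi) | rewrite (@gb_small i) ?(leq_ltn_trans le_iz)]; rewrite ?(mulr0, mul0r).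
  by rewrite /eta; have [lt_zi|le_iz] := ltnP z i; [rewrite (gb_small lt_zi) | rewrite (@gb_small i) ?(leq_ltn_trans le_iz)]; rewrite ?(mulr0, mul0r).
set w := q ^ (K%:Z + z%:Z + 1).
transitivity (\sum_(0 <= x < N) gb x K * gb z x * (pch (q ^ (N%:Z - z%:Z)) (z - x) * q ^ (- (x%:Z * (K%:Z + z%:Z + 1))) *
   (pch (q ^+ N.+1) K * q ^ (- K%:Z) * final_coef z))).
  apply: eq_big_nat => x _; have [lt_zx|le_xz] := ltnP z x; first by rewrite (gb_small lt_zx); ring.
  rewrite /eta /final_coef.
  have -> : pch (q ^ (N%:Z - z%:Z)) (z - x) = fall x z.
    rewrite /pch /fall big_nat_rev /= add0n -{3}[x]add0n big_addn; apply: eq_big_nat => i /andP[_ lt_i].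
    by rewrite exprnP -qzD; congr (1 - q ^ _); lia.
  rewrite -(fall_cat (leq0n x) le_xz).
  have S : (-1) ^+ z = (-1) ^+ (z - x) * (-1) ^+ x :> F by rewrite -exprD subnK.
  have E : q ^ (- (K%:Z * (x%:Z + 1))) * q ^ (- tri x) * q ^ (- tri z - x%:Z * z%:Z + tri x - x%:Z) =
    q ^ (- (x%:Z * (K%:Z + z%:Z + 1))) * q ^ (- K%:Z) * q ^ (- tri z).
    by rewrite -!qzD; congr (q ^ _); ring.
  rewrite S.
  by apply: (lincomb (c := pch (q ^+ N.+1) K * gb x K * (-1) ^+ x * fall 0 x * (-1) ^+ (z - x) * gb z x * fall x z ^+ 2) E); ring.
rewrite gb_sum_shift //.
transitivity (\sum_(0 <= b < N) gb b K * gb z b * (pch (q ^+ N.+1 * q ^+ K) (b - K) * q ^ (- (b%:Z * (K%:Z + z%:Z + 1))) *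
   (pch (q ^+ N.+1) K * q ^ (- K%:Z) * final_coef z))); last first.
  apply: eq_big_nat => b _; rewrite /chain_coef /eta.
  have [lt_bK|le_Kb] := ltnP b K; first by rewrite (gb_small lt_bK); ring.
  have -> : pch (q ^+ N.+1) b = pch (q ^+ N.+1) K * pch (q ^+ N.+1 * q ^+ K) (b - K).
    rewrite /pch (big_cat_nat (n := K)) //=; congr (_ * _).
    rewrite -{1}[K]add0n big_addn; apply: eq_bigr => i _; by rewrite addnC exprD mulrA.
  have E : q ^ (- (K%:Z * (b%:Z + 1))) * q ^ (- (b%:Z * (z%:Z + 1))) =
     q ^ (- (b%:Z * (K%:Z + z%:Z + 1))) * q ^ (- K%:Z).
    by rewrite -!qzD; congr (q ^ _); ring.
  by apply: (lincomb (c := - gb b K * pch (q ^+ N.+1) K * pch (q ^+ N.+1 * q ^+ K) (b - K) * gb z b * final_coef z) E); ring.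
rewrite gb_sum_shift //; congr (_ * _).
set cst := _ * final_coef z.
under eq_bigr => i _ do rewrite /= mulrA.
under [RHS]eq_bigr => i _ do rewrite /= mulrA.
rewrite -!mulr_suml; congr (_ * _).
have R := gb_pch_sym (q ^ (N%:Z - z%:Z)) w (z - K).
have esum : q ^ (N%:Z - z%:Z) * w = q ^+ N.+1 * q ^+ K.
  by rewrite -exprD exprnP /w -qzD; congr (q ^ _); lia.
rewrite esum in R.
transitivity (q ^ (- (z%:Z * (K%:Z + z%:Z + 1))) *
  \sum_(0 <= k < (z - K).+1) gb (z - K) k * (pch (q ^ (N%:Z - z%:Z)) k * w ^+ k)).
  rewrite big_nat_rev /= mulr_sumr; apply: eq_big_nat => i /andP[_ lt_i].
  rewrite add0n subSS.
  have -> : gb (z - K) (z - K - i) = gb (z - K) i.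
    have -> : (z - K = i + (z - K - i))%N by lia.
    by rewrite addKn -gb_sym.
  have -> : (z - (K + (z - K - i)) = i)%N by lia.
  have -> : q ^ (- ((K + (z - K - i))%N%:Z * (K%:Z + z%:Z + 1))) = q ^ (- (z%:Z * (K%:Z + z%:Z + 1))) * w ^+ i.
    rewrite /w exprnP exprz_exp -qzD; congr (q ^ _).
    have -> : (K + (z - K - i))%N%:Z = z%:Z - i%:Z by lia.
    by ring.
  by ring.
rewrite R mulr_sumr; apply: eq_big_nat => i /andP[_ lt_i].
have -> : (K + i - K = i)%N by lia.
have -> : q ^ (- ((K + i)%N%:Z * (K%:Z + z%:Z + 1))) = q ^ (- (z%:Z * (K%:Z + z%:Z + 1))) * w ^+ (z - K - i).
  rewrite /w exprnP exprz_exp -qzD; congr (q ^ _).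
  have -> : (z - K - i)%N%:Z = z%:Z - K%:Z - i%:Z by lia.
  by rewrite PoszD; ring.
by ring.
Qed.

(** * Rearranged double sums and sums over chains *)

Lemma sum_offset a b (f : nat -> F) : \sum_(a <= i < b) f i = \sum_(0 <= i < b - a) f (i + a)%N.
Proof. by rewrite -{1}[a]add0n big_addn. Qed.

Lemma sum_antidiag (A : nat -> nat -> F) : (forall a c, (N <= a + c)%N -> A a c = 0) ->
  \sum_(0 <= a < N) \sum_(0 <= c < N) A a c = \sum_(0 <= K < N) \sum_(0 <= a < K.+1) A a (K - a)%N.
Proof.
move=> A0.
transitivity (\sum_(0 <= a < N) \sum_(0 <= K < N) (if (a <= K)%N then A a (K - a)%N else 0)).
  apply: eq_big_nat => a /andP[_ lt_aN].
  rewrite [RHS](big_cat_nat (n := a)) //=; last by apply: ltnW.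
  rewrite [X in _ = X + _]big_nat [X in _ = X + _]big1 ?add0r; last by move=> i /andP[_ lt_ia]; rewrite leqNgt lt_ia.
  rewrite [in RHS]sum_offset [X in X = _](big_cat_nat (n := (N - a)%N)) ?leq_subr //=.
  rewrite [X in _ + X]big_nat [X in _ + X]big1 ?addr0; last first.
    by move=> i /andP[le_i _]; apply: A0; lia.
  by apply: eq_bigr => i _; rewrite leq_addl addnK.
rewrite exchange_big_nat /=; apply: eq_big_nat => K /andP[_ lt_KN].
rewrite (big_cat_nat (n := K.+1)) //= [X in _ + X]big_nat [X in _ + X]big1 ?addr0; last first.
  by move=> i /andP[lt_Ki _]; rewrite leqNgt lt_Ki.
by apply: eq_big_nat => a /andP[_ le_aK]; rewrite -ltnS le_aK.
Qed.

Lemma sum_shear (B : nat -> nat -> F) :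
  (forall a K, (K < a)%N || (N <= K)%N -> B a K = 0) ->
  \sum_(0 <= a < N) \sum_(0 <= K < N) B a K = \sum_(0 <= c < N) \sum_(0 <= a < N) B a (c + a)%N.
Proof.
move=> B0; rewrite [RHS]exchange_big_nat /=; apply: eq_big_nat => a /andP[_ lt_aN].
rewrite (big_cat_nat (n := a)) //=; last by apply: ltnW.
rewrite big_nat big1 ?add0r; last by move=> K /andP[_ lt_Ka]; rewrite B0 ?lt_Ka.
rewrite [in LHS]sum_offset [RHS](big_cat_nat (n := (N - a)%N)) ?leq_subr //=.
rewrite [X in _ = _ + X]big_nat [X in _ = _ + X]big1 ?addr0 //.
by move=> i /andP[le_i _]; apply: B0; apply/orP; right; lia.
Qed.

Definition esum (w : nat -> F) (n k : nat) : F := \sum_(0 <= a < N) ecoef n k a * w a.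
Definition fsum (w : nat -> F) (r K : nat) : F := \sum_(0 <= a < N) fcoef r K a * w a.

Lemma esum_big w n k : (N <= n + k)%N -> esum w n k = 0.
Proof.
by move=> le_N; rewrite /esum big_nat big1 // => a /andP[_ lt_a]; rewrite /ecoef fall_zero // mulr0 mul0r.
Qed.

Lemma fsum_small w r K : (K < r)%N || (N <= K)%N -> fsum w r K = 0.
Proof.
move=> H; rewrite /fsum big_nat big1 // => a /andP[_ lt_a]; rewrite /fcoef.
case/orP: H => [lt_Kr|le_N]; last by rewrite fall_zero // mulr0 mul0r.
have [lt_ar|le_ra] := ltnP a r; first by rewrite (gb_small lt_ar) ?(mulr0, mul0r).
by rewrite (@gb_small K) ?(mulr0, mul0r) // (leq_trans lt_Kr).
Qed.

(** For second argument 0 the product [gb a n * gb n a] is a Kronecker delta. *)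
Lemma esum0 w n : (n < N)%N -> esum w n 0 = w n.
Proof.
move=> lt_nN; rewrite /esum (big_cat_nat (n := n)) ?(ltnW lt_nN) //= (big_cat_nat (n := n.+1) (m := n)) //=.
rewrite big_nat1 big_nat big1 ?add0r => [|i /andP[_ lt_in]]; last first.
  by rewrite /ecoef (gb_small lt_in) ?(mulr0, mul0r).
rewrite big_nat big1 ?addr0 => [|i /andP[lt_ni _]]; last first.
  by rewrite /ecoef addn0 (gb_small lt_ni) ?(mulr0, mul0r).
by rewrite /ecoef addn0 !gbnn fallnn mulr0 add0r subrr expr0z !mul1r.
Qed.

Lemma esum_S w n b K :
  \sum_(0 <= s < K.+1) gb s n * ((-1) ^+ s * q ^ (- N%:Z * s%:Z + tri s) *
      chain_coef b (K - s) * esum w s (K - s)) = hcoef n b K * esum w n b.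
Proof.
rewrite /esum mulr_sumr.
under [RHS]eq_bigr => a _ do rewrite mulrA -ecoef_S mulr_suml.
rewrite exchange_big_nat /=; apply: eq_bigr => s _; rewrite !mulr_sumr.
by apply: eq_bigr => a _; ring.
Qed.

Lemma fsum_N w rho c K :
  \sum_(0 <= r < N) gb r rho * (q ^ (r%:Z + (c + r)%N%:Z * (r%:Z + rho%:Z) - r%:Z * rho%:Z) *
      Pcoef K (c + r) * fsum w r (c + r)) = chain_coef c (K - rho) * fsum w rho K.
Proof.
rewrite /fsum mulr_sumr.
under [RHS]eq_big_nat => a /andP[_ lt_a] do rewrite mulrA -fcoef_N // mulr_suml.
rewrite exchange_big_nat /=; apply: eq_bigr => s _; rewrite !mulr_sumr.
by apply: eq_bigr => a _; ring.
Qed.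

(** The row [w] times [twist_mx], for functions on all naturals, which keeps ordinals out of the
    summations. *)
Definition twist_vec (w : nat -> F) (n : nat) : F := \sum_(0 <= b < N) twist_coef b * gb b n * w b.

Lemma esum_twist_vec w n c :
  esum (twist_vec w) n c = q ^ (1 - N%:Z) *
    \sum_(0 <= r < N) gb r n * (q ^ (r%:Z + (c + r)%N%:Z * r%:Z) * fsum w r (c + r)).
Proof.
transitivity (\sum_(0 <= b < N) (\sum_(0 <= a < N) ecoef n c a * (twist_coef b * gb b a)) * w b).
  rewrite /esum /twist_vec; under eq_bigr => a _ do rewrite mulr_sumr.
  rewrite exchange_big_nat /=; apply: eq_bigr => b _; rewrite mulr_suml.
  by apply: eq_bigr => a _; ring.
transitivity (\sum_(0 <= b < N) (q ^ (1 - N%:Z) * \sum_(0 <= r < N) gb r n *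
   (q ^ (r%:Z + (c + r)%N%:Z * r%:Z) * fcoef r (c + r) b)) * w b).
  apply: eq_big_nat => b /andP[_ lt_bN]; congr (_ * _).
  have [lt_bn|le_nb] := ltnP b n; last exact: ecoef_W.
  rewrite !big1 ?mulr0 // => a _.
    rewrite /fcoef; have [lt_ba|le_ab] := ltnP b a; first by rewrite (gb_small lt_ba); ring.
    by rewrite (@gb_small a) ?(leq_ltn_trans le_ab) //; ring.
  rewrite /ecoef; have [lt_ba|le_ab] := ltnP b a; first by rewrite (gb_small lt_ba); ring.
  by rewrite (@gb_small a) ?(leq_ltn_trans le_ab) //; ring.
rewrite mulr_sumr; under [RHS]eq_bigr => r _ do rewrite /fsum !mulr_sumr.
rewrite [RHS]exchange_big_nat /=; apply: eq_bigr => b _; rewrite mulr_sumr mulr_suml.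
by apply: eq_bigr => r _; ring.
Qed.

(* [chain_sum V k j g] sums over [c_j >= ... >= c_(j+k-1)], with the weights [chain_coef] of consecutive entries. *)
Fixpoint chain_sum (V : nat -> int) (k j : nat) (g : nat -> F) : F :=
  match k with
  | 0 => g 0%N
  | k'.+1 => \sum_(0 <= c < N) q ^ (- (V j * c%:Z)) * chain_sum V k' j.+1 (fun b => chain_coef b c) * g c
  end.

Lemma eq_chain_sum V V' k j g g' : (forall i, (j <= i < j + k)%N -> V i = V' i) -> g =1 g' ->
  chain_sum V k j g = chain_sum V' k j g'.
Proof.
elim: k j g g' => [|k IH] j g g' eqV eqg /=; first exact: eqg.
apply: eq_bigr => c _; rewrite eqg eqV ?leqnn ?addnS ?ltnS ?leq_addr //.
by congr (_ * _ * _); apply: IH => // i lt_i; apply: eqV; lia.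
Qed.

Lemma chain_sum_sum V k j r (P : pred nat) (f : nat -> nat -> F) :
  \sum_(i <- r | P i) chain_sum V k j (f i) = chain_sum V k j (fun c => \sum_(i <- r | P i) f i c).
Proof.
case: k => [|k] //=; rewrite exchange_big /=; apply: eq_bigr => c _.
by rewrite -mulr_sumr.
Qed.

Lemma chain_sum_scale V k j x g : x * chain_sum V k j g = chain_sum V k j (fun c => x * g c).
Proof. by case: k => [|k] //=; rewrite mulr_sumr; apply: eq_bigr => c _; ring. Qed.

(** The flag is false for the first auxiliary index, which has no predecessor to couple with. *)
Definition Pker (b : bool) (K K' : nat) : F := if b then Pcoef K K' else 1.

(* [kernel_sum X k f] sums [f K_k] over [K_1 >= ... >= K_k] with the weights [Pcoef] of consecutive entries. *)
Fixpoint kernel_sum (X : nat -> int) (k : nat) (f : nat -> F) : F :=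
  match k with
  | 0 => f 0%N
  | k'.+1 => kernel_sum X k' (fun K => \sum_(0 <= K' < N) q ^ (K'%:Z * X k') * Pker (0 < k')%N K K' * f K')
  end.

Lemma eq_kernel_sum X X' k f f' : (forall i, (i < k)%N -> X i = X' i) -> f =1 f' -> kernel_sum X k f = kernel_sum X' k f'.
Proof.
elim: k f f' => [|k IH] f f' eqX eqf /=; first exact: eqf.
apply: IH => [i lt_ik|K]; first by apply: eqX; rewrite ltnW.
by apply: eq_bigr => K' _; rewrite eqf eqX.
Qed.

Lemma kernel_sum_sum X k r (P : pred nat) (f : nat -> nat -> F) :
  \sum_(i <- r | P i) kernel_sum X k (f i) = kernel_sum X k (fun K => \sum_(i <- r | P i) f i K).
Proof.
elim: k f => [|k IH] f //=; rewrite IH; apply: eq_kernel_sum => // K.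
by rewrite exchange_big /=; apply: eq_bigr => K' _; rewrite mulr_sumr.
Qed.

Lemma kernel_sum_scale X k x f : x * kernel_sum X k f = kernel_sum X k (fun K => x * f K).
Proof.
elim: k f => [|k IH] f //=; rewrite IH; apply: eq_kernel_sum => // K.
by rewrite mulr_sumr; apply: eq_bigr => K' _; ring.
Qed.

(** The flag is false as long as no index of the period has been summed out. *)
Definition hker (b : bool) (n c K : nat) : F := if b then hcoef n c K else 1.

(** The weight of a single late index: [false] at the last position of a period, where it is signed
    and quadratic, [true] at the positions before it, where $\beta=-1$. *)
Definition step_wt (b : bool) (a : nat) : F :=
  if b then q ^ (- a%:Z) else (-1) ^+ a * q ^ (- N%:Z * a%:Z + tri a).

(** The linear weight of the inner late positions, multiplied by the kernel [hcoef], yields the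
    signed quadratic weight of the last position. One computation therefore serves all late
    indices. *)
Lemma hcoef_Pcoef a c K :
  q ^ (- a%:Z) * q ^ (- (a%:Z * c%:Z)) * q ^ (- (K%:Z * a%:Z)) * hcoef a c K =
  (-1) ^+ a * q ^ (- N%:Z * a%:Z + tri a) * Pcoef K (a + c).
Proof.
rewrite /hcoef /Pcoef.
have E : q ^ (- a%:Z) * q ^ (- (a%:Z * c%:Z)) * q ^ (- (K%:Z * a%:Z)) *
   q ^ (- (N%:Z + c%:Z) * K%:Z + (N%:Z - 1) * c%:Z + tri a + a%:Z * c%:Z) =
   q ^ (- N%:Z * a%:Z + tri a) * q ^ (- (N%:Z + (a + c)%N%:Z) * K%:Z + (N%:Z - 1) * (a + c)%N%:Z).
  by rewrite -!qzD; congr (q ^ _); rewrite PoszD; ring.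
by apply: (lincomb (c := (-1) ^+ a * gb K (a + c) * fall (a + c) K) E); ring.
Qed.

(** The index [a] and the first chain variable [c] combine into [K' = a + c], and for fixed [K'] the
    remaining sum is [esum_S]. The chain loses a variable and the kernel gains one. *)
Lemma step_S V k j w (b : bool) (s K : nat) (x : int) :
  \sum_(0 <= a < N) gb a s * q ^ (a%:Z * (x - s%:Z)) * step_wt b a *
     ((\sum_(0 <= c < N) q ^ (- ((s%:Z - x + b%:Z * a%:Z) * c%:Z)) * chain_sum V k j (fun c' => chain_coef c' c) *
        (hker b a c K * esum w a c)) * q ^ (- (b%:Z * K%:Z * a%:Z))) =
  \sum_(0 <= K' < N) q ^ (K'%:Z * x) * Pker b K K' *
     (chain_sum V k j (fun c => hcoef s c K' * esum w s c) * q ^ (- (K'%:Z * s%:Z))).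
Proof.
transitivity (\sum_(0 <= a < N) \sum_(0 <= c < N) gb a s * ((-1) ^+ a * q ^ (- N%:Z * a%:Z + tri a) *
   (q ^ ((a + c)%N%:Z * x) * q ^ (- ((a + c)%N%:Z * s%:Z)) * Pker b K (a + c)) *
   chain_sum V k j (fun c' => chain_coef c' c) * esum w a c)).
  apply: eq_bigr => a _; rewrite mulr_suml mulr_sumr; apply: eq_bigr => c _.
  have E : q ^ (a%:Z * (x - s%:Z)) * q ^ (- ((s%:Z - x + b%:Z * a%:Z) * c%:Z)) =
    q ^ ((a + c)%N%:Z * x) * q ^ (- ((a + c)%N%:Z * s%:Z)) * q ^ (- (b%:Z * a%:Z * c%:Z)).
    by rewrite -!qzD; congr (q ^ _); rewrite PoszD; ring.
  transitivity (gb a s * (q ^ (a%:Z * (x - s%:Z)) * q ^ (- ((s%:Z - x + b%:Z * a%:Z) * c%:Z))) *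
     (step_wt b a * hker b a c K * q ^ (- (b%:Z * K%:Z * a%:Z))) * chain_sum V k j (fun c' => chain_coef c' c) * esum w a c).
    by ring.
  rewrite E {E}; case: b => /=.
    have E := hcoef_Pcoef a c K; rewrite !mul1r.
    by apply: (lincomb (c := gb a s * q ^ ((a + c)%N%:Z * x) * q ^ (- ((a + c)%N%:Z * s%:Z)) *
      chain_sum V k j (fun c' => chain_coef c' c) * esum w a c) E); ring.
  by rewrite !mul0r oppr0 expr0z; ring.
rewrite sum_antidiag => [|a c le_N]; last by rewrite esum_big // !mulr0.
apply: eq_big_nat => K' /andP[_ lt_K'].
set z := q ^ (K'%:Z * x) * Pker b K K'; set y := q ^ (- (K'%:Z * s%:Z)).
transitivity (\sum_(0 <= a < K'.+1) (z * y) * chain_sum V k j (fun c =>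
  (gb a s * ((-1) ^+ a * q ^ (- N%:Z * a%:Z + tri a) * chain_coef c (K' - a) * esum w a (K' - a))))).
  apply: eq_big_nat => a /andP[_ le_aK]; rewrite subnKC // /z /y.
  transitivity (q ^ (K'%:Z * x) * Pker b K K' * q ^ (- (K'%:Z * s%:Z)) *
    ((gb a s * ((-1) ^+ a * q ^ (- N%:Z * a%:Z + tri a)) * esum w a (K' - a)) *
      chain_sum V k j (fun c => chain_coef c (K' - a)))); first by ring.
  by congr (_ * _); rewrite chain_sum_scale; apply: eq_chain_sum => // c; ring.
rewrite -mulr_sumr chain_sum_sum; transitivity (z * y * chain_sum V k j (fun c => hcoef s c K' * esum w s c)); last by ring.
by congr (_ * _); apply: eq_chain_sum => // c; rewrite esum_S.
Qed.

(** * One period of the summation *)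

Section Period.
Variable m : nat.
Let d := (2 * m + 1)%N.

(** The linear form through which the history [h] enters the exponent of a later index of residue
    [x]. *)
Definition coupling (x : nat) (h : seq nat) : int :=
  \sum_(0 <= i < size h | ~~ (d %| i.+1)%N) Delta i.+1 x m * (nth 0%N h i)%:Z.

Lemma coupling_rcons x h a : coupling x (rcons h a) =
  coupling x h + (if (d %| (size h).+1)%N then 0 else Delta (size h).+1 x m * a%:Z).
Proof.
rewrite /coupling size_rcons big_mkcond /= big_nat_recr //= -big_mkcond /= nth_rcons ltnn eqxx.
rewrite (fun_if (fun b => b)) if_neg; congr (_ + _).
rewrite big_nat_cond [in RHS]big_nat_cond; apply: eq_bigr => i /andP[/andP[_ lt_i] _].
by rewrite nth_rcons lt_i.
Qed.

Lemma coupling_nil x : coupling x [::] = 0.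
Proof. by rewrite /coupling big_geq. Qed.

Definition sgn_wt (a : nat) : F := (-1) ^+ a * q ^ (- N%:Z * a%:Z + tri a).

(* The index following the history [h] = n_1, ..., n_(j-1) is n_j = a, with j = size h + 1. *)
Definition next_exponent (h : seq nat) : int :=
  if ((size h).+1 == m + 1 %[mod d])%N then 0 else
  \sum_(0 <= i < size h | ~~ (d %| i.+1)%N) Delta i.+1 (size h).+1 m * (nth 0%N h i)%:Z.

Definition term_wt (h : seq nat) (a : nat) : F :=
  gb a (last 0%N h) * q ^ (a%:Z * next_exponent h) *
  (if ((size h).+1 == m + 1 %[mod d])%N then sgn_wt a else 1) *
  (if ((size h).+1 == 2 * m + 1 %[mod d])%N then sgn_wt a else 1) *
  q ^ (beta (size h).+1 m * a%:Z).

Fixpoint nested_sum (f : seq nat -> F) (k : nat) (h : seq nat) : F :=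
  if k is k'.+1 then \sum_(0 <= a < N) term_wt h a * nested_sum f k' (rcons h a) else f h.

Lemma eq_mod_pos tau y x : (0 < y <= d)%N -> (0 < x <= d)%N -> ((d * tau + y) %% d == x %% d)%N = (y == x).
Proof.
move=> Hy Hx; rewrite mulnC modnMDl !modn_lt2; try lia.
by do 2?case: ltnP => ?; lia.
Qed.

Lemma beta_pos tau y : (0 < y <= d)%N ->
  beta (d * tau + y) m = if (y <= m)%N then 1 else if (y < d)%N then -1 else 0.
Proof.
move=> Hy; rewrite /beta -/d mulnC modnMDl modn_lt2; last lia.
by case: (ltnP y d) => Hyd; do ?[case: ifP => ?]; lia.
Qed.

Lemma dvd_pos tau y : (0 < y <= d)%N -> (d %| d * tau + y)%N = (y == d).
Proof. by move=> Hy; rewrite /dvdn -[0%N](modnn d) eq_mod_pos //; lia. Qed.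

Lemma Delta_mod i j tau sigma : Delta (d * tau + i) (d * sigma + j) m = Delta i j m.
Proof.
rewrite /Delta -/d.
have -> : (d * tau + i + (d * sigma + j) = (tau + sigma) * d + (i + j))%N by ring.
have -> : (d * tau + i + 1 = tau * d + (i + 1))%N by lia.
have -> : (d * tau + i = tau * d + i)%N by lia.
have -> : (d * sigma + j = sigma * d + j)%N by lia.
by rewrite !modnMDl.
Qed.

Lemma next_exponent_low h tau y : size h = (d * tau + y)%N -> (y < m)%N -> next_exponent h = coupling y.+1 h.
Proof.
move=> Eh lt_ym; rewrite /next_exponent Eh -addnS eq_mod_pos ?ifN; try lia.
rewrite /coupling Eh; apply: eq_bigr => i _; congr (_ * _).
by rewrite -{1}[i.+1]add0n -(muln0 d) Delta_mod.
Qed.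

(** The reflection $j\mapsto 1-j$ at work: position [d - k] is congruent to $1-(k+1)$, so its
    exponent is minus the coupling at [k.+1]. The couplings at $1,\dots,m$ therefore suffice. *)
Lemma next_exponent_high h tau k : size h = (d * tau + (d - k.+1))%N -> (k < m)%N -> next_exponent h = - coupling k.+1 h.
Proof.
move=> Eh lt_km; rewrite /next_exponent Eh -addnS eq_mod_pos ?ifN; try lia.
rewrite /coupling Eh big_nat_cond [in RHS]big_nat_cond -sumrN; apply: eq_bigr => i /andP[_].
have Ei : (i.+1 = d * (i.+1 %/ d) + i.+1 %% d)%N by rewrite mulnC -divn_eq.
rewrite -mulNr /dvdn => ndvd; congr (_ * _).
have lt_d : (i.+1 %% d < d)%N by rewrite ltn_mod; lia.
have Hr : (0 < i.+1 %% d < d)%N by rewrite lt_d lt0n ndvd.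
have -> : k.+1 = (d * 0 + k.+1)%N by rewrite muln0.
rewrite Ei !Delta_residues -/d; try lia.
by move: (i.+1 %% d)%N Hr => r Hr; do 4?case: ifP; lia.
Qed.

Lemma coupling_rcons_low h a tau y x : size h = (d * tau + y)%N -> (y < m)%N -> (0 < x <= m)%N ->
  coupling x (rcons h a) = coupling x h - ((x == y.+1) || (x == y.+2))%:R * a%:Z.
Proof.
move=> Eh lt_ym Hx; rewrite coupling_rcons Eh -addnS dvd_pos ?ifN; try lia.
have -> : x = (d * 0 + x)%N by lia.
rewrite Delta_residues -/d; try lia.
rewrite muln0 add0n; congr (_ + _).
by case: ifP => [|_]; [|case: ifP]; lia.
Qed.

(** An index at position [d - k] undoes the effect of an equal index at position [k]. For [k = 0]
    the position is a multiple of [d], and such indices act on no later one. *)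
Lemma coupling_rcons_high h a tau k x : size h = (d * tau + (d - k.+1))%N -> (k <= m)%N -> (0 < x <= m)%N ->
  coupling x (rcons h a) = coupling x h + ((0 < k) && ((x == k) || (x == k.+1)))%N%:R * a%:Z.
Proof.
move=> Eh lt_ym Hx; rewrite coupling_rcons Eh -addnS dvd_pos; try lia.
congr (_ + _); case: ifP => [|Hk]; first by case: k {Eh lt_ym} => [|k]; rewrite ?mul0r //; lia.
have -> : x = (d * 0 + x)%N by lia.
rewrite Delta_residues -/d; try lia.
rewrite muln0 add0n; congr (_ * _); have -> /= : (0 < k)%N by lia.
by case: (x =P k) => ?; case: (x =P k.+1) => ? /=; (case: ifP => [|?]; [|case: ifP]); lia.
Qed.

Lemma term_wt_S h tau k a : size h = (d * tau + (d - k.+1))%N -> (k < m)%N ->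
  term_wt h a = gb a (last 0%N h) * q ^ (a%:Z * - coupling k.+1 h) * step_wt (0 < k)%N a.
Proof.
move=> Eh lt_km; rewrite /term_wt (next_exponent_high Eh lt_km) Eh -addnS -/d beta_pos ?eq_mod_pos; try lia.
rewrite ifN; last by lia.
rewrite !mulr1 -mulrA; congr (_ * _); rewrite /step_wt /sgn_wt; case: posnP => [k0|k_gt0].
  by do ![case: ifP => ?]; try lia; rewrite mul0r expr0z mulr1.
by do ![case: ifP => ?]; try lia; rewrite mul1r mulN1r.
Qed.

Lemma term_wt_W h tau a : (0 < m)%N -> size h = (d * tau + m)%N ->
  term_wt h a = gb a (last 0%N h) * (sgn_wt a * q ^ (- a%:Z)).
Proof.
move=> m_gt0 Eh; rewrite /term_wt /next_exponent Eh -addnS -/d beta_pos ?eq_mod_pos; try lia.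
rewrite addn1 eqxx mulr0 expr0z mulr1; do ![case: ifP => ?]; try lia.
by rewrite mulr1 mulN1r mulrA.
Qed.

Lemma term_wt_N h tau y a : size h = (d * tau + y)%N -> (y < m)%N ->
  term_wt h a = gb a (last 0%N h) * q ^ (a%:Z * coupling y.+1 h + a%:Z).
Proof.
move=> Eh lt_ym; rewrite /term_wt (next_exponent_low Eh lt_ym) Eh -addnS -/d beta_pos ?eq_mod_pos; try lia.
do ![case: ifP => ?]; try lia.
by rewrite !mulr1 mul1r qzD mulrA.
Qed.

Lemma term_wt_0 h a : m = 0%N -> term_wt h a = gb a (last 0%N h) * (sgn_wt a * sgn_wt a).
Proof.
move=> m0; rewrite /term_wt /next_exponent /beta /d m0 !modn1 /=.
by rewrite mulr0 mul0r expr0z !mulr1 mulrA.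
Qed.

(** The ansatz for the sum over all later periods: the past enters only through its last entry [n]
    and the parameters [V], to be filled with the couplings. *)
Definition closed_form (w : nat -> F) (k : nat) (n : nat) (V : nat -> int) : F := chain_sum V k 0 (esum w n).

Section OnePeriod.
Variables (f : seq nat -> F) (w : nat -> F).
Hypothesis fE : forall h, (d %| size h)%N -> (last 0%N h < N)%N ->
  f h = closed_form w m (last 0%N h) (fun j => coupling j.+1 h).

(** The invariant while the last indices are summed: each step moves one variable from the chain to
    the kernel. The term at [j.+1 == k] compensates the change that the last entry of [h], once it
    is itself summed, has made to the coupling at [k]. *)
Lemma nested_sum_S k h tau : (k <= m)%N -> size h = (d * tau + (d - k))%N -> (last 0%N h < N)%N ->
  nested_sum f k h = kernel_sum (fun j => - coupling j.+1 h + (j.+1 == k)%:R * (last 0%N h)%:Z) k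
   (fun K => chain_sum (fun j => coupling j.+1 h) (m - k) k
      (fun c => hker (0 < k)%N (last 0%N h) c K * esum w (last 0%N h) c) *
      q ^ (- ((0 < k)%N%:Z * K%:Z * (last 0%N h)%:Z))).
Proof.
elim: k h => [|k IH] h le_km Eh lt_n /=.
  rewrite fE //; last first.
    by rewrite Eh subn0 -mulnSr dvdn_mulr.
  rewrite subn0 /closed_form !mul0r oppr0 expr0z mulr1.
  by apply: eq_chain_sum => // c; rewrite mul1r.
set s := last 0%N h.
transitivity (kernel_sum (fun j => - coupling j.+1 h) k (fun K => \sum_(0 <= a < N)
   gb a s * q ^ (a%:Z * (- coupling k.+1 h + s%:Z - s%:Z)) * step_wt (0 < k)%N a *
  ((\sum_(0 <= c < N) q ^ (- ((s%:Z - (- coupling k.+1 h + s%:Z) + (0 < k)%N%:Z * a%:Z) * c%:Z)) *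
     chain_sum (fun j => coupling j.+1 h) (m - k.+1) k.+1 (fun c' => chain_coef c' c) *
     (hker (0 < k)%N a c K * esum w a c)) * q ^ (- ((0 < k)%N%:Z * K%:Z * a%:Z))))).
  rewrite -kernel_sum_sum; apply: eq_big_nat => a /andP[_ lt_aN].
  have Ea : size (rcons h a) = (d * tau + (d - k))%N by rewrite size_rcons Eh; lia.
  rewrite (term_wt_S _ Eh) // IH ?last_rcons //; last exact: ltnW.
  rewrite kernel_sum_scale; apply: eq_kernel_sum => [j lt_jk|K].
    rewrite (coupling_rcons_high _ Eh); try lia.
  rewrite addrK; congr (_ * _).
  have -> : (m - k = (m - k.+1).+1)%N by lia.
  rewrite /=; congr (_ * _); apply: eq_bigr => c _; congr (_ * _ * _).
    congr (q ^ - (_ * _)); rewrite (coupling_rcons_high _ Eh); try lia.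
  apply: eq_chain_sum => // i Hi; rewrite (coupling_rcons_high _ Eh); lia.
rewrite /=; apply: eq_kernel_sum => [j lt_jk|K]; first by rewrite eqSS (ltn_eqF lt_jk); lia.
rewrite step_S; apply: eq_bigr => K' _; rewrite eqxx !mul1r.
by congr (_ * _ * _).
Qed.

(** The middle index, of residue $m+1$: the chain is used up, so [esum0] applies, and the signs of
    its own weight and of the kernel cancel. *)
Lemma fsum_W r K :
  \sum_(0 <= a < N) gb a r * (sgn_wt a * q ^ (- a%:Z)) *
    (hcoef a 0 K * esum w a 0 * q ^ (- (K%:Z * a%:Z))) = fsum w r K.
Proof.
apply: eq_big_nat => a /andP[_ lt_aN]; rewrite esum0 //.
have H := hcoef_Pcoef a 0 K; rewrite mulr0 oppr0 expr0z mulr1 addn0 in H.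
have E : q ^ (- N%:Z * a%:Z + tri a) * q ^ (- N%:Z * a%:Z + tri a) *
    q ^ (- (N%:Z + a%:Z) * K%:Z + (N%:Z - 1) * a%:Z) =
    q ^ (- N%:Z * K%:Z + a%:Z * a%:Z - N%:Z * a%:Z - K%:Z * a%:Z).
  by rewrite -!qzD; congr (q ^ _); have := tri2 a; lia.
have S : (-1) ^+ a * (-1) ^+ a = 1 :> F by rewrite -exprD addnn -mul2n exprM sqrrN expr1n expr1n.
transitivity (gb a r * w a * sgn_wt a * (q ^ (- a%:Z) * q ^ (- (K%:Z * a%:Z)) * hcoef a 0 K)).
  by ring.
rewrite H /sgn_wt /Pcoef /fcoef -E.
by apply: (lincomb (c := gb a r * w a * q ^ (- N%:Z * a%:Z + tri a) * q ^ (- N%:Z * a%:Z + tri a) *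
    q ^ (- (N%:Z + a%:Z) * K%:Z + (N%:Z - 1) * a%:Z) * gb K a * fall a K) S); ring.
Qed.

Lemma nested_sum_W h tau : (0 < m)%N -> size h = (d * tau + m)%N ->
  nested_sum f m.+1 h = kernel_sum (fun j => - coupling j.+1 h) m (fsum w (last 0%N h)).
Proof.
move=> m_gt0 Eh /=.
transitivity (kernel_sum (fun j => - coupling j.+1 h) m (fun K => \sum_(0 <= a < N)
   gb a (last 0%N h) * (sgn_wt a * q ^ (- a%:Z)) *
    (hcoef a 0 K * esum w a 0 * q ^ (- (K%:Z * a%:Z))))); last first.
  by apply: eq_kernel_sum => // K; rewrite fsum_W.
rewrite -kernel_sum_sum; apply: eq_big_nat => a /andP[_ lt_aN].
have Ea : size (rcons h a) = (d * tau + (d - m))%N by rewrite size_rcons Eh; lia.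
have Eh' : size h = (d * tau + (d - m.+1))%N by lia.
rewrite (term_wt_W _ _ Eh) // (nested_sum_S _ Ea) ?last_rcons //.
rewrite kernel_sum_scale; apply: eq_kernel_sum => [j lt_jk|K].
  by rewrite (coupling_rcons_high _ Eh'); lia.
by rewrite m_gt0 mul1r subnn.
Qed.

(** The shear $K=c+a$ cancels the mixed terms in [v] and [a]: the new chain variable [c] keeps the
    coupling [v], and the sum over [a] becomes the one in [fcoef_N]. *)
Lemma sum_N (v : int) k j (V : nat -> int) rho K0 b :
  \sum_(0 <= a < N) gb a rho * q ^ (a%:Z * v + a%:Z) *
    (\sum_(0 <= K < N) q ^ (K%:Z * (- v + a%:Z)) * Pker b K0 K *
      (chain_sum V k j (fun c => chain_coef c (K - a)) * fsum w a K)) =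
  \sum_(0 <= c < N) q ^ (- (v * c%:Z)) * chain_sum V k j (fun c' => chain_coef c' c) *
    (\sum_(0 <= a < N) gb a rho * (q ^ (a%:Z + (c + a)%N%:Z * a%:Z) * Pker b K0 (c + a) * fsum w a (c + a))).
Proof.
under eq_bigr => a _ do rewrite mulr_sumr.
rewrite sum_shear => [|a K H]; last by rewrite fsum_small // !mulr0.
apply: eq_bigr => c _; rewrite mulr_sumr; apply: eq_bigr => a _; rewrite addnK.
have E : q ^ (a%:Z * v + a%:Z) * q ^ ((c + a)%N%:Z * (- v + a%:Z)) =
  q ^ (- (v * c%:Z)) * q ^ (a%:Z + (c + a)%N%:Z * a%:Z).
  by rewrite -!qzD; congr (q ^ _); rewrite PoszD; ring.
by apply: (lincomb (c := gb a rho * Pker b K0 (c + a) * chain_sum V k j (fun c' => chain_coef c' c) * fsum w a (c + a)) E); ring.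
Qed.

Lemma chain_coef0 b : chain_coef 0 b = 1.
Proof. by rewrite /chain_coef gbn0 mul0r oppr0 expr0z mulr1. Qed.

(** Through the first half of the period the exchange runs backwards: each step consumes a kernel
    variable and restores a chain variable, with [j] variables in the kernel and [k] in the
    chain. *)
Lemma nested_sum_N k j h tau : (j + k = m)%N -> (0 < j)%N -> size h = (d * tau + j)%N ->
  nested_sum f (d - j) h = kernel_sum (fun i => - coupling i.+1 h) j (fun K =>
    chain_sum (fun i => coupling i.+1 h + (i == j)%:R * (last 0%N h)%:Z) k j (fun c => chain_coef c (K - last 0%N h)) *
    fsum w (last 0%N h) K).
Proof.
elim: k j h => [|k IH] j h Em j_gt0 Eh.
  rewrite addn0 in Em; have -> : (d - j = m.+1)%N by lia.
  rewrite (@nested_sum_W _ tau) -?Em //.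
  by apply: eq_kernel_sum => // K; rewrite /= chain_coef0 mul1r.
have -> : (d - j = (d - j.+1).+1)%N by lia.
rewrite /=; set rho := last 0%N h; set v := coupling j.+1 h.
transitivity (kernel_sum (fun i => - coupling i.+1 h) j (fun K0 => \sum_(0 <= a < N)
   gb a rho * q ^ (a%:Z * v + a%:Z) *
    (\sum_(0 <= K < N) q ^ (K%:Z * (- v + a%:Z)) * Pker true K0 K *
      (chain_sum (fun i => coupling i.+1 h) k j.+1 (fun c => chain_coef c (K - a)) * fsum w a K)))).
  rewrite -kernel_sum_sum; apply: eq_big_nat => a /andP[_ lt_aN].
  have Ea : size (rcons h a) = (d * tau + j.+1)%N by rewrite size_rcons Eh; lia.
  rewrite (term_wt_N _ Eh) ?(IH _ _ _ _ Ea) ?last_rcons //; try lia.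
  rewrite /= kernel_sum_scale; apply: eq_kernel_sum => [i lt_ij|K].
    by rewrite (coupling_rcons_low _ Eh); lia.
  congr (_ * _); rewrite j_gt0; apply: eq_bigr => K' _; congr (_ * _ * (_ * _)).
    by congr (q ^ (_ * _)); rewrite (coupling_rcons_low _ Eh); lia.
  by apply: eq_chain_sum => // i Hi; rewrite (coupling_rcons_low _ Eh); lia.
apply: eq_kernel_sum => // K0; rewrite sum_N mulr_suml; apply: eq_bigr => c _.
have -> : \sum_(0 <= a < N) gb a rho * (q ^ (a%:Z + (c + a)%N%:Z * a%:Z) * Pker true K0 (c + a) * fsum w a (c + a)) =
   q ^ (- (c%:Z * rho%:Z)) * (chain_coef c (K0 - rho) * fsum w rho K0).
  rewrite -fsum_N mulr_sumr; apply: eq_bigr => a _.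
  have E : q ^ (- (c%:Z * rho%:Z)) * q ^ (a%:Z + (c + a)%N%:Z * (a%:Z + rho%:Z) - a%:Z * rho%:Z) =
    q ^ (a%:Z + (c + a)%N%:Z * a%:Z).
    by rewrite -!qzD; congr (q ^ _); rewrite PoszD; ring.
  by apply: (lincomb (c := - gb a rho * Pcoef K0 (c + a) * fsum w a (c + a)) E); rewrite /Pker; ring.
have E : q ^ (- ((v + (j == j)%:R * rho%:Z) * c%:Z)) = q ^ (- (v * c%:Z)) * q ^ (- (c%:Z * rho%:Z)).
  by rewrite -qzD eqxx mul1r; congr (q ^ _); ring.
rewrite E (@eq_chain_sum _ (fun i => coupling i.+1 h) _ _ _ (fun c' => chain_coef c' c)) => [|i Hi|//]; first by ring.
by rewrite gtn_eqF ?mul0r ?addr0 //; lia.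
Qed.

Lemma nested_sum_period h : (d %| size h)%N -> (last 0%N h < N)%N ->
  nested_sum f d h = q ^ (N%:Z - 1) * closed_form (twist_vec w) m (last 0%N h) (fun j => coupling j.+1 h).
Proof.
move=> /dvdnP[tau Eh]; rewrite mulnC -[(d * tau)%N]addn0 in Eh => lt_n; rewrite /closed_form.
have [m0|m_gt0] := posnP m.
  (* In a period of length 1 the only index carries both signed weights. Their signs cancel, and
     their product is [twist_coef] up to the factor $q^{N-1}$. *)
  rewrite (_ : d = 1%N) ?m0 /=; last by lia.
  rewrite esum0 // mulr_sumr; apply: eq_big_nat => a /andP[_ lt_a].
  rewrite term_wt_0 // fE ?last_rcons //; last by rewrite /d m0 dvd1n.
  rewrite /closed_form m0 /= esum0 //.
  have E : sgn_wt a * sgn_wt a = q ^ (N%:Z - 1) * twist_coef a.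
    rewrite /sgn_wt mulrACA -exprD addnn -mul2n exprM sqrrN expr1n expr1n mul1r -!qzD.
    by congr (q ^ _); have := tri2 a; rewrite /twist_coef; lia.
  by rewrite E; ring.
have -> : d = (d - 1).+1 by lia.
have Em : m = (m.-1).+1 by lia.
rewrite /=; set n := last 0%N h; set v := coupling 1 h.
transitivity (\sum_(0 <= a < N)
   gb a n * q ^ (a%:Z * v + a%:Z) *
    (\sum_(0 <= K < N) q ^ (K%:Z * (- v + a%:Z)) * Pker false 0 K *
      (chain_sum (fun i => coupling i.+1 h) m.-1 1 (fun c => chain_coef c (K - a)) * fsum w a K))).
  apply: eq_big_nat => a /andP[_ lt_aN].
  have Ea : size (rcons h a) = (d * tau + 1)%N by rewrite size_rcons Eh; lia.
  rewrite (term_wt_N _ Eh) // (@nested_sum_N m.-1 1 _ tau) ?last_rcons //; try lia.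
  rewrite /=; congr (_ * _); apply: eq_bigr => K' _; congr (_ * _ * (_ * _)).
    by congr (q ^ (_ * _)); rewrite (coupling_rcons_low _ Eh); lia.
  by apply: eq_chain_sum => // i Hi; rewrite (coupling_rcons_low _ Eh); lia.
rewrite sum_N [in RHS]Em /= mulr_sumr; apply: eq_bigr => c _; rewrite esum_twist_vec.
have -> : \sum_(0 <= a < N) gb a n * (q ^ (a%:Z + (c + a)%N%:Z * a%:Z) * Pker false 0 (c + a) * fsum w a (c + a)) =
  \sum_(0 <= a < N) gb a n * (q ^ (a%:Z + (c + a)%N%:Z * a%:Z) * fsum w a (c + a)).
  by apply: eq_bigr => a _; rewrite /Pker mulr1.
have E : q ^ (N%:Z - 1) * q ^ (1 - N%:Z) = 1.
  by rewrite -qzD (_ : _ + _ = 0) //; lia.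
rewrite /v; set S := \sum_(_ <= _ < _) _; set z := q ^ (- _).
by apply: (lincomb (c := - z * S * chain_sum (fun j => coupling j.+1 h) m.-1 1 (fun c' => chain_coef c' c)) E); ring.
Qed.

End OnePeriod.

Lemma nested_sumD f k b h : nested_sum f (k + b) h = nested_sum (nested_sum f k) b h.
Proof.
elim: b h => [|b IH] h; first by rewrite addn0.
by rewrite addnS /=; apply: eq_bigr => a _; rewrite IH.
Qed.

Lemma nested_sum_scale x f k h : nested_sum (fun h => x * f h) k h = x * nested_sum f k h.
Proof.
elim: k h => [|k IH] h //=; rewrite mulr_sumr.
by apply: eq_bigr => a _; rewrite IH; ring.
Qed.

(** The start of the induction on periods: with no period left, the chain sum has to be concentrated
    at 0. For positive [k] the sum is alternating and vanishes by [gb_pch_sum] at $a=0$. *)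
Lemma esum_final_coef n k : (n < N)%N -> esum final_coef n k = if k is 0 then final_coef n else 0.
Proof.
move=> lt_nN; case: k => [|k]; first exact: esum0.
have [le_N|lt_N] := leqP N (n + k.+1); first by rewrite esum_big.
rewrite /esum.
transitivity (\sum_(0 <= a < N) gb a n * gb (n + k.+1) a *
   ((-1) ^+ a * q ^ (a%:Z * a%:Z - a%:Z * n%:Z - tri a) * (q ^ (- N%:Z * k.+1%:Z) * fall 0 (n + k.+1)))).
  apply: eq_bigr => a _; rewrite /ecoef /final_coef.
  have [lt_a|le_a] := ltnP (n + k.+1) a; first by rewrite (@gb_small (n + k.+1)) //; ring.
  rewrite -(fall_cat (leq0n a) le_a).
  have E : q ^ (- N%:Z * k.+1%:Z + a%:Z * a%:Z - a%:Z * n%:Z) * q ^ (- tri a) =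
    q ^ (a%:Z * a%:Z - a%:Z * n%:Z - tri a) * q ^ (- N%:Z * k.+1%:Z).
    by rewrite -!qzD; congr (q ^ _); ring.
  by apply: (lincomb (c := gb a n * gb (n + k.+1) a * (-1) ^+ a * fall 0 a * fall a (n + k.+1)) E); ring.
rewrite gb_sum_shift ?leq_addr // addKn; apply/eqP; rewrite mulf_eq0; apply/orP; right; apply/eqP.
set cst := _ * fall 0 _.
have := gb_pch_sum 0 k.+1; rewrite expr0n mulr0n => H.
(* Zero is written as a multiple of the vanishing sum [H], which is then read backwards and compared
   term by term. *)
transitivity ((-1) ^+ (n + k.+1) * q ^ (tri k - tri n) * cst * 0); last exact: mulr0.
rewrite -[X in _ = _ * X]H mulr_sumr [RHS]big_nat_rev /= add0n; apply: eq_big_nat => i /andP[_ lt_i].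
have [j Ej] : exists j, k.+1 = (i + j)%N by exists (k.+1 - i)%N; lia.
have -> : (k.+2 - i.+1 = j)%N by lia.
have -> : pch 0 j = 1 by rewrite /pch big1 // => ? _; rewrite mul0r subr0.
rewrite Ej -gb_sym.
have -> : (-1) ^+ (n + (i + j)) = (-1) ^+ (n + i) * (-1) ^+ j :> F by rewrite addnA exprD.
have S : (-1) ^+ j * (-1) ^+ j = 1 :> F by rewrite -exprD addnn -mul2n exprM sqrrN expr1n expr1n.
have E : q ^ ((n + i)%N%:Z * (n + i)%N%:Z - (n + i)%N%:Z * n%:Z - tri (n + i)) =
   q ^ (tri k - tri n) * q ^ (tri j - (i + j)%N%:Z * j%:Z).
  rewrite -qzD; congr (q ^ _); apply: (mulfI (_ : 2 != 0 :> int)) => //.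
  have := tri2 n; have := tri2 j; have := tri2 (n + i); have := tri2 k; rewrite !PoszD (_ : k%:Z = i%:Z + j%:Z - 1); last by lia.
  move=> E0 E1 E2 E3.
  rewrite !mulrDr !mulrN E0 E1 E2 E3; ring.
rewrite E; apply: (lincomb (c := - gb (i + j) i * (-1) ^+ (n + i) * q ^ (tri k - tri n) *
  q ^ (tri j - (i + j)%N%:Z * j%:Z) * cst) S); ring.
Qed.

Definition weight_vec p := iter p twist_vec final_coef.

Lemma chain_sum_concentrated V k j g x : g 0%N = x -> (forall c, (0 < c)%N -> g c = 0) -> (0 < N)%N -> chain_sum V k j g = x.
Proof.
move=> g0 gc N_gt0; elim: k j => [|k IH] j //=.
rewrite big_ltn // big_nat big1 ?addr0 => [|c /andP[c_gt0 _]]; last by rewrite gc ?mulr0.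
rewrite mulr0 oppr0 expr0z mul1r g0.
have -> : forall l i, chain_sum V l i (fun b => chain_coef b 0) = 1; last by rewrite mul1r.
elim=> [|l IHl] i /=; first exact: chain_coef0.
rewrite big_ltn // big_nat big1 ?addr0 => [|c /andP[c_gt0 _]]; last by rewrite /chain_coef gb_small // mul0r mulr0.
by rewrite IHl chain_coef0 mulr0 oppr0 expr0z !mulr1.
Qed.

Lemma nested_sum_periods p h : (d %| size h)%N -> (last 0%N h < N)%N ->
  nested_sum (fun h => final_coef (last 0%N h)) (d * p) h =
  q ^ (p%:Z * (N%:Z - 1)) * closed_form (weight_vec p) m (last 0%N h) (fun j => coupling j.+1 h).
Proof.
elim: p h => [|p IH] h dvd_h lt_h.
  rewrite muln0 mul0r expr0z mul1r /closed_form; symmetry.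
  apply: chain_sum_concentrated; rewrite ?esum_final_coef //; last by apply: leq_ltn_trans lt_h.
  by case=> // c _; rewrite esum_final_coef.
rewrite mulnS addnC nested_sumD.
set G := nested_sum _ (d * p) in IH *.
(* [nested_sum_period] expects a bare closed form, so the power of [q] from the other periods is
   divided out and put back. *)
have E : q ^ (p%:Z * (N%:Z - 1)) * q ^ (- (p%:Z * (N%:Z - 1))) = 1 by rewrite -qzD addrN.
transitivity (q ^ (p%:Z * (N%:Z - 1)) * nested_sum (fun h => q ^ (- (p%:Z * (N%:Z - 1))) * G h) d h).
  by rewrite nested_sum_scale mulrA E mul1r.
rewrite (@nested_sum_period _ (weight_vec p)) // => [|h' dvd_h' lt_h'].
  by rewrite mulrA -qzD; congr (q ^ _ * _); lia.
by rewrite IH // mulrA [_ * q ^ (_ * _)]mulrC E mul1r.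
Qed.

(** Expanding the clasps one at a time by [eta_row_clasp_mx] gives a chain sum with zero parameters,
    in agreement with [coupling_nil]. *)
Lemma eta_clasp_mx_chain k j (u : 'cV[F]_N) :
  (eta_row 0 *m iter k (mulmx clasp_mx) u) 0 0 = chain_sum (fun _ => 0) k j (fun c => (eta_row c *m u) 0 0).
Proof.
elim: k j u => [|k IH] j u //; rewrite iterSr (IH j.+1) /=.
under [RHS]eq_bigr => c _ do rewrite mul0r oppr0 expr0z mul1r mulrC chain_sum_scale.
rewrite chain_sum_sum; apply: eq_chain_sum => // b.
rewrite mulmxA eta_row_clasp_mx mulmx_suml summxE; apply: eq_bigr => c _.
by rewrite -scalemxAl mxE mulrC.
Qed.

Lemma twist_row_weight_vec p (a : 'I_N) : twist_row p 0 a = weight_vec p a.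
Proof.
elim: p a => [|p IH] a.
  by rewrite !mxE /eta pch0 gbn0 mul0r oppr0 expr0z !mul1r.
rewrite /= mxE /weight_vec /= -/(weight_vec p) /twist_vec big_mkord; apply: eq_bigr => b _.
by rewrite -/(twist_row p) IH mxE mulrC.
Qed.

Lemma nested_sum_matrix p : (0 < N)%N ->
  q ^ (p%:Z * (1 - N%:Z)) * nested_sum (fun h => final_coef (last 0%N h)) (d * p) [::] =
  (eta_row 0 *m iter m (mulmx clasp_mx) (twist_col p)) 0 0.
Proof.
move=> N_gt0; rewrite nested_sum_periods // mulrA -qzD (_ : _ + _ = 0); last by lia.
rewrite expr0z mul1r (eta_clasp_mx_chain _ 0) /closed_form; apply: eq_chain_sum => [i _|c]; first exact: coupling_nil.
rewrite eta_row_twist_col mxE /esum big_mkord; apply: eq_bigr => a _.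
by rewrite twist_row_weight_vec mxE mulrC.
Qed.

End Period.

(** * Sums over the powers of E and F in a braiding *)

Lemma sum_offset_prod a b (f : nat -> F) : \prod_(a <= i < b) f i = \prod_(0 <= i < b - a) f (i + a)%N.
Proof. by rewrite -{1}[a]add0n big_addn. Qed.

Lemma fall_pch y k : (k <= y)%N -> fall (y - k) y = pch (q ^ (N%:Z - y%:Z)) k.
Proof.
move=> le_ky; rewrite /fall big_nat_rev sum_offset_prod /pch.
have -> : (y - (y - k) = k)%N by lia.
apply: eq_big_nat => i /andP[_ lt_ik]; rewrite exprnP -qzD; congr (1 - q ^ _); lia.
Qed.

Lemma qzX (z : int) k : (q ^ z) ^+ k = q ^ (z * k%:Z).
Proof. by rewrite exprnP exprz_exp. Qed.

(** The $q$-difference operator by which powers of E act on the coordinates of a state killed by E;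
    see [highest_exp0] and [highest_exp2] for the two values of [kappa]. *)
Fixpoint qdiff (kappa : F) (f : nat -> F) (k b : nat) : F :=
  if k is k'.+1 then kappa * q ^+ b * (qdiff kappa f k' b - qdiff kappa f k' b.+1) else f b.

Definition qdsum (f : nat -> F) (k b : nat) : F :=
  \sum_(0 <= j < k.+1) gb k j * ((-1) ^+ j * q ^ (tri j - j%:Z) * f (b + j)%N).

Lemma qdiffE kappa f k b : qdiff kappa f k b = kappa ^+ k * q ^+ (k * b) * qdsum f k b.
Proof.
elim: k b => [|k IH] b /=.
  by rewrite /qdsum big_nat1 gbn0 tri0 subrr expr0z addn0 !mul1r.
have -> : qdsum f k.+1 b = qdsum f k b - q ^+ k * qdsum f k b.+1.
  rewrite /qdsum gb_sum_rec' mulr_sumr -sumrB; apply: eq_big_nat => j /andP[_ lt_jk].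
  have E : q ^+ (k - j) * q ^ (tri j.+1 - j.+1%:Z) = q ^+ k * q ^ (tri j - j%:Z).
    by rewrite !exprnP -!qzD; congr (q ^ _); rewrite triS; lia.
  rewrite addSnnS exprS.
  by apply: (lincomb (c := - gb k j * (-1) ^+ j * f (b + j.+1)%N) E); ring.
rewrite !IH mulSn mulnS !exprD exprS; ring.
Qed.

Lemma qdsum_rev f k x : (k <= x)%N ->
  qdsum f k (x - k) = \sum_(0 <= i < k.+1) gb k i * ((-1) ^+ (k - i) * q ^ (tri (k - i) - (k - i)%N%:Z) * f (x - i)%N).
Proof.
move=> le_kx; rewrite /qdsum big_nat_rev add0n; apply: eq_big_nat => i /andP[_ lt_ik].
rewrite subSS; have -> : gb k (k - i) = gb k i.
  by have -> : k = (i + (k - i))%N by [lia]; rewrite addKn -gb_sym.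
by have -> : (x - k + (k - i) = x - i)%N by lia.
Qed.

(** The parallel case. After exchanging the sums, the inner one is the left side of [gb_pch_sym]
    with $a=q^{N-y}$ and $w=a^{-1}$, hence a single power of [q]. *)
Lemma braid_sum f x : (x < N)%N ->
  \sum_(0 <= k < x.+1) (-1) ^+ k * q ^ (tri k - k%:Z - k%:Z * (N%:Z - 1) + k%:Z * (x%:Z - k%:Z)) *
     gb x k * fall (x - k) x * qdsum f k (x - k) =
  \sum_(0 <= y < x.+1) gb x y * ((-1) ^+ (x - y) * fall y x *
     q ^ (tri (x - y) - (x - y)%N%:Z - (x - y)%N%:Z * (N%:Z - 1) + (x - y)%N%:Z * y%:Z - y%:Z * (N%:Z - y%:Z)) * f y).
Proof.
move=> lt_xN.
transitivity (\sum_(0 <= k < x.+1) \sum_(0 <= i < x.+1) gb k i * gb x k *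
  ((-1) ^+ k * q ^ (tri k - k%:Z - k%:Z * (N%:Z - 1) + k%:Z * (x%:Z - k%:Z)) * fall (x - k) x *
   ((-1) ^+ (k - i) * q ^ (tri (k - i) - (k - i)%N%:Z) * f (x - i)%N))).
  apply: eq_big_nat => k /andP[_ lt_kx]; rewrite qdsum_rev // mulr_sumr.
  rewrite [RHS](big_cat_nat (n := k.+1)) //= [X in _ = _ + X]big_nat [X in _ = _ + X]big1 ?addr0.
    by apply: eq_bigr => i _; ring.
  by move=> i /andP[lt_ki _]; rewrite gb_small // !mul0r.
rewrite exchange_big_nat /= [RHS]big_nat_rev add0n; apply: eq_big_nat => i /andP[_ lt_ix].
rewrite gb_sum_shift // subSS.
have -> : gb x (x - i) = gb x i.
  by have -> : x = (i + (x - i))%N by [lia]; rewrite addKn -gb_sym.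
congr (_ * _); have -> : (x - (x - i) = i)%N by lia.
have [y Ey] : exists y, x = (i + y)%N by exists (x - i)%N; lia.
have -> : (x - i = y)%N by lia.
have H := gb_pch_sym (q ^ (N%:Z - y%:Z)) (q ^ (- (N%:Z - y%:Z))) y.
rewrite -qzD addrN expr0z in H.
have H1 : \sum_(0 <= k < y.+1) gb y k * (pch 1 k * (q ^ (- (N%:Z - y%:Z))) ^+ (y - k)) = q ^ (- (y%:Z * (N%:Z - y%:Z))).
  rewrite big_nat_recl // big_nat big1 ?addr0 => [|k _]; last first.
    by rewrite /pch big_nat_recl // expr0 mulr1 subrr mul0r mul0r mulr0.
  rewrite gbn0 pch0 !mul1r subn0 qzX; congr (q ^ _); ring.
rewrite H1 {H1} in H.
rewrite qzD -H mulrA mulr_sumr mulr_suml; apply: eq_big_nat => k /andP[_ lt_ky].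
have -> : fall (x - (i + k)) x = pch (q ^ (N%:Z - y%:Z)) k * fall y x.
  rewrite -(@fall_cat _ y x); try lia.
  by rewrite (_ : x - (i + k) = y - k)%N ?fall_pch //; lia.
rewrite addKn.
have E : q ^ (tri (i + k) - (i + k)%N%:Z - (i + k)%N%:Z * (N%:Z - 1) + (i + k)%N%:Z * (x%:Z - (i + k)%N%:Z)) *
   q ^ (tri k - k%:Z) =
   q ^ (tri i - i%:Z - i%:Z * (N%:Z - 1) + i%:Z * y%:Z) * (q ^ (- (N%:Z - y%:Z))) ^+ k.
  rewrite qzX -!qzD; congr (q ^ _); rewrite triD Ey !PoszD.
  by have := tri2 k; lia.
have S : (-1) ^+ k * (-1) ^+ k = 1 :> F by rewrite -exprD addnn -mul2n exprM sqrrN expr1n expr1n.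
have S' : (-1) ^+ (i + k) = (-1) ^+ i * (-1) ^+ k :> F by rewrite exprD.
rewrite S'.
transitivity (gb y k * (-1) ^+ i * fall y x * pch (q ^ (N%:Z - y%:Z)) k * f y * ((-1) ^+ k * (-1) ^+ k) *
  (q ^ (tri (i + k) - (i + k)%N%:Z - (i + k)%N%:Z * (N%:Z - 1) + (i + k)%N%:Z * (x%:Z - (i + k)%N%:Z)) *
   q ^ (tri k - k%:Z))); first by ring.
by rewrite E S; ring.
Qed.

Lemma pchD a m n : pch a (m + n) = pch a m * pch (a * q ^+ m) n.
Proof.
elim: n => [|n IH]; first by rewrite addn0 pch0 mulr1.
by rewrite addnS !pchS IH exprD -!mulrA.
Qed.

(** Supplies a Gaussian binomial whose upper index [N.-1 - x] does not depend on the summation index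
    [n], as [gb_sum_shift] requires. *)
Lemma fall_gb x n : (x < N)%N -> fall x (x + n) * pch q x * gb (x + n) n = gb (N.-1 - x) n * pch q (x + n).
Proof.
move=> lt_xN; have [le_N|lt_N] := leqP N (x + n).
  by rewrite fall_zero // (@gb_small (N.-1 - x)) ?mul0r //; lia.
have [e Me] : exists e, (N.-1 - x = n + e)%N by exists (N.-1 - x - n)%N; lia.
have -> : fall x (x + n) = pch (q ^+ e.+1) n.
  have := @fall_pch (x + n) n; rewrite addnK => ->; last exact: leq_addl.
  by rewrite exprnP; congr (pch (q ^ _) n); lia.
have -> : gb (x + n) n = pch q (x + n) / (pch q x * pch q n) by rewrite addnC gbE.
have Hp : pch q (n + e) = pch q e * pch (q ^+ e.+1) n by rewrite addnC pchD -exprS.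
rewrite Me gbE Hp.
have := qf_neq0 x; have := qf_neq0 n; have := qf_neq0 e.
move: (pch q x) (pch q n) (pch q e) (pch q (x + n)) (pch (q ^+ e.+1) n) => a b c g h a0 b0 c0; field.
by do ?[apply/andP; split].
Qed.

(** The antiparallel case: the inner sum is [gb_pch_sum] with $a=q^{x+j+1}$. *)
Lemma unbraid_sum f x : (x < N)%N ->
  \sum_(0 <= n < N) (-1) ^+ n * q ^ (tri n + n%:Z * (x%:Z - N%:Z + 1)) *
     gb (x + n) n * fall x (x + n) * qdsum f n x =
  \sum_(x <= y < N) gb y x * (fall x y * q ^ ((y - x)%N%:Z * (y - x)%N%:Z + (y - x)%N%:Z * (x%:Z - N%:Z + 1) +
       (y%:Z + 1) * (N%:Z - 1 - y%:Z))) * f y.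
Proof.
move=> lt_xN; set M := (N.-1 - x)%N.
have gp n : fall x (x + n) * gb (x + n) n = gb M n * pch (q ^+ x.+1) n.
  apply: (mulIf (qf_neq0 x)).
  have := fall_gb n lt_xN; rewrite -/M pchD -exprS => H.
  by transitivity (fall x (x + n) * pch q x * gb (x + n) n); [ring | rewrite H; ring].
transitivity (\sum_(0 <= n < N) \sum_(0 <= j < N) gb n j * gb M n *
  ((-1) ^+ n * q ^ (tri n + n%:Z * (x%:Z - N%:Z + 1)) * pch (q ^+ x.+1) n *
   ((-1) ^+ j * q ^ (tri j - j%:Z) * f (x + j)%N))).
  apply: eq_big_nat => n /andP[_ lt_nN]; rewrite -[X in X * _]mulrA [X in _ * X * _]mulrC gp /qdsum mulr_sumr.
  rewrite [RHS](big_cat_nat (n := n.+1)) //= [X in _ = _ + X]big_nat [X in _ = _ + X]big1 ?addr0.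
    by apply: eq_bigr => i _; ring.
  by move=> i /andP[lt_ki _]; rewrite gb_small // !mul0r.
rewrite exchange_big_nat /= [RHS]sum_offset [LHS](big_cat_nat (n := (N - x)%N)) ?leq_subr //=.
rewrite [X in _ + X = _]big_nat [X in _ + X = _]big1 ?addr0; last first.
  move=> j /andP[le_j _]; rewrite big1 // => n _; have [lt_nj|le_jn] := ltnP n j.
    by rewrite gb_small // !mul0r.
  by rewrite (@gb_small M) ?mulr0 ?mul0r // /M; lia.
apply: eq_big_nat => j /andP[_ lt_j]; rewrite gb_sum_shift; try (rewrite /M; lia).
rewrite addnK (addnC j x).
have -> : gb (x + j) x = gb (x + j) j by rewrite gb_sym.
have H := gp j.
have C := gb_pch_sum (q ^+ (x + j).+1) (M - j).
rewrite -mulrA [fall x _ * _]mulrC.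
transitivity (gb M j * pch (q ^+ x.+1) j * (q ^+ (x + j).+1) ^+ (M - j) *
   q ^ (j%:Z * j%:Z + j%:Z * (x%:Z - N%:Z + 1)) * f (x + j)%N); last first.
  rewrite -H; set e1 := q ^ _; set e2 := q ^ _.
  have -> : e2 = e1 * (q ^+ (x + j).+1) ^+ (M - j); last by ring.
  rewrite [q ^+ (x + j).+1]exprnP qzX -qzD; congr (q ^ (_ + _)).
  have -> : (M - j)%N%:Z = N%:Z - 1 - (x + j)%N%:Z by rewrite /M; lia.
  by rewrite -[(x + j).+1]addn1 PoszD.
rewrite -C -!mulrA; congr (_ * _); rewrite mulr_suml mulr_sumr; apply: eq_big_nat => k /andP[_ lt_k].
rewrite pchD -exprD.
have -> : (x.+1 + j = (x + j).+1)%N by lia.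
have E : q ^ (tri (j + k) + (j + k)%N%:Z * (x%:Z - N%:Z + 1)) * q ^ (tri j - j%:Z) =
  q ^ (tri k - (M - j)%N%:Z * k%:Z) * q ^ (j%:Z * j%:Z + j%:Z * (x%:Z - N%:Z + 1)).
  rewrite -!qzD; congr (q ^ _); rewrite triD !PoszD.
  have -> : (M - j)%N%:Z = N%:Z - 1 - x%:Z - j%:Z by rewrite /M; lia.
  by have := tri2 j; lia.
have S : (-1) ^+ j * (-1) ^+ j = 1 :> F by rewrite -exprD addnn -mul2n exprM sqrrN expr1n expr1n.
have -> : (-1) ^+ (j + k) = (-1) ^+ j * (-1) ^+ k :> F by rewrite exprD.
transitivity (gb (M - j) k * pch (q ^+ x.+1) j * pch (q ^+ (x + j).+1) k * (-1) ^+ k * f (x + j)%N *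
  ((-1) ^+ j * (-1) ^+ j) * (q ^ (tri (j + k) + (j + k)%N%:Z * (x%:Z - N%:Z + 1)) * q ^ (tri j - j%:Z))).
  by ring.
by rewrite S E; ring.
Qed.

(** * From nested sums to sums over tuples *)

Section Chains.
Variable m : nat.
Local Notation term_wt := (term_wt m).
Local Notation nested_sum := (nested_sum m).
Local Notation next_exponent := (next_exponent m).
Local Notation d := (2 * m + 1)%N.

Definition word_wt (h l : seq nat) : F :=
  \prod_(0 <= i < size l) term_wt (h ++ take i l) (nth 0%N l i).

Lemma word_wt_cons h a l : word_wt h (a :: l) = term_wt h a * word_wt (rcons h a) l.
Proof.
rewrite /word_wt big_nat_recl // take0 cats0; congr (_ * _).
by apply: eq_bigr => i _; rewrite /= cat_rcons.
Qed.

Lemma nested_sum_tuples f k h :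
  nested_sum f k h = \sum_(n : k.-tuple 'I_N) word_wt h (map val n) * f (h ++ map val n).
Proof.
elim: k h => [|k IH] h.
  rewrite (bigD1 [tuple]) //= big1 ?addr0 => [|n ne_n]; last first.
    by case/eqP: ne_n; rewrite tuple0.
  by rewrite /word_wt big_geq // mul1r cats0.
rewrite /= big_tuple_cons big_mkord; apply: eq_bigr => a _.
rewrite IH mulr_sumr; apply: eq_bigr => n _.
by rewrite /= word_wt_cons mulrA cat_rcons.
Qed.

Lemma word_wt_unsorted h l : ~~ path leq (last 0%N h) l -> word_wt h l = 0.
Proof.
elim: l h => [|a l IH] h //=; rewrite negb_and word_wt_cons => /orP[lt_a|nl].
  by rewrite /term_wt gb_small ?(mul0r, mulr0) // ltnNge.
by rewrite IH ?mulr0 // last_rcons.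
Qed.

Lemma prod_qz I (r : seq I) (P : pred I) (e : I -> int) :
  \prod_(i <- r | P i) q ^ e i = q ^ (\sum_(i <- r | P i) e i).
Proof.
apply/esym; apply: (big_morph (fun z => q ^ z)); last exact: expr0z.
by move=> x y; rewrite expfzDr.
Qed.

Lemma word_wtE l : (size l %% d = 0)%N ->
  word_wt [::] l =
  (\prod_(1 <= i < (size l).+1) \prod_(i.+1 <= j < (size l).+1 | ~~ (d %| i)%N && (j != m + 1 %[mod d])%N)
     q ^ (Delta i j m * (nth 0%N l i.-1)%:Z * (nth 0%N l j.-1)%:Z)) *
  (\prod_(1 <= i < (size l).+1 | (i == m + 1 %[mod d])%N) sgn_wt (nth 0%N l i.-1)) *
  (\prod_(1 <= i < (size l).+1 | (i == 2 * m + 1 %[mod d])%N) sgn_wt (nth 0%N l i.-1)) *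
  (\prod_(1 <= i < size l) (q ^ (beta i m * (nth 0%N l i.-1)%:Z) * gb (nth 0%N l i) (nth 0%N l i.-1))).
Proof.
set M := size l => Md.
have lastE i : (i < M)%N -> last 0%N (take i l) = nth 0%N (0%N :: l) i.
  move=> lt_i; rewrite (last_nth 0%N) size_take lt_i.
  by case: i lt_i => // i lt_i /=; rewrite nth_take.
have szE i : (i < M)%N -> size (take i l) = i by move=> lt_i; rewrite size_take lt_i.
transitivity ((\prod_(0 <= i < M) q ^ ((nth 0%N l i)%:Z * next_exponent (take i l))) *
  (\prod_(0 <= i < M) (if (i.+1 == m + 1 %[mod d])%N then sgn_wt (nth 0%N l i) else 1)) *
  (\prod_(0 <= i < M) (if (i.+1 == 2 * m + 1 %[mod d])%N then sgn_wt (nth 0%N l i) else 1)) *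
  ((\prod_(0 <= i < M) gb (nth 0%N l i) (nth 0%N (0%N :: l) i)) *
   (\prod_(0 <= i < M) q ^ (beta i.+1 m * (nth 0%N l i)%:Z)))).
  rewrite -!big_split /=; apply: eq_big_nat => i /andP[_ lt_i].
  by rewrite /term_wt szE // lastE //; ring.
congr (_ * _ * _ * _).
- transitivity (\prod_(1 <= j < M.+1) \prod_(1 <= i < M.+1)
     (if [&& (i < j)%N, ~~ (d %| i)%N & (j != m + 1 %[mod d])%N] then
        q ^ (Delta i j m * (nth 0%N l i.-1)%:Z * (nth 0%N l j.-1)%:Z) else 1)).
    rewrite big_add1 /=; apply: eq_big_nat => j /andP[_ lt_j].
    rewrite big_add1 /= (big_cat_nat (n := j)) //=; last exact: ltnW.
    rewrite [X in _ = _ * X]big_nat [X in _ = _ * X]big1 ?mulr1; last first.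
      by move=> i /andP[le_ji _]; rewrite ltnS ltnNge le_ji.
    rewrite /next_exponent szE //; case: ifP => Hj.
      by rewrite mulr0 expr0z big1 // => i _; rewrite !andbF.
    rewrite mulr_sumr -prod_qz big_mkcond /=; apply: eq_big_nat => i /andP[_ lt_i].
    rewrite ltnS lt_i andbT /=; case: ifP => // _.
    by rewrite nth_take //; congr (q ^ _); ring.
  rewrite exchange_big_nat /=; apply: eq_big_nat => i /andP[i_gt0 lt_i].
  rewrite [RHS](big_nat_widenl _ 1) //=.
  rewrite [RHS]big_mkcond /=; apply: eq_bigr => j _.
  by rewrite [(_ && (i < j)%N)]andbC.
- by rewrite [RHS]big_add1 /= [RHS]big_mkcond.
- by rewrite [RHS]big_add1 /= [RHS]big_mkcond.
case EM : M Md => [|M'] Md; first by rewrite !big_geq // mulr1.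
(* The product with $\beta$ stops before the last index; nothing is lost, since [d] divides the
   length and so the last $\beta$ is zero. *)
have B : beta M'.+1 m = 0 by rewrite /beta Md /= addn1.
rewrite big_ltn // gbn0 mul1r [X in _ * X]big_nat_recr //= B mul0r expr0z mulr1.
rewrite mulrC big_split /= [X in _ = X * _]big_add1 /=; congr (_ * _).
by apply: eq_big_nat => i /andP[i_gt0 _]; case: i i_gt0.
Qed.

End Chains.
End QSeries.

Arguments gb : simpl never.

(** * The R-matrix *)

Lemma t_neq0 : t != 0.
Proof. by rewrite /t tofrac_eq0 polyX_eq0. Qed.

Lemma tX_neq1 k : t ^+ k.+1 != 1.
Proof.
rewrite /t -rmorphXn -(rmorph1 (@tofrac _)) tofrac_eq; apply/eqP => /(congr1 (fun p : {poly rat} => size p)).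
by rewrite size_polyXn size_poly1.
Qed.

Lemma q_neq0 : q != 0. Proof. exact: expf_neq0 t_neq0. Qed.

Lemma qX_neq1 k : q ^+ k.+1 != 1.
Proof. by rewrite /q -exprM mulnS addSn tX_neq1. Qed.

Lemma tzD (x y : int) : t ^ (x + y) = t ^ x * t ^ y.
Proof. by rewrite expfzDr ?t_neq0. Qed.

Lemma tzX (z : int) k : (t ^ z) ^+ k = t ^ (z * k%:Z).
Proof. by rewrite exprnP exprz_exp. Qed.

Lemma tzN (z : int) : t ^ (- z) = (t ^ z)^-1.
Proof. by rewrite invr_expz. Qed.

Lemma qzE4 (z : int) : q ^ z = t ^ (4 * z).
Proof. by rewrite /q [t ^+ 4]exprnP exprz_exp. Qed.

Lemma tz_neq0 (z : int) : t ^ z != 0. Proof. exact: expfz_neq0 t_neq0. Qed.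

Definition vdiff : Qt := t ^+ 2 - t ^- 2.

Lemma vdiffE : vdiff = t ^ 2 - t ^ (- 2).
Proof. by rewrite tzN. Qed.

Lemma mul_sub_tz (u w : int) : (t ^ u - t ^ (- u)) * (t ^ w - t ^ (- w)) =
  t ^ (u + w) + t ^ (- (u + w)) - t ^ (u - w) - t ^ (- (u - w)).
Proof. by rewrite opprD opprB !tzD; ring. Qed.

Lemma quantum_intE k : quantum_int k = (t ^ (2 * k%:Z) - t ^ (- (2 * k%:Z))) / vdiff.
Proof. by rewrite /quantum_int -mul2n tzN. Qed.

Lemma sub_tz_neq0 k : t ^ (2 * k.+1%:Z) - t ^ (- (2 * k.+1%:Z)) != 0.
Proof.
have -> : t ^ (2 * k.+1%:Z) - t ^ (- (2 * k.+1%:Z)) = t ^ (- (2 * k.+1%:Z)) * (q ^+ k.+1 - 1).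
  rewrite mulrBr mulr1 [q ^+ _]exprnP qzE4 -tzD; congr (t ^ _ - _); lia.
by rewrite mulf_neq0 ?tz_neq0 // subr_eq0 qX_neq1.
Qed.

Lemma vdiff_neq0 : vdiff != 0.
Proof. by have := sub_tz_neq0 0; rewrite mulr1 tzN. Qed.

Lemma quantum_int0 : quantum_int 0 = 0.
Proof. by rewrite quantum_intE mulr0 oppr0 subrr mul0r. Qed.

Lemma quantum_int_neq0 k : quantum_int k.+1 != 0.
Proof.
rewrite quantum_intE; apply: mulf_neq0; first exact: sub_tz_neq0.
by apply: invr_neq0; exact: vdiff_neq0.
Qed.

Lemma quantum_factS k : quantum_fact k.+1 = quantum_fact k * quantum_int k.+1.
Proof. by rewrite /quantum_fact big_nat_recr. Qed.

Lemma quantum_fact0 : quantum_fact 0 = 1.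
Proof. by rewrite /quantum_fact big_geq. Qed.

Lemma quantum_fact_neq0 k : quantum_fact k != 0.
Proof.
elim: k => [|k IH]; first by rewrite quantum_fact0 oner_eq0.
by rewrite quantum_factS mulf_neq0 ?quantum_int_neq0.
Qed.

Lemma quantum_int_low k :
  quantum_int k.+1 * t ^ (- (2 * k%:Z) - 4) + 1 = quantum_int k.+2 * t ^ (- (2 * k.+1%:Z)).
Proof.
apply: (mulIf vdiff_neq0); rewrite mulrDl mul1r 2!quantum_intE mulrAC divfK ?vdiff_neq0 //.
rewrite [in RHS]mulrAC divfK ?vdiff_neq0 // 2!mulrBl -4!tzD vdiffE.
have -> : 2 * k.+1%:Z + (- (2 * k%:Z) - 4) = - 2 by lia.
have -> : 2 * k.+2%:Z - 2 * k.+1%:Z = 2 by lia.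
have -> : - (2 * k.+1%:Z) + (- (2 * k%:Z) - 4) = - (2 * k.+2%:Z) - 2 * k.+1%:Z by lia.
by ring.
Qed.

Lemma quantum_int_high k :
  quantum_int k.+1 * t ^ (2 * k%:Z + 4) + 1 = quantum_int k.+2 * t ^ (2 * k.+1%:Z).
Proof.
apply: (mulIf vdiff_neq0); rewrite mulrDl mul1r 2!quantum_intE mulrAC divfK ?vdiff_neq0 //.
rewrite [in RHS]mulrAC divfK ?vdiff_neq0 // 2!mulrBl -4!tzD vdiffE.
have -> : - (2 * k.+1%:Z) + (2 * k%:Z + 4) = 2 by lia.
have -> : - (2 * k.+2%:Z) + 2 * k.+1%:Z = - 2 by lia.
have -> : 2 * k.+1%:Z + (2 * k%:Z + 4) = 2 * k.+2%:Z + 2 * k.+1%:Z by lia.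
by ring.
Qed.

Definition sgb (s : bool) : int := if s then 1 else -1.

Definition theta_coef (s : bool) (k : nat) : Qt :=
  if s then t ^+ (k * k.-1) * (t ^+ 2 - t ^- 2) ^+ k / quantum_fact k
  else (-1) ^+ k * t ^- (k * k.-1) * (t ^+ 2 - t ^- 2) ^+ k / quantum_fact k.

Lemma frac_cancel (F : fieldType) (a b c x y : F) : b != 0 -> c != 0 -> x * (c * y) / (a * b) * (b / c) = x * y / a.
Proof.
by move=> b0 c0; rewrite invfM; transitivity (x * y / a * (b / b) * (c / c)); [ring | rewrite !divff ?mulr1].
Qed.

(** The recursion of the coefficients that makes the sum in [Theta_comm] telescope. *)
Lemma theta_coef_rec s k : theta_coef s k.+1 * (quantum_int k.+1 / vdiff) = (sgb s)%:~R * t ^ (sgb s * (2 * k%:Z)) * theta_coef s k.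
Proof.
rewrite /theta_coef -/vdiff quantum_factS exprS.
have E : t ^ (2 * k%:Z) * t ^+ (k * k.-1) = t ^+ (k.+1 * k).
  by rewrite !exprnP -tzD; congr (t ^ _); case: k => //= k; lia.
have E' : t ^ (- (2 * k%:Z)) * t ^- (k * k.-1) = t ^- (k.+1 * k).
  by rewrite -E invfM tzN.
have q1 := quantum_fact_neq0 k; have q2 := quantum_int_neq0 k; have q3 := vdiff_neq0.
case: s; rewrite /sgb [k.+1.-1]/=.
  by rewrite frac_cancel // mul1r -E !mulrA.
by rewrite frac_cancel // -E' exprS !mulN1r !mulNr !mulrA [t ^ _ * _]mulrC.
Qed.

(** * The modules V and V* and the intertwining property of the braiding *)

Section Representation.
Import Order.TTheory Num.Theory.
Variable n : nat.
Local Notation N := n.+1.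
Local Notation state := ('I_N -> 'I_N -> 'I_N -> Qt).
Local Notation gb := (gb q).
Local Notation pch := (pch q).
Local Notation fall := (fall q N).
Local Notation qdsum := (qdsum q).
Local Notation qdiff := (qdiff q).
Local Notation twist_coef := (twist_coef q N).
Local Notation final_coef := (final_coef q N).
Local Notation twist_mx := (twist_mx q N).
Local Notation clasp_mx := (clasp_mx q N).
Local Notation twist_col := (twist_col q N).
Local Notation eta_row := (eta_row q N).

Definition Kmx (up : bool) (z : int) : 'M[Qt]_N :=
  \matrix_(a, b) (if a == b then t ^ (2 * z * weight up a) else 0).

Lemma mul_Kmx up z m (A : 'M[Qt]_(m, N)) a b : (A *m Kmx up z) a b = A a b * t ^ (2 * z * weight up b).
Proof.
rewrite mxE (bigD1 b) //= big1 ?addr0 ?mxE ?eqxx // => c ne_cb.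
by rewrite mxE (negPf ne_cb) mulr0.
Qed.

Lemma Kmx_mul up z m (A : 'M[Qt]_(N, m)) a b : (Kmx up z *m A) a b = t ^ (2 * z * weight up a) * A a b.
Proof.
rewrite mxE (bigD1 a) //= big1 ?addr0 ?mxE ?eqxx // => c ne_cb.
by rewrite mxE eq_sym (negPf ne_cb) mul0r.
Qed.

Lemma Kmx_tr up z : (Kmx up z)^T = Kmx up z.
Proof. by apply/matrixP => a b; rewrite !mxE eq_sym; case: eqP => [->|]. Qed.

Lemma KmxK up x y : Kmx up x *m Kmx up y = Kmx up (x + y).
Proof.
apply/matrixP => a b; rewrite mul_Kmx !mxE; case: eqP => [->|_]; last by rewrite mul0r.
by rewrite -tzD; congr (t ^ _); ring.
Qed.

Lemma Kmx0 up : Kmx up 0 = 1%:M.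
Proof. by apply/matrixP => a b; rewrite !mxE mulr0 mul0r expr0z; case: eqP. Qed.

Lemma matKE z : matK N z = Kmx true z. Proof. by []. Qed.

Lemma sum_matE (a : 'I_N) (X : 'I_N -> Qt) :
  \sum_c matE N a c * X c = quantum_int (N - a.+1) * X (inord a.+1).
Proof.
have [lt_a|le_a] := ltnP a.+1 N.
  rewrite (bigD1 (inord a.+1)) //= big1 ?addr0 => [|c ne_c].
    by rewrite mxE inordK // eqxx.
  rewrite mxE; case: eqP => [E|_]; last exact: mul0r.
  by case/eqP: ne_c; rewrite -E inord_val.
rewrite (_ : N - a.+1 = 0)%N; last by lia.
rewrite quantum_int0 mul0r big1 // => c _; rewrite mxE; case: eqP => [E|_]; last exact: mul0r.
by have := ltn_ord c; rewrite E ltnNge le_a.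
Qed.

Lemma sum_matF (a : 'I_N) (X : 'I_N -> Qt) :
  \sum_c matF N a c * X c = quantum_int a * X (inord a.-1).
Proof.
case: a => [[|a] lt_a] /=.
  by rewrite quantum_int0 mul0r big1 // => c _; rewrite mxE mul0r.
have E : (inord a : 'I_N) = a :> nat by rewrite inordK // ltnW.
rewrite (bigD1 (inord a)) //= big1 ?addr0 => [|c ne_c].
  by rewrite mxE /= E eqxx.
rewrite mxE; case: eqP => [[E']|_]; last exact: mul0r.
by case/eqP: ne_c; apply: val_inj; rewrite /= E.
Qed.

Lemma actE_false a b : actE N false a b = - (matE N b a * t ^ (- (2 * weight true a))).
Proof. by rewrite /actE matKE mxE mxE mul_Kmx mulrN1 mulNr. Qed.

Lemma actF_false a b : actF N false a b = - (t ^ (2 * weight true b) * matF N b a).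
Proof. by rewrite /actF matKE mxE mxE Kmx_mul mulr1. Qed.

Lemma actE_supp up a b : actE N up a b != 0 -> weight up a = weight up b + 2.
Proof.
case: up; rewrite /weight.
  by rewrite /actE mxE; case: (nat_of_ord b =P a.+1) => [->|_]; rewrite ?eqxx //; lia.
rewrite actE_false mxE; case: (nat_of_ord a =P b.+1) => [->|_]; last by rewrite mul0r oppr0 eqxx.
by move=> _; lia.
Qed.

Lemma actF_supp up a b : actF N up a b != 0 -> weight up a = weight up b - 2.
Proof.
case: up; rewrite /weight.
  by rewrite /actF mxE; case: (nat_of_ord a =P b.+1) => [->|_]; rewrite ?eqxx //; lia.
rewrite actF_false mxE; case: (nat_of_ord b =P a.+1) => [->|_]; last by rewrite mulr0 oppr0 eqxx.
by move=> _; lia.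
Qed.

Lemma exp_supp up (A : 'M[Qt]_N) (s : int) k a b :
  (forall a b, A a b != 0 -> weight up a = weight up b + s) ->
  (A ^+ k) a b != 0 -> weight up a = weight up b + s * k%:Z.
Proof.
move=> HA; elim: k a => [|k IH] a.
  by rewrite expr0 !mxE mulr0 addr0; case: (a =P b) => [->|_] //; rewrite eqxx.
rewrite exprS mxE => H; have [c] : exists c, A a c * (A ^+ k) c b != 0.
  apply/existsP; apply: contraNT H; rewrite negb_exists => /forallP H.
  by rewrite big1 // => c _; apply/eqP; rewrite -[_ == _]negbK.
rewrite mulf_eq0 negb_or => /andP[/HA -> /IH ->]; lia.
Qed.

Lemma supp_Kmx up (A : 'M[Qt]_N) (s : int) k z :
  (forall a b, A a b != 0 -> weight up a = weight up b + s) ->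
  Kmx up z *m A ^+ k = t ^ (2 * z * s * k%:Z) *: (A ^+ k *m Kmx up z).
Proof.
move=> HA; apply/matrixP => a b; rewrite Kmx_mul mxE mul_Kmx.
have [->|/(exp_supp HA) ->] := eqVneq ((A ^+ k) a b) 0; first by rewrite !mulr0 mul0r mulr0.
rewrite mulrCA -tzD mulrC; congr (_ * t ^ _); ring.
Qed.

Lemma actE_nil up : actE N up ^+ N = 0.
Proof.
apply/matrixP => a b; rewrite mxE; apply/eqP; apply: contraT => /(exp_supp (@actE_supp up)).
by have := ltn_ord a; have := ltn_ord b; case: up; rewrite /weight; lia.
Qed.

Lemma comm_EF_true : actE N true *m actF N true - actF N true *m actE N true =
  vdiff^-1 *: (Kmx true 1 - Kmx true (-1)).
Proof.
rewrite /actE /actF; apply/matrixP => a b; rewrite mxE [X in X + _]mxE sum_matE [X in _ + X]mxE [X in _ - X]mxE sum_matF !mxE.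
have [<-{b}|ne_ab] := eqVneq a b; last first.
  rewrite subr0 mulr0.
  have -> : quantum_int (N - a.+1) * (if (inord a.+1 : 'I_N) == b.+1 :> nat then quantum_int (inord a.+1 : 'I_N) else 0) = 0.
    case: (leqP N a.+1) => [le_a|lt_a].
      have -> : (N - a.+1 = 0)%N by lia.
      by rewrite quantum_int0 mul0r.
    rewrite inordK // ifN ?mulr0 //; apply: contra ne_ab => /eqP [] E; exact/eqP/val_inj.
  rewrite sub0r; apply/eqP; rewrite oppr_eq0; apply/eqP.
  case: a ne_ab => [[|a] lt_a] ne_ab /=; first by rewrite quantum_int0 mul0r.
  rewrite inordK; last exact: ltnW.
  by rewrite ifN ?mulr0 //; apply: contra ne_ab => /eqP E; apply/eqP/val_inj.
have -> : quantum_int (N - a.+1) * (if (inord a.+1 : 'I_N) == a.+1 :> nat then quantum_int (inord a.+1 : 'I_N) else 0) =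
    quantum_int (N - a.+1) * quantum_int a.+1.
  have [lt_a|le_a] := ltnP a.+1 N; first by rewrite inordK // eqxx.
  have -> : (N - a.+1 = 0)%N by lia.
  by rewrite quantum_int0 !mul0r.
have -> : quantum_int a * (if a == (inord a.-1 : 'I_N).+1 :> nat then quantum_int (N - a) else 0) =
    quantum_int a * quantum_int (N - a).
  case: a => [[|a] lt_a] /=; first by rewrite quantum_int0 !mul0r.
  by rewrite inordK ?eqxx // ltnW.
rewrite !quantum_intE mulr1 mulrN1 mulNr /weight.
have lt_a := ltn_ord a.
have -> : 2 * (N - a.+1)%N%:Z = 2 * N%:Z - 2 * a%:Z - 2 by lia.
have -> : 2 * (N - a)%N%:Z = 2 * N%:Z - 2 * a%:Z by lia.
have -> : 2 * a.+1%:Z = 2 * a%:Z + 2 by lia.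
have [W EW] : exists W : int, W = 2 * N%:Z - 2 - 4 * a%:Z by eexists.
have -> : 2 * (N%:Z - 1 - 2 * a%:Z) = W by lia.
rewrite -!mulrA [vdiff^-1 * (_ * _)]mulrCA [vdiff^-1 * (_ / _)]mulrCA !mulrA.
apply: (mulIf vdiff_neq0); apply: (mulIf vdiff_neq0); rewrite mulrBl mulrBl.
set i := vdiff^-1; have iK x : x * i * vdiff = x by rewrite divfK // vdiff_neq0.
rewrite !iK [i * _]mulrC iK vdiffE !mul_sub_tz.
have -> : 2 * N%:Z - 2 * a%:Z - 2 + (2 * a%:Z + 2) = 2 * N%:Z by lia.
have -> : 2 * a%:Z + (2 * N%:Z - 2 * a%:Z) = 2 * N%:Z by lia.
have -> : 2 * N%:Z - 2 * a%:Z - 2 - (2 * a%:Z + 2) = W - 2 by lia.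
have -> : 2 * a%:Z - (2 * N%:Z - 2 * a%:Z) = - (W + 2) by lia.
by rewrite opprK; ring.
Qed.

Lemma Kmx_false z : Kmx false z = Kmx true (- z).
Proof.
by apply/matrixP => a b; rewrite !mxE; case: eqP => // _; congr (t ^ _); rewrite /weight; ring.
Qed.

(** On the dual, transposition reverses products and the powers of K brought in by the antipode
    cancel, so the relation on V carries over with K inverted. *)
Lemma comm_EF up : actE N up *m actF N up - actF N up *m actE N up = vdiff^-1 *: (Kmx up 1 - Kmx up (-1)).
Proof.
case: up; first exact: comm_EF_true.
have H := comm_EF_true; rewrite /actE /actF !matKE in H *.
rewrite 2!mulNmx 2!mulmxN 2!opprK -2!trmx_mul.
have -> : matE N *m Kmx true (-1) *m (Kmx true 1 *m matF N) = matE N *m matF N.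
  by rewrite mulmxA -[_ *m Kmx true (-1) *m Kmx true 1]mulmxA KmxK addNr Kmx0 mulmx1.
have -> : Kmx true 1 *m matF N *m (matE N *m Kmx true (-1)) = matF N *m matE N.
  have := @supp_Kmx true (matF N) (-2) 1 1 (@actF_supp true).
  have := @supp_Kmx true (matE N) 2 1 1 (@actE_supp true).
  rewrite !expr1 => HE ->; rewrite -scalemxAl -mulmxA [Kmx true 1 *m (_ *m _)]mulmxA HE.
  rewrite -scalemxAl -scalemxAr scalerA -tzD -mulmxA KmxK addrN Kmx0 mulmx1 expr0z.
  by rewrite scale1r.
rewrite -linearB -opprB H -scalerN linearZ /= linearN linearB /= !Kmx_tr !Kmx_false opprB opprK.
by [].
Qed.

Lemma scale_sub_add (V : lmodType Qt) (x y z : Qt) (u v : V) :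
  x *: u - y *: v + (z *: u - z *: v) = (x + z) *: u - (y + z) *: v.
Proof. by rewrite !scalerDl opprD addrACA. Qed.

Lemma comm_exprS (A : pzRingType) (e f : A) k :
  e * f ^+ k.+2 - f ^+ k.+2 * e = (e * f ^+ k.+1 - f ^+ k.+1 * e) * f + f ^+ k.+1 * (e * f - f * e).
Proof. by rewrite [f ^+ k.+2]exprSr mulrBl mulrBr !mulrA addrA subrK. Qed.

Lemma comm_EF_exp up k :
  actE N up *m actF N up ^+ k.+1 - actF N up ^+ k.+1 *m actE N up =
  (quantum_int k.+1 / vdiff) *: (actF N up ^+ k *m
     (t ^ (- (2 * k%:Z)) *: Kmx up 1 - t ^ (2 * k%:Z) *: Kmx up (-1))).
Proof.
elim: k => [|k IH].
  rewrite !expr1 expr0 mul1mx comm_EF mulr0 oppr0 expr0z !scale1r; congr (_ *: _).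
  by rewrite quantum_intE mulr1 -vdiffE divff ?mul1r // vdiff_neq0.
set E := actE N up in IH *; set Fm := actF N up in IH *.
rewrite (comm_exprS E Fm k : E *m Fm ^+ k.+2 - Fm ^+ k.+2 *m E =
    (E *m Fm ^+ k.+1 - Fm ^+ k.+1 *m E) *m Fm + Fm ^+ k.+1 *m (E *m Fm - Fm *m E)).
rewrite IH comm_EF.
have HK z : Kmx up z *m Fm = t ^ (- (4 * z)) *: (Fm *m Kmx up z).
  have := @supp_Kmx up Fm (-2) 1 z (@actF_supp up); rewrite expr1 => ->.
  by congr (t ^ _ *: _); ring.
set A := Fm ^+ k.+1.
have EA : Fm ^+ k *m Fm = A by rewrite /A exprSr.
have -> : (quantum_int k.+1 / vdiff) *: (Fm ^+ k *m (t ^ (- (2 * k%:Z)) *: Kmx up 1 - t ^ (2 * k%:Z) *: Kmx up (-1))) *m Fm =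
   (quantum_int k.+1 / vdiff * t ^ (- (2 * k%:Z) - 4)) *: (A *m Kmx up 1) -
   (quantum_int k.+1 / vdiff * t ^ (2 * k%:Z + 4)) *: (A *m Kmx up (-1)).
  rewrite -scalemxAl -mulmxA mulmxBl -2!scalemxAl 2!HK 2!scalerA -2!tzD mulmxBr -2!scalemxAr 2!mulmxA EA.
  by rewrite scalerBr 2!scalerA.
rewrite -[A *m (vdiff^-1 *: _)]scalemxAr mulmxBr scalerBr [in RHS]mulmxBr -2![in RHS]scalemxAr scalerBr 2!scalerA.
move: (A *m Kmx up 1) (A *m Kmx up (-1)) => X Y.
have H1 : quantum_int k.+1 / vdiff * t ^ (- (2 * k%:Z) - 4) + vdiff^-1 = quantum_int k.+2 / vdiff * t ^ (- (2 * k.+1%:Z)).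
  by rewrite mulrAC [in RHS]mulrAC -quantum_int_low [in RHS]mulrDl [in RHS]mul1r.
have H2 : quantum_int k.+1 / vdiff * t ^ (2 * k%:Z + 4) + vdiff^-1 = quantum_int k.+2 / vdiff * t ^ (2 * k.+1%:Z).
  by rewrite mulrAC [in RHS]mulrAC -quantum_int_high [in RHS]mulrDl [in RHS]mul1r.
by rewrite scale_sub_add H1 H2.
Qed.

(* The quasi-R-matrix ([s = true]) and its inverse ([s = false]). *)
Definition Theta (s l r : bool) (Psi : 'M[Qt]_N) : 'M[Qt]_N :=
  \sum_(k < N) theta_coef s k *: (actE N l ^+ k *m Psi *m (actF N r ^+ k)^T).

Lemma supp_Kmx_sub r s k : Kmx r (- sgb s) *m actF N r ^+ k - actF N r ^+ k *m Kmx r (sgb s) =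
  - ((sgb s)%:~R * t ^ (sgb s * (2 * k%:Z))) *:
    (actF N r ^+ k *m (t ^ (- (2 * k%:Z)) *: Kmx r 1 - t ^ (2 * k%:Z) *: Kmx r (-1))).
Proof.
rewrite (supp_Kmx _ _ (@actF_supp r)) mulmxBr -2!scalemxAr.
set X := _ *m Kmx r 1; set Y := _ *m Kmx r (-1).
have -> : 2 * - sgb s * -2 * k%:Z = sgb s * (2 * k%:Z) + sgb s * (2 * k%:Z) by ring.
rewrite scalerBr 2!scalerA; set e := t ^ (2 * k%:Z).
have e0 : t ^ (- (2 * k%:Z)) = e^-1 by rewrite tzN.
have ne : e != 0 by exact: tz_neq0.
rewrite tzD e0; case: s; rewrite /sgb ?mul1r ?mulN1r ?opprK -/X -/Y -/e ?e0.
  by rewrite 2!mulNr divff // 2!scaleNr scale1r opprK addrC.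
by rewrite mulVf // scale1r.
Qed.

(** A tensor is a matrix on which $X\otimes Y$ acts by [X *m Psi *m Y^T]. The commutator of E with
    $F^{k+1}$ cancels against the term in $E^{k+1}$ and $F^k$ by [theta_coef_rec], and the
    nilpotency of E closes the telescope. *)
Lemma Theta_comm s l r Psi :
  Theta s l r (Psi *m (actE N r)^T + actE N l *m Psi *m Kmx r (sgb s)) =
  Theta s l r Psi *m (actE N r)^T + actE N l *m Theta s l r Psi *m Kmx r (- sgb s).
Proof.
set E := actE N r; set Fm := actF N r; set El := actE N l.
rewrite /Theta -/E -/Fm -/El mulmx_suml mulmx_sumr mulmx_suml.
have H : \sum_(k < N) theta_coef s k *: (El ^+ k *m Psi *m (Fm ^+ k *m E - E *m Fm ^+ k)^T) =
   \sum_(k < N) theta_coef s k *: (El ^+ k.+1 *m Psi *m (Kmx r (- sgb s) *m Fm ^+ k - Fm ^+ k *m Kmx r (sgb s))^T).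
  apply: (telescope_shift (P := fun k => theta_coef s k *: (El ^+ k *m Psi *m (Fm ^+ k *m E - E *m Fm ^+ k)^T))
    (Q := fun k => theta_coef s k *: (El ^+ k.+1 *m Psi *m (Kmx r (- sgb s) *m Fm ^+ k - Fm ^+ k *m Kmx r (sgb s))^T))).
  - by rewrite expr0 2!mul1mx mulmx1 subrr trmx0 mulmx0 scaler0.
  - move=> k; rewrite -opprB comm_EF_exp supp_Kmx_sub -/Fm.
    set B := Fm ^+ k *m _.
    have trZ (x : Qt) (A : 'M[Qt]_N) : (x *: A)^T = x *: A^T by exact: linearZ.
    rewrite -scaleNr 2!trZ -2!scalemxAr 2!scalerA; congr (_ *: _).
    by rewrite mulrN theta_coef_rec mulrN mulrC.
  - by rewrite actE_nil 2!mul0mx scaler0.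
rewrite (eq_bigr (fun k : 'I_N => theta_coef s k *: (El ^+ k *m (Psi *m E^T) *m (Fm ^+ k)^T) +
   theta_coef s k *: (El ^+ k *m (El *m Psi *m Kmx r (sgb s)) *m (Fm ^+ k)^T))); last first.
  by move=> k _; rewrite mulmxDr mulmxDl scalerDr.
apply: sum_sub_add H => k.
  rewrite -scalemxAl -scalerBr; congr (_ *: _).
  by rewrite linearB /= 2!trmx_mul mulmxBr 3!mulmxA.
rewrite -scalemxAr -scalemxAl -scalerBr; congr (_ *: _).
rewrite linearB /= 2!trmx_mul 2!Kmx_tr mulmxBr 4!mulmxA.
have e1 : El *m El ^+ k = El ^+ k.+1 by exact: esym (exprS El k).
have e2 : El ^+ k *m El = El ^+ k.+1 by exact: esym (exprSr El k).
by rewrite e1 e2 2![in RHS]mulmxA.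
Qed.

(** The diagonal factor $v^{\pm H\otimes H/2}$ of the R-matrix and of its inverse. *)
Definition Dress (s l r : bool) (Psi : 'M[Qt]_N) : 'M[Qt]_N :=
  \matrix_(a, b) (t ^ (if s then weight l a * weight r b else - (weight l a * weight r b)) * Psi a b).

Lemma Dress_El s l r Psi :
  Dress s l r (actE N l *m Psi) = actE N l *m Dress s l r Psi *m Kmx r (sgb s).
Proof.
apply/matrixP => a b; rewrite mul_Kmx 3!mxE mulr_sumr mulr_suml; apply: eq_bigr => c _; rewrite !mxE.
have [->|/actE_supp ->] := eqVneq (actE N l a c) 0; first by rewrite !(mul0r, mulr0).
rewrite mulrCA -[RHS]mulrA; congr (_ * _).
rewrite [RHS]mulrAC -tzD; congr (t ^ _ * _); case: s => /=; ring.
Qed.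

Lemma Dress_Er s l r Psi :
  Dress s l r (Psi *m (actE N r)^T) = Kmx l (sgb s) *m Dress s l r Psi *m (actE N r)^T.
Proof.
apply/matrixP => a b; rewrite 3!mxE mulr_sumr; apply: eq_bigr => c _; rewrite Kmx_mul !mxE.
have [->|/actE_supp ->] := eqVneq (actE N r b c) 0; first by rewrite !mulr0.
rewrite !mulrA -tzD; congr (t ^ _ * _ * _); case: s => /=; ring.
Qed.

Lemma Dress_Kr s l r z Psi : Dress s l r (Psi *m Kmx r z) = Dress s l r Psi *m Kmx r z.
Proof. by apply/matrixP => a b; rewrite mxE !mul_Kmx mxE mulrA. Qed.

Lemma Dress_Kl s l r z Psi : Dress s l r (Kmx l z *m Psi) = Kmx l z *m Dress s l r Psi.
Proof. by apply/matrixP => a b; rewrite mxE !Kmx_mul mxE mulrCA. Qed.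

Lemma DressD s l r A B : Dress s l r (A + B) = Dress s l r A + Dress s l r B.
Proof. by apply/matrixP => a b; rewrite !mxE mulrDr. Qed.

Lemma Theta_K s l r z Psi : Theta s l r (Kmx l z *m Psi *m Kmx r z) = Kmx l z *m Theta s l r Psi *m Kmx r z.
Proof.
rewrite /Theta mulmx_sumr mulmx_suml; apply: eq_bigr => k _.
rewrite -scalemxAr -scalemxAl; congr (_ *: _).
apply/matrixP => a b; rewrite mul_Kmx Kmx_mul.
rewrite [in LHS]mxE [in RHS]mxE mulr_sumr mulr_suml; apply: eq_bigr => c _.
rewrite ![(_ *m _) a c]mxE !mulr_suml mulr_sumr mulr_suml; apply: eq_bigr => e _.
rewrite mul_Kmx Kmx_mul !mxE.
have [->|He] := eqVneq ((actE N l ^+ k) a e) 0; first by rewrite !(mul0r, mulr0).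
have [->|Hf] := eqVneq ((actF N r ^+ k) b c) 0; first by rewrite !(mul0r, mulr0).
have Ea := exp_supp (@actE_supp l) He; have Eb := exp_supp (@actF_supp r) Hf.
have E : t ^ (2 * z * weight l a) * t ^ (2 * z * weight r b) = t ^ (2 * z * weight l e) * t ^ (2 * z * weight r c).
  by rewrite -!tzD Ea Eb; congr (t ^ _); ring.
apply: (lincomb (c := - (actE N l ^+ k) a e * Psi e c * (actF N r ^+ k) b c) E); ring.
Qed.

Definition DeltaE (l r : bool) (Psi : 'M[Qt]_N) : 'M[Qt]_N :=
  actE N l *m Psi *m Kmx r 1 + Psi *m (actE N r)^T.

(** With tensors as matrices the flip is transposition; [cross_mxE] compares this with
    [cross_coef]. *)
Definition cross_mx (rh l r : bool) (Psi : 'M[Qt]_N) : 'M[Qt]_N :=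
  if rh then (Dress true l r (Theta true l r Psi))^T else Theta false r l (Dress false r l Psi^T).

Lemma cross_mxE rh l r (Psi : 'M[Qt]_N) c d :
  cross_mx rh l r Psi c d = \sum_(a < N) \sum_(b < N) cross_coef rh l r a b c d * Psi a b.
Proof.
have H (x : nat -> Qt) (A B M : 'M[Qt]_N) u v :
  (\sum_(k < N) x k *: (A ^+ k *m M *m (B ^+ k)^T)) u v =
  \sum_(a < N) \sum_(b < N) (\sum_(k < N) x k * (A ^+ k) u a * (B ^+ k) v b) * M a b.
  rewrite summxE exchange_big /=.
  transitivity (\sum_(k < N) \sum_(b < N) \sum_(a < N) x k * (A ^+ k) u a * (B ^+ k) v b * M a b).
    apply: eq_bigr => k _; rewrite 2!mxE mulr_sumr; apply: eq_bigr => b _.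
    rewrite !mxE mulr_suml mulr_sumr; apply: eq_bigr => a _; ring.
  rewrite exchange_big /=; apply: eq_bigr => b _; rewrite exchange_big /=; apply: eq_bigr => a _.
  by rewrite mulr_suml.
rewrite /cross_mx; case: rh.
  rewrite 2!mxE H mulr_sumr; apply: eq_bigr => a _; rewrite mulr_sumr; apply: eq_bigr => b _.
  by rewrite mulrA.
rewrite H exchange_big /=; apply: eq_bigr => a _; apply: eq_bigr => b _.
by rewrite !mxE mulrCA mulrA.
Qed.

Lemma cross_mxD rh l r A B : cross_mx rh l r (A + B) = cross_mx rh l r A + cross_mx rh l r B.
Proof.
apply/matrixP => c d; rewrite mxE !cross_mxE -big_split /=; apply: eq_bigr => a _.
by rewrite -big_split /=; apply: eq_bigr => b _; rewrite mxE mulrDr.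
Qed.

Lemma cross_mx_sum rh l r (x : 'I_N -> Qt) (A : 'I_N -> 'M[Qt]_N) :
  cross_mx rh l r (\sum_i x i *: A i) = \sum_i x i *: cross_mx rh l r (A i).
Proof.
apply/matrixP => c d; rewrite summxE cross_mxE.
transitivity (\sum_a \sum_b \sum_i x i * (cross_coef rh l r a b c d * A i a b)).
  apply: eq_bigr => a _; apply: eq_bigr => b _; rewrite summxE mulr_sumr; apply: eq_bigr => i _.
  by rewrite mxE mulrCA.
under eq_bigr => a _ do rewrite exchange_big.
rewrite exchange_big /=; apply: eq_bigr => i _; rewrite mxE cross_mxE mulr_sumr.
by apply: eq_bigr => a _; rewrite mulr_sumr.
Qed.

Lemma cross_mxZ rh l r x A : cross_mx rh l r (x *: A) = x *: cross_mx rh l r A.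
Proof.
apply/matrixP => c d; rewrite mxE !cross_mxE mulr_sumr; apply: eq_bigr => a _.
by rewrite mulr_sumr; apply: eq_bigr => b _; rewrite mxE mulrCA.
Qed.

Lemma cross_K rh l r z Psi :
  cross_mx rh l r (Kmx l z *m Psi *m Kmx r z) = Kmx r z *m cross_mx rh l r Psi *m Kmx l z.
Proof.
rewrite /cross_mx; case: rh.
  by rewrite Theta_K Dress_Kr Dress_Kl 2!trmx_mul 2!Kmx_tr mulmxA.
by rewrite 2!trmx_mul 2!Kmx_tr mulmxA Dress_Kr Dress_Kl Theta_K.
Qed.

(** [Theta_comm] carries $E\otimes K+1\otimes E$ to $E\otimes K^{-1}+1\otimes E$; the dressing makes
    this the opposite coproduct, which the flip turns back. The inverse crossing goes through the
    same stages in reverse. *)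
Lemma cross_DeltaE rh l r Psi : cross_mx rh l r (DeltaE l r Psi) = DeltaE r l (cross_mx rh l r Psi).
Proof.
rewrite /cross_mx /DeltaE; case: rh.
  rewrite addrC (Theta_comm true) DressD Dress_Er Dress_Kr Dress_El linearD /=.
  rewrite -[actE N l *m _ *m Kmx r (sgb true) *m _]mulmxA KmxK addrN Kmx0 mulmx1.
  by rewrite !trmx_mul trmxK Kmx_tr mulmxA.
rewrite linearD /= 3!trmx_mul trmxK Kmx_tr DressD Dress_Kl.
have -> : Dress false r l (Psi^T *m (actE N l)^T) = Kmx r (-1) *m Dress false r l Psi^T *m (actE N l)^T.
  exact: Dress_Er.
rewrite 2!mulmxA KmxK addrN Kmx0 mul1mx Dress_El.
by rewrite (Theta_comm false) addrC.
Qed.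

(** * States on three strands *)

Definition slice0 (psi : state) c : 'M[Qt]_N := \matrix_(a, b) psi a b c.
Definition slice1 (psi : state) a : 'M[Qt]_N := \matrix_(b, c) psi a b c.

(* Vectors of the triple tensor product killed by [E]. *)
Definition highest (o0 o1 o2 : bool) (psi : state) := forall a b c,
  t ^ (2 * weight o1 b) * t ^ (2 * weight o2 c) * \sum_i actE N o0 a i * psi i b c +
  t ^ (2 * weight o2 c) * \sum_i actE N o1 b i * psi a i c +
  \sum_i actE N o2 c i * psi a b i = 0.

Definition braid0 rh o0 o1 (psi : state) : state := fun a b c => cross_mx rh o0 o1 (slice0 psi c) a b.
Definition braid1 rh o1 o2 (psi : state) : state := fun a b c => cross_mx rh o1 o2 (slice1 psi a) b c.

(** Coassociativity: the iterated coproduct of E is grouped here on strands 0 and 1, and in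
    [highest1P] on strands 1 and 2, to match the strands that cross. *)
Lemma highest0P o0 o1 o2 psi : highest o0 o1 o2 psi <->
  forall c, t ^ (2 * weight o2 c) *: DeltaE o0 o1 (slice0 psi c) +
    \sum_i actE N o2 c i *: slice0 psi i = 0.
Proof.
have H a b c : (t ^ (2 * weight o2 c) *: DeltaE o0 o1 (slice0 psi c) +
    \sum_i actE N o2 c i *: slice0 psi i) a b =
   t ^ (2 * weight o1 b) * t ^ (2 * weight o2 c) * (\sum_i actE N o0 a i * psi i b c) +
  t ^ (2 * weight o2 c) * (\sum_i actE N o1 b i * psi a i c) + \sum_i actE N o2 c i * psi a b i.
  rewrite mxE summxE mxE [DeltaE _ _ _ _ _]mxE mul_Kmx mulr1 mxE [(_ *m _^T) a b]mxE mulrDr.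
  congr (_ + _ + _); last by apply: eq_bigr => i _; rewrite !mxE.
    by under [in LHS]eq_bigr => i _ do rewrite mxE; ring.
  by congr (_ * _); apply: eq_bigr => i _; rewrite !mxE mulrC.
split=> [hw c|hw a b c]; first by apply/matrixP => a b; rewrite H hw mxE.
by rewrite -H hw mxE.
Qed.

Lemma highest1P o0 o1 o2 psi : highest o0 o1 o2 psi <->
  forall a, \sum_i actE N o0 a i *: (Kmx o1 1 *m slice1 psi i *m Kmx o2 1) +
    DeltaE o1 o2 (slice1 psi a) = 0.
Proof.
have H a b c : (\sum_i actE N o0 a i *: (Kmx o1 1 *m slice1 psi i *m Kmx o2 1) +
    DeltaE o1 o2 (slice1 psi a)) b c =
   t ^ (2 * weight o1 b) * t ^ (2 * weight o2 c) * (\sum_i actE N o0 a i * psi i b c) +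
  t ^ (2 * weight o2 c) * (\sum_i actE N o1 b i * psi a i c) + \sum_i actE N o2 c i * psi a b i.
  rewrite mxE summxE [DeltaE _ _ _ _ _]mxE mul_Kmx mulr1 mxE [(_ *m _^T) b c]mxE addrA.
  congr (_ + _ + _).
  - rewrite mulr_sumr; apply: eq_bigr => i _; rewrite mxE mul_Kmx Kmx_mul mulr1 !mxE.
    ring.
  - by rewrite mulrC; congr (_ * _); apply: eq_bigr => i _; rewrite mxE.
  - by apply: eq_bigr => i _; rewrite !mxE mulrC.
split=> [hw a|hw a b c]; first by apply/matrixP => b c; rewrite H hw mxE.
by rewrite -H hw mxE.
Qed.

Lemma highest_braid0 rh o0 o1 o2 psi :
  highest o0 o1 o2 psi -> highest o1 o0 o2 (braid0 rh o0 o1 psi).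
Proof.
move=> /highest0P hw; apply/highest0P => c.
have E i : slice0 (braid0 rh o0 o1 psi) i = cross_mx rh o0 o1 (slice0 psi i).
  by apply/matrixP => a b; rewrite mxE.
rewrite E -cross_DeltaE -cross_mxZ.
under eq_bigr => i _ do rewrite E.
rewrite -cross_mx_sum -cross_mxD hw.
by apply/matrixP => a b; rewrite cross_mxE mxE big1 // => i _; rewrite big1 // => j _; rewrite mxE mulr0.
Qed.

Lemma highest_braid1 rh o0 o1 o2 psi :
  highest o0 o1 o2 psi -> highest o0 o2 o1 (braid1 rh o1 o2 psi).
Proof.
move=> /highest1P hw; apply/highest1P => a.
have E i : slice1 (braid1 rh o1 o2 psi) i = cross_mx rh o1 o2 (slice1 psi i).
  by apply/matrixP => b c; rewrite mxE.
rewrite E -cross_DeltaE.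
under eq_bigr => i _ do rewrite E -cross_K.
rewrite -cross_mx_sum -cross_mxD hw.
by apply/matrixP => b c; rewrite cross_mxE mxE big1 // => i _; rewrite big1 // => j _; rewrite mxE mulr0.
Qed.

Definition wt (i : nat) : int := N%:Z - 1 - 2 * i%:Z.

Lemma weight_true (a : 'I_N) : weight true a = wt a. Proof. by []. Qed.
Lemma weight_false (a : 'I_N) : weight false a = - wt a. Proof. by []. Qed.

Definition cup_state : state := fun a b c => cup_coef true b c * (if a == ord0 then 1 else 0).

(** E kills $e_0$, and the coevaluation is invariant. *)
Lemma highest_cup : highest true true false cup_state.
Proof.
move=> a b c; have -> : \sum_i actE N true a i * cup_state i b c = 0.
  apply: big1 => i _; rewrite /cup_state /actE mxE; case: (nat_of_ord i =P a.+1) => [E|_]; last by rewrite mul0r.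
  by case: (i =P ord0) E => [->|_] //; rewrite !mulr0.
rewrite mulr0 add0r.
have -> : \sum_i actE N true b i * cup_state a i c = actE N true b c * (if a == ord0 then 1 else 0).
  rewrite (bigD1 c) //= big1 ?addr0 /cup_state /cup_coef => [|i /negPf ->]; last by rewrite mul0r mulr0.
  by rewrite eqxx mul1r.
have -> : \sum_i actE N false c i * cup_state a b i = actE N false c b * (if a == ord0 then 1 else 0).
  rewrite (bigD1 b) //= big1 ?addr0 /cup_state /cup_coef => [|i]; last first.
    by rewrite eq_sym => /negPf ->; rewrite mul0r mulr0.
  by rewrite eqxx mul1r.
rewrite actE_false weight_false.
have -> : 2 * - wt c = - (2 * weight true c) by rewrite weight_true; ring.
rewrite mulrA -mulrDl [_ * actE _ _ _ _]mulrC subrr mul0r; exact: erefl.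
Qed.

Lemma sum_actE_false (c : 'I_N) (X : 'I_N -> Qt) : (0 < c)%N ->
  \sum_i actE N false c i * X i = - (quantum_int (N - c) * t ^ (- (2 * wt c)) * X (inord c.-1)).
Proof.
move=> c_gt0; have E : (inord c.-1 : 'I_N) = c.-1 :> nat by rewrite inordK // (leq_ltn_trans (leq_pred _)).
rewrite (bigD1 (inord c.-1)) //= big1 ?addr0 => [|i ne_i].
  by rewrite actE_false mxE E prednK // eqxx mulNr.
rewrite actE_false mxE; case: (nat_of_ord c =P i.+1) => [Ei|_]; last by rewrite !mul0r oppr0 mul0r.
by case/eqP: ne_i; apply: val_inj; rewrite /= E Ei.
Qed.

Lemma matF_exp k (a b : 'I_N) :
  (matF N ^+ k) a b = if a == (b + k)%N :> nat then quantum_fact a / quantum_fact b else 0.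
Proof.
elim: k a => [|k IH] a.
  rewrite expr0 mxE addn0 -[(_ == _ :> nat)]/(a == b); case: eqP => [->|_] //.
  by rewrite divff // quantum_fact_neq0.
rewrite exprS mxE sum_matF IH addnS; case: a => [[|a] lt_a] /=.
  by rewrite quantum_int0 mul0r.
rewrite inordK; last exact: ltnW.
by rewrite eqSS; case: eqP => _; rewrite ?mulr0 // quantum_factS mulrA [quantum_int _ * _]mulrC.
Qed.

Lemma actF_false_exp k (a b : 'I_N) : (actF N false ^+ k) a b =
  if b == (a + k)%N :> nat then (-1) ^+ k * t ^ (2 * (k%:Z * wt a - k%:Z * k%:Z - k%:Z)) *
    (quantum_fact b / quantum_fact a) else 0.
Proof.
elim: k a => [|k IH] a.
  rewrite expr0 mxE addn0 -[(_ == _ :> nat)]/(b == a) eq_sym; case: eqP => [->|_] //.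
  by rewrite divff ?quantum_fact_neq0 // !mul0r !subr0 mulr0 expr0z !mulr1.
have [lt_a|le_a] := ltnP a.+1 N; last first.
  rewrite exprS mxE big1 => [|c _]; last first.
    rewrite actF_false mxE; case: (nat_of_ord c =P a.+1) => [E|_]; last by rewrite mulr0 oppr0 mul0r.
    by have := ltn_ord c; rewrite E ltnNge le_a.
  case: eqP => // E; have := ltn_ord b; rewrite E => H; exfalso; move: H le_a; clear; lia.
rewrite exprS mxE (bigD1 (inord a.+1)) //= big1 ?addr0 => [|i ne_i]; last first.
  rewrite actF_false mxE; case: (nat_of_ord i =P a.+1) => [Ei|_]; last by rewrite mulr0 oppr0 mul0r.
  by case/eqP: ne_i; rewrite -Ei inord_val.
rewrite IH actF_false mxE weight_true inordK // eqxx addnS addSn; case: eqP => _; last by rewrite mulr0.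
rewrite quantum_factS invfM exprS.
have E : t ^ (2 * wt a.+1) * t ^ (2 * (k%:Z * wt a.+1 - k%:Z * k%:Z - k%:Z)) =
  t ^ (2 * (k.+1%:Z * wt a - k.+1%:Z * k.+1%:Z - k.+1%:Z)).
  by rewrite -tzD; congr (t ^ _); rewrite /wt; lia.
rewrite -E; have := quantum_int_neq0 a => nz.
have Q : quantum_int a.+1 * (quantum_int a.+1)^-1 = 1 by rewrite divff.
apply: (lincomb (c := - t ^ (2 * wt a.+1) * t ^ (2 * (k%:Z * wt a.+1 - k%:Z * k%:Z - k%:Z)) * (-1) ^+ k *
   quantum_fact b / quantum_fact a) Q); ring.
Qed.

Lemma actF_exp_ord0 k (b : 'I_N) : (actF N true ^+ k) ord0 b = ((k == 0%N) && (b == ord0))%:R.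
Proof.
rewrite /actF matF_exp /=; case: k => [|k] /=; last by rewrite addnS.
rewrite addn0 eq_sym -[(_ == _ :> nat)]/(b == ord0); case: eqP => [->|_] //.
by rewrite divff // quantum_fact_neq0.
Qed.

(** After the flip, strand 0 is the factor on which F has acted. Positive powers of F never produce
    $e_0$, so only the term $k=0$ of the R-matrix contributes. *)
Lemma braid0_f (psi : state) x :
  braid0 true true true psi ord0 x x = t ^ (wt 0 * wt x) * psi x ord0 x.
Proof.
rewrite /braid0 /cross_mx 2!mxE 2!weight_true [wt x * _]mulrC summxE; congr (_ * _).
rewrite big_ord_recl big1 ?addr0 => [|k _].
  rewrite /theta_coef mul1mx trmx1 mulmx1 !mxE quantum_fact0 !expr0 !mul1r invr1 mul1r; exact: erefl.
by rewrite mxE mxE big1 ?mulr0 // => b _; rewrite [X in _ * X]mxE actF_exp_ord0 mulr0.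
Qed.

Lemma braid1_eps (psi : state) x :
  braid1 false true false psi x x ord0 = t ^ (wt 0 * wt x) * psi x ord0 x.
Proof.
rewrite /braid1 /cross_mx /Theta summxE big_ord_recl big1 ?addr0 => [|k _].
  rewrite mxE mul1mx trmx1 mulmx1 !mxE weight_true weight_false /theta_coef quantum_fact0 !expr0 invr1 !mulr1 mul1r.
  congr (t ^ _ * _); rewrite /=; ring.
by rewrite mxE mxE big1 ?mulr0 // => b _; rewrite [X in _ * X]mxE actF_exp_ord0 mulr0.
Qed.

(** * Explicit half-twists in the coordinates *)

Definition qint_prod (a b : nat) : Qt := \prod_(a <= i < b) quantum_int (n - i).

Lemma qint_prodSr a b : (a <= b)%N -> qint_prod a b.+1 = qint_prod a b * quantum_int (n - b).
Proof. by move=> le_ab; rewrite /qint_prod big_nat_recr. Qed.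

Lemma qint_prodSl a b : (a < b)%N -> qint_prod a b = quantum_int (n - a) * qint_prod a.+1 b.
Proof. by move=> lt_ab; rewrite /qint_prod big_ltn. Qed.

Lemma t_q (i : nat) : q ^+ i = t ^ (4 * i%:Z).
Proof. by rewrite exprnP qzE4. Qed.

(* As [E] kills [psi], the action of [E] on strand 0 (below, on strand 2) can be traded for its
   actions on the two other strands, which shift the diagonal coordinates. *)
Lemma highest_exp0 (psi : state) k (b c : 'I_N) : highest true true false psi -> c = (b + k)%N :> nat ->
  \sum_i (actE N true ^+ k) ord0 i * psi i b c =
  qint_prod b c * qdiff (t ^ (- (2 * n%:Z))) (fun y => psi ord0 (inord y) (inord y)) k b.
Proof.
move=> hw; elim: k b c => [|k IH] b c Ec.
  rewrite addn0 in Ec; have -> : c = b by exact: val_inj.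
  rewrite /qint_prod big_geq // mul1r /= inord_val expr0 (bigD1 ord0) //= big1 => [|i ne_i].
    by rewrite addr0 !mxE mul1r.
  by rewrite mxE eq_sym (negPf ne_i) mul0r.
have c_gt0 : (0 < c)%N by rewrite Ec addnS.
pose P (b c : 'I_N) := \sum_i (actE N true ^+ k) ord0 i * psi i b c.
have Erec : \sum_i (actE N true ^+ k.+1) ord0 i * psi i b c =
    t ^ (- (2 * wt b)) * (quantum_int (N - c) * P b (inord c.-1) - quantum_int (N - b.+1) * P (inord b.+1) c).
  transitivity (\sum_j (actE N true ^+ k) ord0 j * \sum_i actE N true j i * psi i b c).
    rewrite exprSr; under eq_bigr => i _ do rewrite mxE mulr_suml.
    rewrite exchange_big /=; apply: eq_bigr => j _; rewrite mulr_sumr.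
    by apply: eq_bigr => i _; rewrite mulrA.
  rewrite /P 2!mulr_sumr -sumrB mulr_sumr; apply: eq_bigr => j _.
  have := hw j b c; rewrite (sum_matE b (fun i => psi j i c)) sum_actE_false // weight_true weight_false => H.
  have esum : 2 * - wt c = - (2 * wt c) by ring.
  rewrite esum in H; set S := \sum_i _ in H *.
  have HS : quantum_int (N - c) * psi j b (inord c.-1) - quantum_int (N - b.+1) * psi j (inord b.+1) c =
      t ^ (2 * wt b) * S.
    apply: (mulfI (tz_neq0 (- (2 * wt c)))).
    by apply: (lincomb (c := -1) H); ring.
  have E1 : t ^ (- (2 * wt b)) * t ^ (2 * wt b) = 1 by rewrite -tzD addNr.
  set e := (actE N true ^+ k) ord0 j.
  transitivity (e * (t ^ (- (2 * wt b)) * t ^ (2 * wt b) * S)); first by rewrite E1 mul1r.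
  by rewrite -mulrA -HS; ring.
have [lt_b|le_b] := ltnP b.+1 N; last first.
  by have := ltn_ord c; rewrite Ec; move: le_b; clear; lia.
have Ep : (inord c.-1 : 'I_N) = (b + k)%N :> nat.
  by rewrite inordK ?(leq_ltn_trans (leq_pred _)) // Ec addnS.
have Eb : (inord b.+1 : 'I_N) = b.+1 :> nat by rewrite inordK.
rewrite Erec /P (IH _ _ Ep) Ep (IH (inord b.+1) c); last by rewrite Eb Ec addnS.
rewrite Eb Ec addnS subSS.
rewrite (@qint_prodSl b (b + k).+1); last by rewrite ltnS leq_addr.
rewrite [qdiff _ _ k.+1 _]/= t_q.
have -> : t ^ (- (2 * wt b)) = t ^ (- (2 * n%:Z)) * t ^ (4 * b%:Z).
  by rewrite -tzD; congr (t ^ _); rewrite /wt; lia.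
rewrite subSS; have Ep1 := @qint_prodSr b (b + k) (leq_addr _ _).
rewrite qint_prodSl in Ep1; last by rewrite ltnS leq_addr.
apply: (lincomb (c := - t ^ (- (2 * n%:Z)) * t ^ (4 * b%:Z) * qdiff (t ^ (- (2 * n%:Z))) (fun y => psi ord0 (inord y) (inord y)) k b) Ep1); ring.
Qed.

Lemma highest_exp2 (psi : state) k (a e : 'I_N) : highest true false true psi -> e = (a + k)%N :> nat ->
  \sum_i (actE N true ^+ k) ord0 i * psi a e i =
  qint_prod a e * qdiff q (fun y => psi (inord y) (inord y) ord0) k a.
Proof.
move=> hw; elim: k a e => [|k IH] a e Ee.
  rewrite addn0 in Ee; have -> : e = a by exact: val_inj.
  rewrite /qint_prod big_geq // mul1r /= inord_val expr0 (bigD1 ord0) //= big1 => [|i ne_i].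
    by rewrite addr0 !mxE mul1r.
  by rewrite mxE eq_sym (negPf ne_i) mul0r.
have e_gt0 : (0 < e)%N by rewrite Ee addnS.
pose P (a e : 'I_N) := \sum_i (actE N true ^+ k) ord0 i * psi a e i.
have Erec : \sum_i (actE N true ^+ k.+1) ord0 i * psi a e i =
    t ^ (2 * wt k - 2 * wt e) * (quantum_int (N - e) * P a (inord e.-1) - quantum_int (N - a.+1) * P (inord a.+1) e).
  transitivity (\sum_j (actE N true ^+ k) ord0 j * \sum_i actE N true j i * psi a e i).
    rewrite exprSr; under eq_bigr => i _ do rewrite mxE mulr_suml.
    rewrite exchange_big /=; apply: eq_bigr => j _; rewrite mulr_sumr.
    by apply: eq_bigr => i _; rewrite mulrA.
  rewrite /P 2!mulr_sumr -sumrB mulr_sumr; apply: eq_bigr => j _.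
  (* The factor pulled out depends on the weight of [j], which the support of $E^k$ forces to be
     that of index [k]. *)
  have [->|/(exp_supp (@actE_supp true)) esum] := eqVneq ((actE N true ^+ k) ord0 j) 0.
    by rewrite !mul0r !mulr0 subrr mulr0.
  have := hw a e j; rewrite (sum_matE a (fun i => psi i e j)) sum_actE_false // weight_true weight_false => H.
  set S := \sum_i _ in H *.
  have Ej : wt k = wt j by have j0 : (ord0 : 'I_N) = 0%N :> nat by []; move: esum; rewrite !weight_true /wt j0; lia.
  rewrite Ej tzD.
  have E2 : 2 * - wt e = - (2 * wt e) by ring.
  rewrite E2 in H.
  set u := (actE N true ^+ k) ord0 j.
  apply: (lincomb (c := u) H); ring.
have [lt_a|le_a] := ltnP a.+1 N; last first.
  by have := ltn_ord e; rewrite Ee; move: le_a; clear; lia.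
have Ep : (inord e.-1 : 'I_N) = (a + k)%N :> nat.
  by rewrite inordK ?(leq_ltn_trans (leq_pred _)) // Ee addnS.
have Ea : (inord a.+1 : 'I_N) = a.+1 :> nat by rewrite inordK.
rewrite Erec /P (IH _ _ Ep) Ep (IH (inord a.+1) e); last by rewrite Ea Ee addnS.
rewrite Ea Ee addnS subSS.
rewrite (@qint_prodSl a (a + k).+1); last by rewrite ltnS leq_addr.
rewrite [qdiff _ _ k.+1 _]/= -exprS t_q.
have -> : t ^ (2 * wt k - 2 * wt (a + k).+1) = t ^ (4 * a.+1%:Z).
  by congr (t ^ _); rewrite /wt; lia.
rewrite subSS; have Ep1 := @qint_prodSr a (a + k) (leq_addr _ _).
rewrite qint_prodSl in Ep1; last by rewrite ltnS leq_addr.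
apply: (lincomb (c := - t ^ (4 * a.+1%:Z) * qdiff q (fun y => psi (inord y) (inord y) ord0) k a) Ep1); ring.
Qed.

Lemma sub_tzE (w : int) : t ^ (2 * w) - t ^ (- (2 * w)) = - t ^ (- (2 * w)) * (1 - t ^ (4 * w)).
Proof. by rewrite mulrBr mulr1 mulNr opprK -tzD [RHS]addrC; congr (t ^ _ - _); ring. Qed.

Lemma quantum_factE k : quantum_fact k * vdiff ^+ k = (-1) ^+ k * t ^ (- (k%:Z * k%:Z + k%:Z)) * pch q k.
Proof.
elim: k => [|k IH]; first by rewrite quantum_fact0 !expr0 pch0 mul0r addr0 oppr0 expr0z !mulr1.
rewrite quantum_factS 2!exprS qfS quantum_intE t_q.
rewrite sub_tzE; have -> : t ^ (- (k.+1%:Z * k.+1%:Z + k.+1%:Z)) = t ^ (- (k%:Z * k%:Z + k%:Z)) * t ^ (- (2 * k.+1%:Z)).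
  by rewrite -tzD; congr (t ^ _); lia.
set u := - t ^ _ * _; transitivity (quantum_fact k * vdiff ^+ k * u * (vdiff / vdiff)); first by ring.
by rewrite divff ?vdiff_neq0 // IH /u; ring.
Qed.

Lemma quantum_binomial x y : quantum_fact (x + y) / (quantum_fact x * quantum_fact y) =
  t ^ (- (2 * (x%:Z * y%:Z))) * gb (x + y) x.
Proof.
have nz := mulf_neq0 (quantum_fact_neq0 x) (quantum_fact_neq0 y).
have dn k : vdiff ^+ k != 0 by exact: expf_neq0 vdiff_neq0.
apply: (mulIf nz); rewrite divfK //.
apply: (mulIf (dn (x + y)%N)); rewrite quantum_factE.
transitivity (t ^ (- (2 * (x%:Z * y%:Z))) * gb (x + y) x * ((quantum_fact x * vdiff ^+ x) * (quantum_fact y * vdiff ^+ y))); last by rewrite [vdiff ^+ (x + y)]exprD; ring.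
rewrite 2!quantum_factE -(gb_fact q x y) exprD.
have -> : t ^ (- ((x + y)%N%:Z * (x + y)%N%:Z + (x + y)%N%:Z)) =
  t ^ (- (2 * (x%:Z * y%:Z))) * t ^ (- (x%:Z * x%:Z + x%:Z)) * t ^ (- (y%:Z * y%:Z + y%:Z)).
  by rewrite -!tzD; congr (t ^ _); rewrite PoszD; ring.
ring.
Qed.

Lemma qint_prodE a k : (a + k <= N)%N -> qint_prod a (a + k) * vdiff ^+ k =
  (-1) ^+ k * t ^ (- (2 * (k%:Z * (n%:Z - a%:Z) - tri k + k%:Z))) * fall a (a + k).
Proof.
elim: k => [|k IH] le_N.
  rewrite addn0 /qint_prod big_geq // fallnn !expr0 tri0 (_ : 2 * _ = 0); last by ring.
  by rewrite oppr0 expr0z !mulr1.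
rewrite addnS qint_prodSr ?leq_addr // fallSr ?leq_addr // 2!exprS triS quantum_intE.
have -> : (n - (a + k))%N%:Z = n%:Z - a%:Z - k%:Z by lia.
set w := n%:Z - a%:Z - k%:Z.
have -> : N%:Z - 1 - (a + k)%N%:Z = w by rewrite /w; lia.
rewrite qzE4.
rewrite sub_tzE.
have -> : t ^ (- (2 * (k.+1%:Z * (n%:Z - a%:Z) - (tri k + k%:Z + 1) + k.+1%:Z))) =
   t ^ (- (2 * (k%:Z * (n%:Z - a%:Z) - tri k + k%:Z))) * t ^ (- (2 * w)).
  by rewrite -tzD; congr (t ^ _); rewrite /w; lia.
set u := - t ^ (- (2 * w)) * _; transitivity (qint_prod a (a + k) * vdiff ^+ k * u * (vdiff / vdiff)); first by ring.
by rewrite divff ?vdiff_neq0 // IH; [rewrite /u; ring | lia].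
Qed.

Lemma theta_coef_braid0 k y : (y + k < N)%N ->
  theta_coef true k * (qint_prod y (y + k) * (t ^ (- (2 * n%:Z))) ^+ k) * (quantum_fact (y + k) / quantum_fact y) =
  (-1) ^+ k * q ^ (tri k - k%:Z - k%:Z * (N%:Z - 1)) * gb (y + k) k * fall y (y + k).
Proof.
move=> lt_N; have B := quantum_binomial k y.
have P := @qint_prodE y k (ltnW lt_N).
rewrite /theta_coef -/vdiff.
transitivity (t ^+ (k * k.-1) * (t ^ (- (2 * n%:Z))) ^+ k * (qint_prod y (y + k) * vdiff ^+ k) *
   (quantum_fact (k + y) / (quantum_fact k * quantum_fact y))).
  by rewrite invfM [(k + y)%N]addnC; ring.
rewrite B P [(k + y)%N]addnC tzX qzE4.
have -> : t ^+ (k * k.-1) = t ^ (k%:Z * k%:Z - k%:Z).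
  by rewrite exprnP; congr (t ^ _); case: k {lt_N B P} => //= k; lia.
have -> : t ^ (4 * (tri k - k%:Z - k%:Z * (N%:Z - 1))) =
  t ^ (k%:Z * k%:Z - k%:Z) * t ^ (- (2 * n%:Z) * k%:Z) * t ^ (- (2 * (k%:Z * (n%:Z - y%:Z) - tri k + k%:Z))) *
  t ^ (- (2 * (k%:Z * y%:Z))).
  by rewrite -!tzD; congr (t ^ _); have := tri2 k; lia.
ring.
Qed.

(** The power $F^k$ selects the index [x - k], [highest_exp0] turns $E^k$ into an iterated
    $q$-difference, and [braid_sum] carries out the sum over [k]. *)
Lemma braid0_g (psi : state) x : highest true true false psi ->
  braid0 true true true psi x ord0 x = t ^ (wt 0 * wt x) *
  \sum_(0 <= y < x.+1) gb x y * ((-1) ^+ (x - y) * fall y x *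
     q ^ (tri (x - y) - (x - y)%N%:Z - (x - y)%N%:Z * (N%:Z - 1) + (x - y)%N%:Z * y%:Z - y%:Z * (N%:Z - y%:Z)) *
     psi ord0 (inord y) (inord y)).
Proof.
move=> hw; rewrite /braid0 /cross_mx 2!mxE 2!weight_true; congr (_ * _).
set f := fun y => psi ord0 (inord y) (inord y).
rewrite -(braid_sum q_neq0 qX_neq1 f (ltn_ord x)) /Theta summxE.
rewrite big_mkord.
rewrite (big_ord_widen N (fun k => (-1) ^+ k * q ^ (tri k - k%:Z - k%:Z * (N%:Z - 1) + k%:Z * (x%:Z - k%:Z)) *
     gb x k * fall (x - k) x * qdsum f k (x - k)) (ltn_ord x)) [RHS]big_mkcond /=.
apply: eq_bigr => k _; rewrite mxE mxE.
rewrite ltnS; case: (leqP k x) => [le_kx|lt_xk]; last first.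
  rewrite big1 ?mulr0 // => b _; rewrite [X in _ * X]mxE /actF matF_exp.
  case: (nat_of_ord x =P (b + k)%N) => [E|_]; last exact: mulr0.
  by move: lt_xk; rewrite E ltnNge leq_addl.
have lt_y : (x - k < N)%N by rewrite (leq_ltn_trans (leq_subr _ _)).
have Ey : (inord (x - k) : 'I_N) = (x - k)%N :> nat by rewrite inordK.
rewrite (bigD1 (inord (x - k))) //= big1 ?addr0 => [|b ne_b]; last first.
  rewrite [X in _ * X]mxE matF_exp; case: (nat_of_ord x =P (b + k)%N) => [E|_]; last exact: mulr0.
  by case/eqP: ne_b; apply: val_inj; rewrite /= Ey E addnK.
rewrite [X in _ * (_ * X)]mxE matF_exp Ey subnK // eqxx.
have -> : (actE N true ^+ k *m slice0 psi x) ord0 (inord (x - k)) =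
   qint_prod (x - k) x * qdiff (t ^ (- (2 * n%:Z))) f k (x - k).
  rewrite mxE; under eq_bigr => i _ do rewrite mxE.
  by rewrite (highest_exp0 hw) Ey // subnK.
rewrite (qdiffE q_neq0 qX_neq1).
have := @theta_coef_braid0 k (x - k); rewrite subnK // => /(_ (ltn_ord x)) H.
have -> : q ^ (tri k - k%:Z - k%:Z * (N%:Z - 1) + k%:Z * (x%:Z - k%:Z)) =
   q ^ (tri k - k%:Z - k%:Z * (N%:Z - 1)) * q ^+ (k * (x - k)).
  by rewrite exprnP -(qzD q_neq0); congr (q ^ (_ + _)); rewrite PoszM; congr (_ * _); lia.
rewrite /theta_coef in H; by apply: (lincomb (c := q ^+ (k * (x - k)) * qdsum f k (x - k)) H); ring.
Qed.

Lemma theta_coef_braid1 k x : (x + k < N)%N ->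
  theta_coef false k * t ^ (wt k * wt (x + k)) * ((-1) ^+ k * t ^ (2 * (k%:Z * wt x - k%:Z * k%:Z - k%:Z)) *
    (quantum_fact (x + k) / quantum_fact x)) * (qint_prod x (x + k) * (q ^+ k * q ^+ (k * x))) =
  t ^ (wt 0 * wt x) * ((-1) ^+ k * q ^ (tri k + k%:Z * (x%:Z - N%:Z + 1)) * gb (x + k) k * fall x (x + k)).
Proof.
move=> lt_N; have B := quantum_binomial k x.
have P := @qint_prodE x k (ltnW lt_N).
have S : (-1) ^+ k * (-1) ^+ k = 1 :> Qt by rewrite -exprD addnn -mul2n exprM sqrrN expr1n expr1n.
rewrite /theta_coef -/vdiff.
transitivity (t ^- (k * k.-1) * t ^ (wt k * wt (x + k)) * t ^ (2 * (k%:Z * wt x - k%:Z * k%:Z - k%:Z)) *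
   (q ^+ k * q ^+ (k * x)) * ((-1) ^+ k * (-1) ^+ k) * (qint_prod x (x + k) * vdiff ^+ k) *
   (quantum_fact (k + x) / (quantum_fact k * quantum_fact x))).
  by rewrite invfM [(k + x)%N]addnC; ring.
rewrite B P S [(k + x)%N]addnC 2!t_q qzE4.
have -> : t ^- (k * k.-1) = t ^ (- (k%:Z * k%:Z - k%:Z)).
  by rewrite tzN exprnP; congr ((t ^ _)^-1); case: k {lt_N B P S} => //= k; lia.
have E : t ^ (wt 0 * wt x) * t ^ (4 * (tri k + k%:Z * (x%:Z - N%:Z + 1))) =
  t ^ (- (k%:Z * k%:Z - k%:Z)) * t ^ (wt k * wt (x + k)) * t ^ (2 * (k%:Z * wt x - k%:Z * k%:Z - k%:Z)) *
  t ^ (4 * k%:Z) * t ^ (4 * (k * x)%N%:Z) * t ^ (- (2 * (k%:Z * (n%:Z - x%:Z) - tri k + k%:Z))) *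
  t ^ (- (2 * (k%:Z * x%:Z))).
  rewrite -!tzD; congr (t ^ _); have T := tri2 k; rewrite PoszM /wt PoszD.
  have -> : N%:Z = n%:Z + 1 by lia.
  apply/eqP; rewrite -subr_eq0; apply/eqP.
  by transitivity (2 * tri k - (k%:Z * k%:Z + k%:Z)); [ring | rewrite T subrr].
apply: (lincomb (c := - (-1) ^+ k * gb (x + k) k * fall x (x + k)) E); ring.
Qed.

Lemma braid1_g (psi : state) x : highest true false true psi ->
  braid1 false false true psi x ord0 x = t ^ (wt 0 * wt x) *
  \sum_(x <= y < N) gb y x * (fall x y * q ^ ((y - x)%N%:Z * (y - x)%N%:Z + (y - x)%N%:Z * (x%:Z - N%:Z + 1) +
       (y%:Z + 1) * (N%:Z - 1 - y%:Z))) * psi (inord y) (inord y) ord0.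
Proof.
move=> hw; rewrite /braid1 /cross_mx.
set f := fun y => psi (inord y) (inord y) ord0.
rewrite -(unbraid_sum q_neq0 qX_neq1 f (ltn_ord x)) /Theta summxE big_mkord mulr_sumr.
apply: eq_bigr => k _; rewrite mxE mxE.
have [lt_N|le_N] := ltnP (x + k) N; last first.
  rewrite (fall_zero q_neq0) ?mulr0 ?mul0r ?mulr0 // big1 ?mulr0 // => b _; rewrite [X in _ * X]mxE actF_false_exp.
  case: (nat_of_ord b =P (x + k)%N) => [E|_]; last exact: mulr0.
  by have := ltn_ord b; rewrite E ltnNge le_N.
have Ee : (inord (x + k) : 'I_N) = (x + k)%N :> nat by rewrite inordK.
rewrite (bigD1 (inord (x + k))) //= big1 ?addr0 => [|b ne_b]; last first.
  rewrite [X in _ * X]mxE actF_false_exp; case: (nat_of_ord b =P (x + k)%N) => [E|_]; last exact: mulr0.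
  by case/eqP: ne_b; apply: val_inj; rewrite /= Ee E.
rewrite [X in _ * (_ * X)]mxE actF_false_exp Ee eqxx.
have -> : (actE N true ^+ k *m Dress false true false (slice1 psi x)^T) ord0 (inord (x + k)) =
   t ^ (wt k * wt (x + k)) * (qint_prod x (x + k) * qdiff q f k x).
  rewrite -[in RHS]Ee -(highest_exp2 hw) // mxE mulr_sumr; apply: eq_bigr => i _.
  rewrite !mxE weight_true weight_false Ee.
  have [->|/(exp_supp (@actE_supp true))] := eqVneq ((actE N true ^+ k) ord0 i) 0.
    by rewrite !mul0r mulr0.
  rewrite !weight_true => esum.
  have -> : wt k = wt i by move: esum; rewrite /wt (_ : nat_of_ord (ord0 : 'I_N) = 0%N) //; lia.
  by rewrite mulrCA; congr (t ^ _ * _); rewrite /=; ring.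
rewrite (qdiffE q_neq0 qX_neq1).
have H := theta_coef_braid1 lt_N; rewrite /theta_coef in H.
by apply: (lincomb (c := qdsum f k x) H); ring.
Qed.

(** A diagonal normalisation that absorbs the signs, the factors [fall] and the half-integral powers
    of [q] of a parallel full twist, so that [twist_mx] remains. Its value at 0, where the cup sits,
    is 1. *)
Definition coord_scale (x : nat) : Qt := (-1) ^+ x * fall 0 x * t ^ (2 * (x%:Z * N%:Z - x%:Z * x%:Z)).
Definition framing : int := N%:Z ^+ 2 - 1.

Lemma braid0_pair (psi : state) C (G : 'cV[Qt]_N) : highest true true false psi ->
  (forall x, psi x ord0 x = C * coord_scale x * G x 0) ->
  let psi2 := iter 2 (braid0 true true true) psi in
  highest true true false psi2 /\
  forall x, psi2 x ord0 x = C * t ^ (2 * framing) * coord_scale x * (twist_mx *m G) x 0.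
Proof.
move=> hw HG psi2; have hw1 := highest_braid0 true hw; split; first exact: highest_braid0.
move=> x; rewrite /psi2 /= braid0_g // mxE.
rewrite big_mkord (big_ord_widen N (fun y => gb x y * ((-1) ^+ (x - y) * fall y x *
   q ^ (tri (x - y) - (x - y)%N%:Z - (x - y)%N%:Z * (N%:Z - 1) + (x - y)%N%:Z * y%:Z - y%:Z * (N%:Z - y%:Z)) *
   braid0 true true true psi ord0 (inord y) (inord y))) (ltn_ord x)) big_mkcond /= 2!mulr_sumr.
apply: eq_bigr => y _; rewrite ltnS inord_val mxE.
case: (leqP y x) => [le_yx|lt_xy]; last by rewrite (gb_small q lt_xy) !(mulr0, mul0r).
rewrite braid0_f HG /coord_scale -(fall_cat q N (leq0n y) le_yx) /twist_coef 2!qzE4.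
have S : (-1) ^+ x = (-1) ^+ (x - y) * (-1) ^+ y :> Qt by rewrite -exprD subnK.
have E : t ^ (wt 0 * wt x) * t ^ (4 * (tri (x - y) - (x - y)%N%:Z - (x - y)%N%:Z * (N%:Z - 1) + (x - y)%N%:Z * y%:Z - y%:Z * (N%:Z - y%:Z))) *
    t ^ (wt 0 * wt y) * t ^ (2 * (y%:Z * N%:Z - y%:Z * y%:Z)) =
  t ^ (2 * framing) * t ^ (2 * (x%:Z * N%:Z - x%:Z * x%:Z)) * t ^ (4 * (1 - N%:Z + x%:Z * x%:Z + x%:Z - 2 * N%:Z * x%:Z)).
  rewrite -!tzD; congr (t ^ _).
  have [j Ej] : exists j, nat_of_ord x = (y + j)%N by exists (x - y)%N; lia.
  rewrite Ej addKn; have T := tri2 j; rewrite /wt /framing !PoszD.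
  have -> : n.+1%:Z = n%:Z + 1 by lia.
  apply/eqP; rewrite -subr_eq0; apply/eqP.
  by transitivity (2 * (2 * tri j - (j%:Z * j%:Z + j%:Z))); [ring | rewrite T subrr mulr0].
rewrite S; apply: (lincomb (c := C * gb x y * fall 0 y * fall y x * (-1) ^+ (x - y) * (-1) ^+ y * G y 0) E); ring.
Qed.

Lemma braid1_pair (psi : state) C (G : 'cV[Qt]_N) : highest true true false psi ->
  (forall x, psi x ord0 x = C * coord_scale x * G x 0) ->
  let psi2 := braid1 false false true (braid1 false true false psi) in
  highest true true false psi2 /\
  forall x, psi2 x ord0 x = C * t ^ (2 * framing) * coord_scale x * (clasp_mx *m G) x 0.
Proof.
move=> hw HG psi2; have hw1 := highest_braid1 false hw; split; first exact: highest_braid1.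
move=> x; rewrite /psi2 /= braid1_g // mxE.
rewrite big_geq_mkord big_mkcond /= 2!mulr_sumr.
apply: eq_bigr => y _; rewrite inord_val mxE.
case: (leqP x y) => [le_xy|lt_yx]; last by rewrite (gb_small q lt_yx) !(mulr0, mul0r).
rewrite braid1_eps HG /coord_scale -(fall_cat q N (leq0n x) le_xy) 2!qzE4.
have S : (-1) ^+ y = (-1) ^+ (y - x) * (-1) ^+ x :> Qt by rewrite -exprD subnK.
have E : t ^ (wt 0 * wt x) * t ^ (4 * ((y - x)%N%:Z * (y - x)%N%:Z + (y - x)%N%:Z * (x%:Z - N%:Z + 1) +
       (y%:Z + 1) * (N%:Z - 1 - y%:Z))) *
    t ^ (wt 0 * wt y) * t ^ (2 * (y%:Z * N%:Z - y%:Z * y%:Z)) =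
  t ^ (2 * framing) * t ^ (2 * (x%:Z * N%:Z - x%:Z * x%:Z)) * t ^ (4 * (- tri y - x%:Z * y%:Z + tri x - x%:Z)).
  rewrite -!tzD; congr (t ^ _).
  have [j Ej] : exists j, nat_of_ord y = (x + j)%N by exists (y - x)%N; lia.
  rewrite Ej addKn; have T := tri2 (x + j); have T' := tri2 x; rewrite /wt /framing.
  have -> : n.+1%:Z = n%:Z + 1 by lia.
  apply/eqP; rewrite -subr_eq0; apply/eqP.
  transitivity (2 * (2 * tri (x + j) - ((x + j)%N%:Z * (x + j)%N%:Z + (x + j)%N%:Z)) -
     2 * (2 * tri x - (x%:Z * x%:Z + x%:Z))); last by rewrite T T' 2!subrr mulr0.
  by rewrite PoszD; ring.
rewrite S; apply: (lincomb (c := C * gb y x * fall 0 x * fall x y * fall x y * (-1) ^+ (y - x) * (-1) ^+ x * G y 0) E); ring.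
Qed.

(** The half-twist left over after the full antiparallel twists is followed by the cap, which only
    needs its coordinates (x,x,0), and these are given diagonally by [braid1_eps]. *)
Lemma cap_value (psi : state) C (G : 'cV[Qt]_N) :
  (forall x, psi x ord0 x = C * coord_scale x * G x 0) ->
  \sum_(x < N) t ^ (2 * weight true x) * braid1 false true false psi x x ord0 = C * t ^ framing * (eta_row 0 *m G) 0 0.
Proof.
move=> HG; rewrite mxE mulr_sumr; apply: eq_bigr => x _.
rewrite braid1_eps HG mxE /eta pch0 gbn0 mul0r oppr0 expr0z !mul1r /final_coef /coord_scale qzE4 weight_true.
have E : t ^ (2 * wt x) * t ^ (wt 0 * wt x) * t ^ (2 * (x%:Z * N%:Z - x%:Z * x%:Z)) = t ^ framing * t ^ (4 * - tri x).
  rewrite -!tzD; congr (t ^ _); have T := tri2 x; rewrite /wt /framing.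
  have -> : n.+1%:Z = n%:Z + 1 by lia.
  apply/eqP; rewrite -subr_eq0; apply/eqP.
  by transitivity (2 * (2 * tri x - (x%:Z * x%:Z + x%:Z))); [ring | rewrite T subrr mulr0].
apply: (lincomb (c := C * (-1) ^+ x * fall 0 x * G x 0) E); ring.
Qed.

Lemma cup_coord x : cup_state x ord0 x = 1 * coord_scale x * (twist_col 0) x 0.
Proof.
rewrite /cup_state /cup_coef /twist_col /= mxE eq_sym; case: (x =P ord0) => [->|ne_x].
  by rewrite /coord_scale fallnn /= mul0r subrr mulr0 expr0z !mulr1.
rewrite mul0r; case: eqP => [E|_]; last by rewrite mulr0.
by case: ne_x; apply: val_inj.
Qed.

Lemma twisted_coord (m p : nat) :
  let psi := iter m (fun psi : state => braid1 false false true (braid1 false true false psi))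
    (iter p (fun psi : state => iter 2 (braid0 true true true) psi) cup_state) in
  forall x, psi x ord0 x = t ^ (2 * framing * (p + m)%N%:Z) * coord_scale x * (iter m (mulmx clasp_mx) (twist_col p)) x 0.
Proof.
move=> psi.
have H1 : highest true true false (iter p (fun psi : state => iter 2 (braid0 true true true) psi) cup_state) /\
  forall x, iter p (fun psi : state => iter 2 (braid0 true true true) psi) cup_state x ord0 x =
    t ^ (2 * framing * p%:Z) * coord_scale x * (twist_col p) x 0.
  elim: p {psi} => [|p [hw IH]].
    split; first exact: highest_cup.
    by move=> x; rewrite mulr0 expr0z -cup_coord.
  have [hw2 IH2] := braid0_pair hw IH; split=> // x; rewrite iterS IH2 -tzD.
  by congr (t ^ _ * _ * _); lia.
suff: highest true true false psi /\ forall x, psi x ord0 x =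
    t ^ (2 * framing * (p + m)%N%:Z) * coord_scale x * (iter m (mulmx clasp_mx) (twist_col p)) x 0 by case.
rewrite /psi {psi}; elim: m => [|m [hw IH]]; first by rewrite addn0.
have [hw2 IH2] := braid1_pair hw IH; split=> // x; rewrite iterS IH2 -tzD.
by congr (t ^ _ * _ * _); lia.
Qed.

(** * Evaluation of the diagram *)

Definition represents (psi : seq 'I_N -> Qt) (Psi : state) := forall a b c, psi [:: a; b; c] = Psi a b c.

Lemma RT_twist0 k D psi Psi : represents psi Psi ->
  exists2 psi', represents psi' (iter k (braid0 true true true) Psi) &
    RT [:: true; true; false] (nseq k (Cross 0 true) ++ D) psi = RT [:: true; true; false] D psi'.
Proof.
elim: k psi Psi => [|k IH] psi Psi H; first by exists psi.
have H1 : represents (apply_slice [:: true; true; false] (Cross 0 true) psi) (braid0 true true true Psi).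
  move=> a b c; rewrite /braid0 cross_mxE /=; apply: eq_bigr => i _; apply: eq_bigr => j _.
  by rewrite mxE H.
have [psi' H' E'] := IH _ _ H1; exists psi'; first by rewrite iterSr.
by rewrite -E'.
Qed.

Lemma RT_twist1 k D psi Psi : represents psi Psi ->
  exists2 psi', represents psi' (iter k (fun psi : state => braid1 false false true (braid1 false true false psi)) Psi) &
    RT [:: true; true; false] (nseq k.*2 (Cross 1 false) ++ D) psi = RT [:: true; true; false] D psi'.
Proof.
elim: k psi Psi => [|k IH] psi Psi H; first by exists psi.
have H1 : represents (apply_slice [:: true; true; false] (Cross 1 false) psi) (braid1 false true false Psi).
  move=> a b c; rewrite /braid1 cross_mxE /=; apply: eq_bigr => i _; apply: eq_bigr => j _.
  by rewrite mxE H.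
have H2 : represents (apply_slice [:: true; false; true] (Cross 1 false)
    (apply_slice [:: true; true; false] (Cross 1 false) psi)) (braid1 false false true (braid1 false true false Psi)).
  move=> a b c; rewrite {1}/braid1 cross_mxE; apply: eq_bigr => i _; apply: eq_bigr => j _.
  by rewrite mxE -H1.
have [psi' H' E'] := IH _ _ H2; exists psi'; first by rewrite iterSr.
by rewrite -E'.
Qed.

Lemma writhe_twist0 k D : writhe [:: true; true; false] (nseq k (Cross 0 true) ++ D) =
  k%:Z + writhe [:: true; true; false] D.
Proof. by elim: k => [|k IH] /=; rewrite ?add0r // IH; lia. Qed.

Lemma writhe_twist1 k D : writhe [:: true; true; false] (nseq k.*2 (Cross 1 false) ++ D) =
  (k.*2)%:Z + writhe [:: true; true; false] D.
Proof. by elim: k => [|k IH] /=; rewrite ?add0r // IH; lia. Qed.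

Lemma colored_jones_twist (m p : nat) : (0 < p)%N ->
  colored_jones N (double_twist (- m%:Z) p%:Z) = (eta_row 0 *m iter m (mulmx clasp_mx) (twist_col p)) 0 0.
Proof.
move=> p_gt0.
have -> : double_twist (- m%:Z) p%:Z = Cup 1 true :: nseq (2 * p) (Cross 0 true) ++
    (nseq m.*2 (Cross 1 false) ++ [:: Cross 1 false; Cap 0]).
  rewrite /double_twist /half_twists.
  have -> : (0 < 2 * p%:Z)%R = true by lia.
  have -> : (0 < 2 * - m%:Z - 1)%R = false by lia.
  have -> : absz (2 * p%:Z)%R = (2 * p)%N by lia.
  have -> : absz (2 * - m%:Z - 1)%R = (m.*2 + 1)%N by lia.
  by rewrite nseqD -!catA.
set D := nseq m.*2 _ ++ _.
rewrite /colored_jones; set psi0 := fun x => _.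
have W : writhe [:: true] (Cup 1 true :: nseq (2 * p) (Cross 0 true) ++ D) = 2 * (p + m)%N%:Z + 1.
  rewrite [writhe _ _]/= writhe_twist0 /D writhe_twist1 /=; lia.
rewrite W.
have H0 : represents (apply_slice [:: true] (Cup 1 true) psi0) cup_state.
  by move=> a b c; rewrite /= /psi0 /cup_state eqseq_cons andbT.
have [psi1 H1 E1] := RT_twist0 (2 * p) D H0.
have [psi2 H2 E2] := RT_twist1 m [:: Cross 1 false; Cap 0] H1.
rewrite [RT _ _ _]/= E1 /D E2.
have Hit : iter (2 * p) (braid0 true true true) cup_state =
   iter p (fun psi : state => iter 2 (braid0 true true true) psi) cup_state.
  exact: iter_double.
rewrite Hit in H2.
have H3 : represents (apply_slice [:: true; true; false] (Cross 1 false) psi2) (braid1 false true false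
    (iter m (fun psi : state => braid1 false false true (braid1 false true false psi))
    (iter p (fun psi : state => iter 2 (braid0 true true true) psi) cup_state))).
  move=> a b c; rewrite /braid1 cross_mxE /=; apply: eq_bigr => i _; apply: eq_bigr => j _.
  by rewrite mxE H2.
have -> : RT [:: true; true; false] [:: Cross 1 false; Cap 0] psi2 [:: ord0] =
   t ^ (2 * framing * (p + m)%N%:Z) * t ^ framing * (eta_row 0 *m iter m (mulmx clasp_mx) (twist_col p)) 0 0.
  rewrite -(cap_value (@twisted_coord m p)).
  have -> : RT [:: true; true; false] [:: Cross 1 false; Cap 0] psi2 [:: ord0] = \sum_(a < N) \sum_(b < N)
     cap_coef true a b * apply_slice [:: true; true; false] (Cross 1 false) psi2 [:: a; b; ord0] by [].
  apply: eq_bigr => a _; rewrite (bigD1 a) // big1 ?addr0 => [|b ne_b]; last first.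
    by rewrite /cap_coef eq_sym (negPf ne_b) mul0r.
  by rewrite [LHS]addr0 /cap_coef eqxx; congr (_ * _); exact: H3.
(* All $2p+2m+1$ crossings are positive and each has contributed [framing], so the writhe correction
   cancels these powers exactly. *)
rewrite -tzD mulrAC -tzD (_ : _ + _ = 0) ?mul1r //; rewrite /framing; lia.
Qed.

End Representation.

(** * Translation into the stated sums *)

Lemma final_coef_qpoch (N x : nat) :
  final_coef q N x = qpoch (q ^ (1 - N%:Z)) x * q ^+ (N * x)%N * q ^ (- 2 * ('C(x.+1, 2))%:Z).
Proof.
have qzD := qzD q_neq0.
have H : qpoch (q ^ (1 - N%:Z)) x = (-1) ^+ x * fall q N 0 x * q ^ (x%:Z * (1 - N%:Z) + tri x - x%:Z).
  elim: x => [|x IH].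
    by rewrite /qpoch big_geq // fallnn !expr0 mul0r tri0 !mul1r subr0 expr0z.
  rewrite /qpoch big_nat_recr //= -/(qpoch _ _) IH (fallSr _ _ (leq0n x)) triS exprS.
  have -> : q ^ (x.+1%:Z * (1 - N%:Z) + (tri x + x%:Z + 1) - x.+1%:Z) =
     q ^ (x%:Z * (1 - N%:Z) + tri x - x%:Z) * (q ^ (1 - N%:Z) * q ^+ x).
    by rewrite exprnP -!qzD; congr (q ^ _); lia.
  have E : q ^ (1 - N%:Z) * q ^+ x * q ^ (N%:Z - 1 - x%:Z) = 1.
    by rewrite exprnP -!qzD (_ : _ + _ = 0) //; lia.
  move: E; set u := q ^ (1 - N%:Z); set v := q ^+ x; set w := q ^ (N%:Z - 1 - x%:Z) => E.
  apply: (lincomb (c := (-1) ^+ x * fall q N 0 x * q ^ (x%:Z * (1 - N%:Z) + tri x - x%:Z)) (esym E)); ring.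
rewrite H /final_coef -/(tri x) [q ^+ _]exprnP -!mulrA -!qzD; congr (_ * (_ * q ^ _)).
by have := tri2 x; rewrite PoszM; lia.
Qed.

Lemma qbinom_gb a b : (b <= a)%N -> qbinom a b = gb q a b.
Proof. by move=> le_ba; rewrite -{2}(subnKC le_ba) (gbE qX_neq1) subnKC. Qed.

Lemma sgn_wtE (N x : nat) : sgn_wt q N x = (-1) ^+ x * q ^ (- (N * x)%N%:Z + ('C(x.+1, 2))%:Z).
Proof. by rewrite /sgn_wt PoszM mulNr. Qed.

Lemma colored_jones_sum (m p N : nat) (hp : (1 <= p)%N) (hN : (1 <= N)%N) :
  let d := (2 * m + 1)%N in
  let M := (d * p)%N in
  colored_jones N (double_twist (- m%:Z) p%:Z) =
    q ^ (p%:Z * (1 - N%:Z)) *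
    \sum_(n : M.-tuple 'I_N | nondecreasing n)
      (qpoch (q ^ (1 - N%:Z)) (entry n M)
       * q ^+ (N * entry n M)%N
       * q ^ (- 2 * ('C((entry n M).+1, 2))%:Z)
       * (\prod_(1 <= i < M.+1) \prod_(i.+1 <= j < M.+1 |
             ~~ (d %| i)%N && (j != m + 1 %[mod d])%N)
            q ^ (Delta i j m * (entry n i)%:Z * (entry n j)%:Z))
       * (\prod_(1 <= i < M.+1 | (i == m + 1 %[mod d])%N)
            ((-1) ^+ entry n i
             * q ^ (- (N * entry n i)%N%:Z + ('C((entry n i).+1, 2))%:Z)))
       * (\prod_(1 <= i < M.+1 | (i == 2 * m + 1 %[mod d])%N)
            ((-1) ^+ entry n i
             * q ^ (- (N * entry n i)%N%:Z + ('C((entry n i).+1, 2))%:Z)))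
       * (\prod_(1 <= i < M)
            (q ^ (beta i m * (entry n i)%:Z)
             * qbinom (entry n i.+1) (entry n i)))).
Proof.
move=> d M; case: N hN => // N _.
rewrite colored_jones_twist // -(nested_sum_matrix q_neq0 qX_neq1) // nested_sum_tuples; congr (_ * _).
(* The nested sum runs over all tuples; a descent makes one of the Gaussian binomials vanish. *)
rewrite [LHS](bigID (@nondecreasing N.+1 M)) /= [X in _ + X]big1 ?addr0; last first.
  by move=> n; rewrite /nondecreasing -sorted_path0 => Hn; rewrite word_wt_unsorted ?mul0r.
apply: eq_bigr => n Hn.
have szn : size (map val n) = M by rewrite size_map size_tuple.
have M_gt0 : (0 < M)%N by rewrite muln_gt0 hp /d addn1.
rewrite word_wtE ?szn; [|exact: q_neq0|by rewrite /M modnMr].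
have -> : last 0%N (map val n) = entry n M.
  by rewrite /entry (last_nth 0%N) szn; case: M M_gt0 n Hn szn.
rewrite final_coef_qpoch mulrC !mulrA /entry; congr (_ * _ * _ * _).
- by apply: eq_bigr => i _; exact: sgn_wtE.
- by apply: eq_bigr => i _; exact: sgn_wtE.
rewrite /nondecreasing in Hn; have /(sortedP 0%N) Hs := Hn.
apply: eq_big_nat => i /andP[i_gt0 lt_iM]; rewrite qbinom_gb //.
by case: i i_gt0 lt_iM => // i _ lt_iM; apply: Hs; rewrite szn.
Qed.

(** For $m\ge 1$ the residues $m+1$ and $2m+1$ are distinct, so the last index $n$ carries one
    signed weight, which merges with $q^{Nn-2\binom{n+1}{2}}$ into $(-1)^nq^{-\binom{n+1}{2}}$. *)
Lemma summand_merge_last (m p N : nat) (hm : (1 <= m)%N) (hp : (1 <= p)%N) (n : (((2 * m + 1) * p)%N).-tuple 'I_N) :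
  let d := (2 * m + 1)%N in
  let M := (d * p)%N in
  qpoch (q ^ (1 - N%:Z)) (entry n M)
       * q ^+ (N * entry n M)%N
       * q ^ (- 2 * ('C((entry n M).+1, 2))%:Z)
       * (\prod_(1 <= i < M.+1) \prod_(i.+1 <= j < M.+1 |
             ~~ (d %| i)%N && (j != m + 1 %[mod d])%N)
            q ^ (Delta i j m * (entry n i)%:Z * (entry n j)%:Z))
       * (\prod_(1 <= i < M.+1 | (i == m + 1 %[mod d])%N)
            ((-1) ^+ entry n i
             * q ^ (- (N * entry n i)%N%:Z + ('C((entry n i).+1, 2))%:Z)))
       * (\prod_(1 <= i < M.+1 | (i == 2 * m + 1 %[mod d])%N)
            ((-1) ^+ entry n i
             * q ^ (- (N * entry n i)%N%:Z + ('C((entry n i).+1, 2))%:Z)))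
  = qpoch (q ^ (1 - N%:Z)) (entry n M)
       * (-1) ^+ entry n M
       * q ^ (- ('C((entry n M).+1, 2))%:Z)
       * (\prod_(1 <= i < M.+1) \prod_(i.+1 <= j < M.+1 |
             ~~ (d %| i)%N && (j != m + 1 %[mod d])%N)
            q ^ (Delta i j m * (entry n i)%:Z * (entry n j)%:Z))
       * (\prod_(1 <= i < M |
             (i == m + 1 %[mod d])%N || (i == 2 * m + 1 %[mod d])%N)
            ((-1) ^+ entry n i
             * q ^ (- (N * entry n i)%N%:Z + ('C((entry n i).+1, 2))%:Z))).
Proof.
move=> d M; set s := fun i : nat => (-1) ^+ entry n i * q ^ (- (N * entry n i)%N%:Z + ('C((entry n i).+1, 2))%:Z).
have M_gt0 : (0 < M)%N by rewrite muln_gt0 hp /d addn1.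
have -> : \prod_(1 <= i < M.+1 | (i == m + 1 %[mod d])%N) s i = \prod_(1 <= i < M | (i == m + 1 %[mod d])%N) s i.
  rewrite big_mkcond big_nat_recr //= ifN ?mulr1 -?big_mkcond //.
  by rewrite /M modnMr eq_sym /d modn_small; lia.
have -> : \prod_(1 <= i < M.+1 | (i == 2 * m + 1 %[mod d])%N) s i =
    \prod_(1 <= i < M | (i == 2 * m + 1 %[mod d])%N) s i * s M.
  by rewrite big_mkcond big_nat_recr //= -big_mkcond /= ifT // /M modnMr /d modnn.
have -> : \prod_(1 <= i < M | (i == m + 1 %[mod d])%N || (i == 2 * m + 1 %[mod d])%N) s i =
  \prod_(1 <= i < M | (i == m + 1 %[mod d])%N) s i * \prod_(1 <= i < M | (i == 2 * m + 1 %[mod d])%N) s i.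
  rewrite big_mkcond [X in _ = X * _]big_mkcond [X in _ = _ * X]big_mkcond -big_split /=.
  apply: eq_bigr => i _; case: eqP => [E1|_] /=; last by rewrite mul1r.
  by rewrite ifN ?mulr1 // E1 /d modnn modn_small; lia.
set x := entry n M.
have E : q ^+ (N * x)%N * q ^ (- 2 * ('C(x.+1, 2))%:Z) * s M = (-1) ^+ x * q ^ (- ('C(x.+1, 2))%:Z).
  rewrite /s -/x mulrCA [q ^+ _]exprnP -!(qzD q_neq0); congr (_ * q ^ _); lia.
set D := \prod_(1 <= i < M.+1) _.
set P1 := \prod_(1 <= i < M | _) _; set P2 := \prod_(1 <= i < M | _) _.
by apply: (lincomb (c := qpoch (q ^ (1 - N%:Z)) x * D * P1 * P2) E); ring.
Qed.

Theorem theorem1p2 (m p N : nat) (hp : (1 <= p)%N) (hN : (1 <= N)%N) :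
  let d := (2 * m + 1)%N in
  let M := (d * p)%N in
  colored_jones N (double_twist (- m%:Z) p%:Z) =
    q ^ (p%:Z * (1 - N%:Z)) *
    \sum_(n : M.-tuple 'I_N | nondecreasing n)
      (qpoch (q ^ (1 - N%:Z)) (entry n M)
       * q ^+ (N * entry n M)%N
       * q ^ (- 2 * ('C((entry n M).+1, 2))%:Z)
       * (\prod_(1 <= i < M.+1) \prod_(i.+1 <= j < M.+1 |
             ~~ (d %| i)%N && (j != m + 1 %[mod d])%N)
            q ^ (Delta i j m * (entry n i)%:Z * (entry n j)%:Z))
       * (\prod_(1 <= i < M.+1 | (i == m + 1 %[mod d])%N)
            ((-1) ^+ entry n i
             * q ^ (- (N * entry n i)%N%:Z + ('C((entry n i).+1, 2))%:Z)))
       * (\prod_(1 <= i < M.+1 | (i == 2 * m + 1 %[mod d])%N)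
            ((-1) ^+ entry n i
             * q ^ (- (N * entry n i)%N%:Z + ('C((entry n i).+1, 2))%:Z)))
       * (\prod_(1 <= i < M)
            (q ^ (beta i m * (entry n i)%:Z)
             * qbinom (entry n i.+1) (entry n i))))
  /\
  ((1 <= m)%N ->
   colored_jones N (double_twist (- m%:Z) p%:Z) =
    q ^ (p%:Z * (1 - N%:Z)) *
    \sum_(n : M.-tuple 'I_N | nondecreasing n)
      (qpoch (q ^ (1 - N%:Z)) (entry n M)
       * (-1) ^+ entry n M
       * q ^ (- ('C((entry n M).+1, 2))%:Z)
       * (\prod_(1 <= i < M.+1) \prod_(i.+1 <= j < M.+1 |
             ~~ (d %| i)%N && (j != m + 1 %[mod d])%N)
            q ^ (Delta i j m * (entry n i)%:Z * (entry n j)%:Z))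
       * (\prod_(1 <= i < M |
             (i == m + 1 %[mod d])%N || (i == 2 * m + 1 %[mod d])%N)
            ((-1) ^+ entry n i
             * q ^ (- (N * entry n i)%N%:Z + ('C((entry n i).+1, 2))%:Z)))
       * (\prod_(1 <= i < M)
            (q ^ (beta i m * (entry n i)%:Z)
             * qbinom (entry n i.+1) (entry n i))))).
Proof.
move=> d M; split=> [|hm]; first exact: colored_jones_sum.
rewrite colored_jones_sum //; congr (_ * _); apply: eq_bigr => n _; congr (_ * _).
exact: summand_merge_last.
Qed.
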